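(* Let $X$ be a transient Markov process with state space $E$, local time process $(L^x_t,x\in E,t\ge0)$ and Green function $g$. Let $(\psi_x,x\in E)$ be the permanental process with index $2$ associated to $X$, defined on a probability space unrelated to $X$ (so independent of $X$), with expectation denoted $\langle\cdot\rangle$. For every $a\in E$ such that $g(a,a)>0$ and every functional $F$ on the space of measurable functions from $E$ to $\mathbb{R}$, $$\tilde{\mathbb{E}}_a\Big\langle F\big(L^x_\infty+\tfrac12\psi_x;\ x\in E\big)\Big\rangle=\Big\langle\frac{\psi_a}{g(a,a)}\,F\big(\tfrac12\psi_x;\ x\in E\big)\Big\rangle.$$
   Context: The process $X$ is not assumed symmetric. Its Green function is the (finite) function $g(x,y)=\mathbb{E}_x(L^y_\infty)$, where $\mathbb{P}_x$ is the law under which $X$ starts at $x$. For $a$ with $g(a,a)>0$, the probability $\tilde{\mathbb{P}}_a$ (with expectation $\tilde{\mathbb{E}}_a$) is defined by $\tilde{\mathbb{P}}_a|_{\mathcal{F}_t}=\frac{g(X_t,a)}{g(a,a)}\mathbb{P}_a|_{\mathcal{F}_t}$, where $\mathcal{F}_t=\sigma(X_s,0\le s\le t)$; under $\tilde{\mathbb{P}}_a$ the process starts at $a$ and is killed at its last visit to $a$. The permanental process with index $2$ associated to $X$ is the nonnegative process $\psi$ whose finite-dimensional Laplace transforms are $\langle\exp\{-\frac12\sum_{i=1}^n\alpha_i\psi_{x_i}\}\rangle=|I+\alpha G|^{-1/2}$ for all $n$, $\alpha_i\ge0$, $x_i\in E$, with $\alpha=\mathrm{diag}(\alpha_i)$,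 $G=(g(x_i,x_j))_{1\le i,j\le n}$ and $|\cdot|$ the determinant. Functionals $F$ are understood to be measurable (with respect to evaluations) and bounded or nonnegative. *)

(* Defs.v *)
From HB Require Import structures.
From mathcomp Require Import all_boot all_order all_algebra.
From mathcomp Require Import all_classical all_reals all_analysis.
From mathcomp Require Import measurable_realfun.

Set Implicit Arguments.
Unset Strict Implicit.
Unset Printing Implicit Defensive.

Import Order.TTheory GRing.Theory Num.Theory.
Import numFieldNormedType.Exports.

Local Open Scope classical_set_scope.
Local Open Scope ring_scope.

(* A process with a finite or infinite lifetime is a map
   X : R -> Omega -> option E : the time set is [0, +oo[ (the values of X at
   negative times are junk), None is the cemetery point, and the lifetime is the
   infimum of the times at which X is None.  Thus "t is smaller than the lifetime" reads
   X t w <> None. *)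
Section filtration.
Context {R : realType} {dE dO : measure_display}.
Context {E : measurableType dE} {Omega : measurableType dO}.
Variable X : R -> Omega -> option E.

(* sigma(X_s, 0 <= s <= t), resp. sigma(X_s, 0 <= s); since B may be the whole
   of E, the events {X_s = cemetery} belong to these sigma-algebras. *)
Definition natural_filtration (t : R) : set (set Omega) :=
  <<s [set A | exists s B,
       [/\ 0 <= s, s <= t, measurable B & A = X s @^-1` (Some @` B)] ]>>.

Definition natural_sigma : set (set Omega) :=
  <<s [set A | exists s B,
       [/\ 0 <= s, measurable B & A = X s @^-1` (Some @` B)] ]>>.

Definition stopping_time (T : Omega -> \bar R) :=
  (forall w, 0 <= T w)%E /\
  forall t, 0 <= t -> natural_filtration t [set w | (T w <= t%:E)%E].

Definition stopped_sigma (T : Omega -> \bar R) : set (set Omega) :=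
  [set A | natural_sigma A /\
    forall t, 0 <= t -> natural_filtration t (A `&` [set w | (T w <= t%:E)%E])].

(* X_T, with the convention that X_oo is the cemetery. *)
Definition stopped (T : Omega -> \bar R) (w : Omega) : option E :=
  if T w is t%:E%E then X t w else None.

End filtration.

(* Markov property at stopping times: it is part of the setting in which local
   times are defined, and for the Markov property at fixed times only, the
   measures law x could be changed at a point that is not visited at fixed times
   without affecting the others. *)
Record markovProcess (R : realType) (dE dO : measure_display)
    (E : measurableType dE) (Omega : measurableType dO) := MarkovProcess {
  path :> R -> Omega -> option E;
  shift : R -> Omega -> Omega;
  law : R.-pker E ~> Omega;
  path_measurable : forall t B, 0 <= t -> measurable B ->
    measurable (path t @^-1` (Some @` B));
  path_cemetery : forall s t w, 0 <= s -> s <= t ->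
    path s w = None -> path t w = None;
  path_shift : forall s t w, 0 <= s -> 0 <= t ->
    path s (shift t w) = path (t + s) w;
  law_start : forall x B, measurable B ->
    law x (path 0 @^-1` (Some @` B)) = \d_x B;
  stopped_measurable : forall T, stopping_time path T ->
    forall B, measurable B ->
    stopped_sigma path T (stopped path T @^-1` (Some @` B));
  strong_markov : forall T, stopping_time path T ->
    forall A B, stopped_sigma path T A -> natural_sigma path B ->
    forall x,
    law x (A `&` [set w | stopped path T w <> None /\
                          B (shift (fine (T w)) w)]) =
    (\int[law x]_(w in A) (if stopped path T w is Some y then law y B else 0))%E
}.

Record localTime (R : realType) (dE dO : measure_display)
    (E : measurableType dE) (Omega : measurableType dO)
    (X : markovProcess R E Omega) := LocalTime {
  local_time :> E -> R -> Omega -> R;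
  local_time_adapted : forall y t B, 0 <= t -> measurable B ->
    natural_filtration X t (local_time y t @^-1` B);
  local_time_path : forall t w, 0 <= t ->
    measurable_fun setT (fun y => local_time y t w);
  local_time0 : forall y w, local_time y 0 w = 0;
  local_time_le : forall y s t w, 0 <= s -> s <= t ->
    local_time y s w <= local_time y t w;
  local_time_continuous : forall y w,
    {within `[0, +oo[, continuous (fun t => local_time y t w)};
  local_time_additive : forall x y,
    {ae law X x, forall w, forall s t, 0 <= s -> 0 <= t ->
      local_time y (s + t) w =
      local_time y s w + local_time y t (shift X s w)};
  (* The local time at y grows only while X is at y.  Only growth to the right
     of t is considered: if X jumps away from y at time t, then the local time
     at y may grow on each interval ending at t although X_t is not y.  Such
     left growth points are countably many, so the measure d_t L^y is carried by
     {t | X_t = y}. *)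
  local_time_grows : forall y t w, 0 <= t ->
    (forall s, t < s -> local_time y t w < local_time y s w) ->
    X t w = Some y
}.

Section total_local_time.
Context {R : realType} {dE dO : measure_display}.
Context {E : measurableType dE} {Omega : measurableType dO}.
Context {X : markovProcess R E Omega}.
Variable L : localTime X.

Definition total_local_time (y : E) (w : Omega) : \bar R :=
  lim ((L y t w)%:E @[t --> +oo%R]).

Lemma total_local_timeE y w :
  total_local_time y w = limn_esup (fun n => (L y n%:R w)%:E).
Proof.
pose f (t : R) := (L y (Num.max t 0) w)%:E.
have f_nd : {homo f : s t / (s <= t)%R >-> (s <= t)%E}.
  move=> s t st; rewrite lee_fin; apply: local_time_le.
    by rewrite le_max lexx orbT.
  by rewrite ge_max !le_max st lexx orbT.
have cvf := nondecreasing_cvge f_nd.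
have fE : \forall t \near +oo%R, f t = (L y t w)%:E.
  near=> t; rewrite /f; congr (L y _ w)%:E; apply/max_idPl.
  by near: t; exact: nbhs_pinfty_ge.
have cvL : (L y t w)%:E @[t --> +oo%R] --> ereal_sup (range f).
  by apply: cvg_trans cvf; exact: near_eq_cvg.
rewrite /total_local_time (cvg_lim _ cvL)//.
have cvLn := (cvge_pinftyP _ _).1 cvL _ (@cvgr_idn R).
have cLn : cvgn (fun n => (L y n%:R w)%:E) by apply/cvg_ex; eexists; exact: cvLn.
by rewrite is_cvg_limn_esupE ?(cvg_lim _ cvLn).
Unshelve. all: by end_near. Qed.

Lemma measurable_total_local_time w :
  measurable_fun setT (fun y => fine (total_local_time y w)).
Proof.
apply: (measurableT_comp (f:=fine)) => //.
rewrite (_ : total_local_time ^~ w =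
  fun y => limn_esup (fun n => (L y n%:R w)%:E)); last first.
  by apply/funext => y; exact: total_local_timeE.
apply: measurable_fun_limn_esup => n.
by apply/measurable_EFinP; exact: local_time_path.
Qed.

(* The function x |-> L^x_oo; the value 0 is used at the points x where L^x_oo
   is infinite, which for each x is an event of probability 0 when X is
   transient. *)
Definition total_local_time_path (w : Omega) (y : E) : R :=
  fine (total_local_time y w).

HB.instance Definition _ (w : Omega) :=
  isMeasurableFun.Build _ _ _ _ (total_local_time_path w)
    (measurable_total_local_time w).

Definition total_local_time_mfun (w : Omega) : {mfun E >-> R} :=
  total_local_time_path w.

Definition egreen (x y : E) : \bar R :=
  (\int[law X x]_w total_local_time y w)%E.

Definition transient := forall x y, (egreen x y < +oo)%E.

Definition green (x y : E) : R := fine (egreen x y).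

(* The change of measure P~_a = (g(X_t, a) / g(a, a)) P_a on F_t = sigma(X_s,
   0 <= s <= t), before the lifetime, for all t >= 0, with the convention that
   g(cemetery, a) = 0.  Under P_a the density is in general only a
   supermartingale; the missing mass is the probability under P~_a that X has
   been killed by time t.
   These identities determine P~_a on sigma(X_s, 0 <= s). *)
Definition is_tilted_law (a : E) (Pa : probability Omega R) :=
  forall t A, 0 <= t -> natural_filtration X t A ->
    Pa (A `&` [set w | X t w <> None]) =
    (\int[law X a]_(w in A)
       (if X t w is Some x then green x a / green a a else 0)%:E)%E.

End total_local_time.

Definition evaluation_sigma (R : realType) (dE : measure_display)
    (E : measurableType dE) : set (set {mfun E >-> R}) :=
  <<s [set A | exists (x : E) (B : set R),
       measurable B /\ A = [set f : {mfun E >-> R} | B (f x)] ]>>.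

Definition measurable_functional (R : realType) (dE : measure_display)
    (E : measurableType dE) (F : {mfun E >-> R} -> \bar R) :=
  forall B, measurable B -> evaluation_sigma (F @^-1` B).

(* Permanental process with index 2 and kernel g.  The inverse of the square
   root is 0 when the determinant is not positive, so that the Laplace identity
   contains the positivity of the determinant. *)
Definition permanental2 (R : realType) (dE dQ : measure_display)
    (E : measurableType dE) (S : measurableType dQ) (g : E -> E -> R)
    (Q : probability S R) (psi : S -> {mfun E >-> R}) :=
  [/\ forall x, measurable_fun setT (fun s => psi s x),
      forall s x, 0 <= psi s x &
      forall (n : nat) (alpha : 'rV[R]_n) (x : 'I_n -> E),
        (forall i, 0 <= alpha 0 i) ->
        (\int[Q]_s (expR (- (2^-1 * \sum_(i < n) alpha 0 i * psi s (x i))))%:E =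
         ((Num.sqrt (\det (1%:M + diag_mx alpha *m
             \matrix_(i < n, j < n) g (x i) (x j))))^-1)%:E)%E].

(* Main.v *)
(** Both sides are integrals of F against finite measures on paths, so it is
    enough to compare the Laplace transforms of finitely many coordinates, F
    being exp (- \sum_i alpha_i f (x_i)). Put G = (g (x_i, x_j)) with x_0 = a,
    A = \sum_i alpha_i L^{x_i} and D (alpha) = det (1 + alpha G).

    Local times side: v_j = E_a [\int exp (- A_t) dL_t^{x_j}] is finite, and the
    strong Markov property at the times when the local times grow gives
    v (1 + alpha G) = (row a of G). It is obtained by discretizing time: the
    error terms are cross variations of continuous nondecreasing processes,
    dominated because L_infinity^x has finite second moments. By Cramer's rule
    g (a, a) tE_a [exp (- A_infinity)] = v_0 = D' / D, where D' is the derivative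
    of D in the weight of a, D being affine in that weight.

    Permanental side: <psi_a exp (- 1/2 \sum_i alpha_i psi_{x_i})> is -2 times
    the derivative of D^{-1/2} in the weight of a, that is D' / D^{3/2}.

    The two sides agree since <exp (- 1/2 \sum_i alpha_i psi_{x_i})> = D^{-1/2}.
    Laplace transforms of several variables determine the measure because
    (1 - exp (- n x)) ^ N_n tends to the indicator of x > t for N_n ~ n exp (n t). *)

Require Import Defs.
From HB Require Import structures.
From mathcomp Require Import all_boot all_order all_algebra.
From mathcomp Require Import all_classical all_reals all_analysis.
From mathcomp Require Import measurable_realfun.
From mathcomp Require Import ring lra.

Import Order.TTheory GRing.Theory Num.Theory.
Import numFieldNormedType.Exports.

Local Open Scope classical_set_scope.
Local Open Scope ring_scope.

Set Implicit Arguments.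
Unset Strict Implicit.
Unset Printing Implicit Defensive.

(** * Laplace transforms determine finite measures *)

(** Integrals against dL_t are never formed. A layer cake turns E [K_t W] into an integral over
    levels r of expectations on {K_t >= r}, and the strong Markov property is applied at the hitting
    time of each level. The obstacle is that X is known to sit at y at this time only if K grows
    immediately afterwards. A level at which K pauses is a value of K at a rational time, and
    Tonelli shows that almost no level is such a value with positive probability. Since the position
    of the hit inside a grid interval is unknown, the outcome is a pair of inequalities, and the
    resolvent equation becomes a sandwich whose gap tends to 0.

    The tilted law is prescribed only on each F_t before the lifetime, so total local times are
    reached through the death: against F_s-measurable weights, being killed between two grid times s
    and t has density (L_t^a - L_s^a) / g (a, a) with respect to P_a. This is how tE_a
    [exp (- A_infinity)] becomes a limit of Riemann sums for v_0 / g (a, a). *)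

Section layer_cake.
Context d (T : measurableType d) (R : realType).
Variable mu : {sigma_finite_measure set T -> \bar R}.
Local Open Scope ereal_scope.

Variables f W : T -> \bar R.
Hypotheses (mf : measurable_fun setT f) (f0 : forall x, 0 <= f x).
Hypotheses (mW : measurable_fun setT W) (W0 : forall x, 0 <= W x).

Let B : set (T * measurableTypeR R) := [set p | (0 < p.2)%R /\ p.2%:E <= f p.1].

Let mB : measurable B.
Proof.
rewrite (_ : B = [set p | (0 < p.2)%R] `&` [set p | p.2%:E <= f p.1]); last first.
  by apply/seteqP; split => p [].
apply: measurableI.
  rewrite -[X in measurable X]setTI.
  rewrite (_ : [set p | _] = [set p | 0%:E < (p.2)%:E])//.
  apply: measurable_lte => //.
  by apply/measurable_EFinP; apply: measurable_snd.
rewrite -[X in measurable X]setTI.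
apply: measurable_lee => //.
  by apply/measurable_EFinP; apply: measurable_snd.
by apply: measurableT_comp => //; apply: measurable_fst.
Qed.

Let G (p : T * measurableTypeR R) := (\1_B p)%:E * W p.1.

Let mG : measurable_fun setT G.
Proof.
apply: emeasurable_funM.
  by apply/measurable_EFinP; exact: measurable_indic.
by apply: measurableT_comp => //; apply: measurable_fst.
Qed.

Let G0 p : 0 <= G p. Proof. by rewrite /G mule_ge0. Qed.

Let layerE (r : R) : (0 < r)%R ->
  \int[mu]_x G (x, r) = \int[mu]_(x in [set x | r%:E <= f x]) W x.
Proof.
move=> r0; rewrite [RHS]integral_mkcond; apply: eq_integral => x _ /=.
rewrite patchE /G indicE.
have -> : ((x, r) \in B) = (x \in [set x | r%:E <= f x]).
  by apply/idP/idP; rewrite !inE /B/=; [case|].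
by case: ifPn => _; rewrite ?mul1e ?mul0e.
Qed.

Lemma measurable_fun_layer :
  measurable_fun (`]0%R, +oo[%classic : set (measurableTypeR R))
  (fun r : measurableTypeR R => \int[mu]_(x in [set x | r%:E <= f x]) W x).
Proof.
apply: (eq_measurable_fun (fun r : measurableTypeR R => \int[mu]_x G (x, r))).
  by move=> r; rewrite inE/= in_itv/= andbT => /layerE.
apply: measurable_funTS.
apply: (measurable_fun_fubini_tonelli_G G) => //.
Qed.

(** Tonelli on the region under the graph of [f], weighted by [W]. Keeping [W] apart from [f]
    leaves, at each level, an integral over {f >= r}, which is the form in which the strong Markov
    property is used. The value [+oo] of [f] is allowed: its layer is all of ]0, +oo[. *)
Lemma ge0_layer_cake : \int[mu]_x (f x * W x) =
  \int[lebesgue_measure]_(r in `]0%R, +oo[) \int[mu]_(x in [set x | r%:E <= f x]) W x.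
Proof.
transitivity (\int[mu]_x \int[lebesgue_measure]_r G (x, r)).
  apply: eq_integral => x _.
  under [RHS]eq_integral do rewrite /G /= muleC.
  have m1 : measurable_fun setT
      (fun r : measurableTypeR R => (\1_B (x, r))%:E : \bar R).
    by apply/measurable_EFinP; apply: measurableT_comp => //.
  rewrite ge0_integralZl//.
  rewrite muleC; congr (_ * _).
  have -> : (fun r : measurableTypeR R => (\1_B (x, r))%:E : \bar R) =
      (fun r => (\1_(xsection B x) r)%:E).
    apply/funext => r; congr (_%:E); rewrite /indic.
    by congr (nat_of_bool _)%:R; apply/idP/idP; rewrite !inE /xsection/= inE.
  rewrite integral_indic//; last exact: measurable_xsection.
  rewrite setIT.
  have fx0 := f0 x; case fxE : (f x) fx0 => [s| |] // s0.
    have -> : xsection B x = `]0%R, s]%classic.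
      apply/seteqP; split => r; rewrite /xsection/= inE /B/= fxE in_itv/= lee_fin.
        by case=> -> ->.
      by move/andP.
    move: s0; rewrite lee_fin => s0.
    rewrite [RHS]lebesgue_measure_itv/= lte_fin sube0; by case: ltgtP s0 => // <-.
  have -> : xsection B x = `]0%R, +oo[%classic.
    apply/seteqP; split => r; rewrite /xsection/= inE /B/= fxE in_itv/= andbT leey.
      by case.
    by [].
  by rewrite [RHS]lebesgue_measure_itv/= ltry oppr0.
rewrite (fubini_tonelli G mG G0).
rewrite [RHS]integral_mkcond.
apply: eq_integral => r _; rewrite patchE; case: ifPn => r0.
  by apply: layerE; move: r0; rewrite inE/= in_itv/= andbT.
rewrite integral0_eq// => x _ /=.
rewrite /G indicE memNset ?mul0e// /B/= => -[r0' _].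
by move/negP: r0; apply; rewrite inE/= in_itv/= andbT.
Qed.

End layer_cake.

Section layer_cake_restrict.
Context d (T : measurableType d) (R : realType).
Variable mu : {sigma_finite_measure set T -> \bar R}.
Local Open Scope ereal_scope.

Lemma ge0_layer_cake_restrict (f : T -> \bar R) (D : set T) :
  measurable D -> measurable_fun setT f -> (forall x, 0 <= f x) ->
  \int[mu]_(x in D) f x =
  \int[lebesgue_measure]_(r in `]0%R, +oo[) mu (D `&` [set x | r%:E <= f x]).
Proof.
move=> mD mf f0.
have -> : \int[mu]_(x in D) f x = \int[mu]_x (f x * (\1_D x)%:E).
  rewrite integral_mkcond; apply: eq_integral => x _.
  by rewrite patchE indicE; case: ifPn => _; rewrite ?mule1 ?mule0.
rewrite (@ge0_layer_cake _ _ _ mu f (fun x => (\1_D x)%:E))//; last first.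
  by apply/measurable_EFinP; exact: measurable_indic.
apply: eq_integral => r _.
rewrite integral_indic//.
by rewrite -[X in measurable X]setTI; apply: measurable_lee.
Qed.

Lemma measurable_fun_layer_restrict (f : T -> \bar R) (D : set T) :
  measurable D -> measurable_fun setT f -> (forall x, 0 <= f x) ->
  measurable_fun (`]0%R, +oo[%classic : set (measurableTypeR R))
    (fun r : measurableTypeR R => mu (D `&` [set x | r%:E <= f x])).
Proof.
move=> mD mf f0.
apply: (eq_measurable_fun (fun r : measurableTypeR R =>
    \int[mu]_(x in [set x | r%:E <= f x]) (\1_D x)%:E)).
  move=> r _; rewrite integral_indic//.
  by rewrite -[X in measurable X]setTI; apply: measurable_lee.
apply: measurable_fun_layer => //.
by apply/measurable_EFinP; exact: measurable_indic.
Qed.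

End layer_cake_restrict.

(** * Approximation of half-line indicators by polynomials in exponentials *)

Section threshold.
Variable R : realType.
Implicit Types t x y : R.

Lemma bernoulli_ge y N : 0 <= y -> y <= 1 -> 1 - N%:R * y <= (1 - y) ^+ N.
Proof.
move=> y0 y1; elim: N => [|N IH]; first by rewrite expr0 mul0r subr0.
rewrite exprS -natr1; apply: (@le_trans _ _ ((1 - y) * (1 - N%:R * y))).
  have : 0 <= N%:R * y ^+ 2 by rewrite mulr_ge0// exprn_ge0.
  have -> : (1 - y) * (1 - N%:R * y) = 1 - (N%:R + 1) * y + N%:R * y ^+ 2 by ring.
  by rewrite lerDl.
by rewrite ler_wpM2l// subr_ge0.
Qed.

(** By induction, from (1 - y) (1 + (N + 1) y) <= 1 + N y. This rational bound plays the part of exp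
    (- N y). *)
Lemma bernoulli_le y N : 0 <= y -> y <= 1 -> (1 - y) ^+ N <= (1 + N%:R * y)^-1.
Proof.
move=> y0 y1.
have p (n : nat) : 0 < 1 + n%:R * y by rewrite ltr_pwDl// mulr_ge0.
elim: N => [|N IH]; first by rewrite expr0 mul0r addr0 invr1.
rewrite exprS; apply: (@le_trans _ _ ((1 - y) * (1 + N%:R * y)^-1)).
  by rewrite ler_wpM2l// subr_ge0.
rewrite ler_pdivrMr ?p// mulrC ler_pdivlMr ?p// -natr1.
have -> : (1 - y) * (1 + (N%:R + 1) * y) =
  1 + N%:R * y - (y ^+ 2 + N%:R * y ^+ 2) by ring.
by rewrite gerBl addr_ge0// ?mulr_ge0// exprn_ge0.
Qed.

(** The product of the exponent and exp (- n x), of order n exp (n (t - x)), decides the limit: it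
    tends to 0 for x > t and to infinity for x <= t. The factor n settles the case x = t, so that
    the strict inequality appears in the limit. *)
Definition threshold t (n : nat) x : R :=
  (1 - expR (- (n%:R * x))) ^+ (Num.truncn (n%:R * expR (n%:R * t))).+1.

Lemma cvg_inv_affine (c : R) : 0 < c -> (1 + n%:R * c)^-1 @[n --> \oo] --> (0 : R).
Proof.
move=> c0; apply/cvgr0Pnorm_lt => e e0; near=> n.
have np : 0 < 1 + n%:R * c by rewrite ltr_pwDl// mulr_ge0// ltW.
rewrite ger0_norm ?invr_ge0 ?ltW// invf_plt ?posrE//.
have : e^-1 / c < n%:R by near: n; exact: nbhs_infty_gtr.
by rewrite ltr_pdivrMr// => /lt_le_trans; apply; rewrite lerDr.
Unshelve. all: by end_near. Qed.

Lemma threshold_cvg t x : 0 <= t -> 0 <= x ->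
  threshold t n x @[n --> \oo] --> ((t < x)%R%:R : R).
Proof.
move=> t0 x0.
have eb n : 0 <= expR (- (n%:R * x)) <= 1.
  by rewrite expR_ge0 -[leRHS]expR0 ler_expR oppr_le0 mulr_ge0.
have [tx|xt] := ltP t x; rewrite /threshold.
- rewrite [nat_of_bool _]/=.
  pose d := x - t; have d0 : 0 < d by rewrite subr_gt0.
  (* [C] is chosen so that n + 1 <= C (1 + n d / 2). As exp (n d) >= (1 + n d / 2)^2, the error (n +
     1) exp (- n d) is at most C / (1 + n d / 2). *)
  pose C := 1 + 2 / d; have C0 : 0 < C by rewrite ltr_pwDl// divr_ge0// ltW.
  have lo : 1 - C * (1 + n%:R * (d / 2))^-1 @[n --> \oo] --> (1 : R).
    rewrite -[X in _ --> X]subr0 -[X in _ --> _ - X](mulr0 C).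
    by apply: cvgB; [exact: cvg_cst|apply: cvgMr; apply: cvg_inv_affine;
      rewrite divr_gt0].
  apply: (squeeze_cvgr (h := cst 1) _ lo); [|exact: cvg_cst]; near=> n.
  have /andP[e0 e1] := eb n.
  apply/andP; split; last first.
    by rewrite exprn_ile1// ?subr_ge0// gerBl.
  apply: le_trans (bernoulli_ge _ e0 e1); rewrite lerD2l lerN2.
  apply: (@le_trans _ _ ((n%:R * expR (n%:R * t) + 1) * expR (- (n%:R * x)))).
    rewrite ler_wpM2r// -natr1 lerD2r.
    by rewrite truncn_le mulr_ge0// expR_ge0.
  apply: (@le_trans _ _ ((n%:R + 1) * expR (- (n%:R * d)))).
    rewrite mulrDl mul1r -mulrA -expRD mulrDl mul1r lerD//.
      by rewrite ler_wpM2l// ler_expR /d; lra.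
    rewrite ler_expR /d; have nt : 0 <= n%:R * t by exact: mulr_ge0.
    by lra.
  have sq : (1 + n%:R * (d / 2)) ^+ 2 <= expR (n%:R * d).
    have -> : n%:R * d = n%:R * (d / 2) + n%:R * (d / 2) by field.
    rewrite expRD -expr2 ler_sqr ?nnegrE ?expR_ge0// ?expR_ge1Dx//.
    by rewrite addr_ge0// mulr_ge0// divr_ge0// ltW.
  have q0 : 0 < 1 + n%:R * (d / 2) by rewrite ltr_pwDl// mulr_ge0// divr_ge0// ltW.
  rewrite expRN ler_pdivrMr ?expR_gt0// mulrAC -mulrA.
  apply: (@le_trans _ _ (C * ((1 + n%:R * (d / 2)) ^+ 2 / (1 + n%:R * (d / 2))))); last first.
    by rewrite ler_pM2l// ler_pM2r// invr_gt0.
  rewrite expr2 mulfK ?gt_eqF// /C.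
  have -> : (1 + 2 / d) * (1 + n%:R * (d / 2)) =
    n%:R + 1 + (2 / d + n%:R * (d / 2)) by field; rewrite gt_eqF.
  by rewrite lerDl addr_ge0// !mulr_ge0// ?invr_ge0// ltW.
- rewrite [nat_of_bool _]/=.
  apply: (squeeze_cvgr (f := cst 0) _ _ (cvg_inv_affine (@ltr01 R)));
    [|exact: cvg_cst]; near=> n.
  have /andP[e0 e1] := eb n.
  rewrite exprn_ge0 ?subr_ge0//=.
  apply: le_trans (bernoulli_le _ e0 e1) _.
  rewrite lef_pV2 ?posrE ?ltr_pwDl ?mulr_ge0// lerD2l mulr1.
  apply: (@le_trans _ _ ((n%:R * expR (n%:R * t)) * expR (- (n%:R * x)))).
    rewrite -mulrA -expRD -[leLHS]mulr1 ler_wpM2l// -[leLHS]expR0 ler_expR.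
    have ntx : n%:R * x <= n%:R * t by exact: ler_wpM2l.
    by lra.
  by rewrite ler_wpM2r// ltW// truncnS_gt.
Unshelve. all: by end_near. Qed.

End threshold.

Section bounded_convergence.
Context d (T : measurableType d) (R : realType).
Variable m : {finite_measure set T -> \bar R}.

Lemma bounded_integrable (f : T -> R) (M : R) : measurable_fun setT f ->
  (forall x, `|f x| <= M) -> m.-integrable setT (EFin \o f).
Proof.
move=> mf fM; apply: measurable_bounded_integrable => //.
  by rewrite ltey_eq fin_num_measure.
exists M; split; first exact: num_real.
by move=> K MK x _; exact: le_trans (fM x) (ltW MK).
Qed.

Lemma bounded_cvg (f_ : nat -> T -> R) (f : T -> R) (M : R) :
  (forall n, measurable_fun setT (f_ n)) ->
  (forall n x, `|f_ n x| <= M) -> (forall x, f_ n x @[n --> \oo] --> f x) ->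
  (\int[m]_x (f_ n x)%:E @[n --> \oo] --> \int[m]_x (f x)%:E)%E.
Proof.
move=> mf fM ff.
have mlim : measurable_fun setT f.
  by apply: (measurable_fun_cvg mf) => x _; exact: ff.
have [|||||_ _] := @dominated_convergence _ T R m setT measurableT
  (fun n x => (f_ n x)%:E) (EFin \o f) (cst M%:E); last by [].
- by move=> n; exact/measurable_EFinP.
- exact/measurable_EFinP.
- by apply: aeW => x _; apply: cvg_EFin; [exact: nearW|exact: ff].
- exact: finite_measure_integrable_cst.
- by apply: aeW => x n _; rewrite /= lee_fin.
Qed.

End bounded_convergence.

(** * Uniqueness of multivariate Laplace transforms *)

Section laplace_uniqueness.
Context d (T : measurableType d) (R : realType) (I : eqType).
Variable f : I -> T -> R.
Hypothesis mf : forall i, measurable_fun setT (f i).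
Hypothesis f0 : forall i x, 0 <= f i x.

Definition weighted_sum (s : seq (R * I)) (x : T) := \sum_(p <- s) p.1 * f p.2 x.

Definition nonneg_weights (s : seq (R * I)) := all (fun p => 0 <= p.1) s.

Lemma measurable_weighted_sum s : measurable_fun setT (weighted_sum s).
Proof.
apply: measurable_sum => p; apply: measurable_funM => //.
Qed.

Lemma weighted_sum_ge0 s x : nonneg_weights s -> 0 <= weighted_sum s x.
Proof.
move=> s0; rewrite /weighted_sum big_seq sumr_ge0// => p ps.
by rewrite mulr_ge0// (allP s0).
Qed.

Lemma measurable_expN_weighted_sum s :
  measurable_fun setT (fun x => expR (- weighted_sum s x)).
Proof.
apply: measurableT_comp => //; apply: measurableT_comp => //.
exact: measurable_weighted_sum.
Qed.

Lemma expN_weighted_sum_le1 s x : nonneg_weights s -> expR (- weighted_sum s x) <= 1.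
Proof. by move=> s0; rewrite -[leRHS]expR0 ler_expR oppr_le0 weighted_sum_ge0. Qed.

Variables m1 m2 : {finite_measure set T -> \bar R}.

(** The weights phi that may be put under both integrals. Once the Laplace transforms agree, this
    class contains 1; it is closed under multiplication by 1 - exp (- c f_i) and under pointwise
    limits, hence reaches indicators of orthants. The bound by 1 provides the domination in the
    limits. *)
Definition same_laplace (phi : T -> R) := [/\ measurable_fun setT phi,
  forall x, 0 <= phi x <= 1 &
  forall s, nonneg_weights s ->
    (\int[m1]_x (phi x * expR (- weighted_sum s x))%:E =
     \int[m2]_x (phi x * expR (- weighted_sum s x))%:E)%E].

Let phi_exp phi s x : same_laplace phi -> nonneg_weights s ->
  `|phi x * expR (- weighted_sum s x)| <= 1.
Proof.
move=> [_ phi01 _] s0; have /andP[p0 p1] := phi01 x.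
rewrite ger0_norm ?mulr_ge0 ?expR_ge0//.
by rewrite mulr_ile1 ?expR_ge0// expN_weighted_sum_le1.
Qed.

Let mphi_exp phi s : same_laplace phi ->
  measurable_fun setT (fun x => phi x * expR (- weighted_sum s x)).
Proof.
move=> [mphi _ _]; apply: measurable_funM => //.
exact: measurable_expN_weighted_sum.
Qed.

(** Multiplying by exp (- c f_i) only adds the pair (c, i) to the list of weights, so two instances
    of the identity for [phi] are subtracted. *)
Lemma same_laplace_mul1BexpN phi c i : 0 <= c -> same_laplace phi ->
  same_laplace (fun x => phi x * (1 - expR (- (c * f i x)))).
Proof.
move=> c0 Hphi; have [mphi phi01 lphi] := Hphi.
have e01 x : 0 <= 1 - expR (- (c * f i x)) <= 1.
  rewrite subr_ge0 gerBl expR_ge0 andbT -[leRHS]expR0 ler_expR oppr_le0.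
  by rewrite mulr_ge0.
split.
- apply: measurable_funM => //; apply: measurable_funB => //.
  apply: measurableT_comp => //; apply: measurableT_comp => //.
  exact: measurable_funM.
- move=> x; have /andP[p0 p1] := phi01 x; have /andP[e0 e1] := e01 x.
  by rewrite mulr_ge0// mulr_ile1.
- move=> s s0; pose s' := (c, i) :: s.
  have s'0 : nonneg_weights s' by rewrite /nonneg_weights /= c0.
  have E x : (phi x * (1 - expR (- (c * f i x))) * expR (- weighted_sum s x))%:E =
      ((phi x * expR (- weighted_sum s x))%:E -
      (phi x * expR (- weighted_sum s' x))%:E)%E.
    rewrite -EFinB; congr (_%:E).
    rewrite {3}/weighted_sum big_cons /= opprD expRD /weighted_sum; ring.
  under eq_integral do rewrite E.
  under [RHS]eq_integral do rewrite E.
  have int (m : {finite_measure set T -> \bar R}) (t : seq (R * I)) :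
      nonneg_weights t ->
      m.-integrable setT (EFin \o (fun x => phi x * expR (- weighted_sum t x))).
    by move=> t0; apply: (@bounded_integrable _ _ _ _ _ 1) => [|x];
      [exact: mphi_exp|exact: phi_exp].
  by rewrite !integralB_EFin ?lphi//; apply: int.
Qed.

Lemma same_laplace_lim (phi_ : nat -> T -> R) phi :
  (forall n, same_laplace (phi_ n)) ->
  (forall x, phi_ n x @[n --> \oo] --> phi x) -> same_laplace phi.
Proof.
move=> Hphi cphi; split.
- by apply: (measurable_fun_cvg (h := phi_)) => [n|x _]; [case: (Hphi n)|].
- move=> x; have cx := cphi x; apply/andP; split.
    apply: (cvgr_to_ge cx); apply: nearW => n.
    by have [_ /(_ x)/andP[]] := Hphi n.
  apply: (cvgr_to_le cx); apply: nearW => n.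
  by have [_ /(_ x)/andP[]] := Hphi n.
- move=> s s0.
  have lim (m : {finite_measure set T -> \bar R}) :
      (\int[m]_x (phi_ n x * expR (- weighted_sum s x))%:E @[n --> \oo] -->
       \int[m]_x (phi x * expR (- weighted_sum s x))%:E)%E.
    apply: (@bounded_cvg _ _ _ _ _ _ 1) => [n|n x|x]; first exact: mphi_exp.
      exact: phi_exp.
    by apply: cvgMl; exact: cphi.
  have := lim m2; rewrite (_ : (fun n => _) = (fun n =>
    \int[m1]_x (phi_ n x * expR (- weighted_sum s x))%:E)%E); last first.
    by apply/funext => n; have [_ _ ->] := Hphi n.
  by move=> /(cvg_unique _ (lim m1)); exact.
Qed.

Lemma same_laplace_gt phi t i : 0 <= t -> same_laplace phi ->
  same_laplace (fun x => phi x * (t < f i x)%R%:R).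
Proof.
move=> t0 Hphi.
apply: (same_laplace_lim (phi_ := fun n x => phi x * threshold t n (f i x))).
  move=> n; rewrite /threshold; elim: (_.+1) => [|k IH].
    by under eq_fun do rewrite expr0 mulr1.
  under eq_fun do rewrite exprSr mulrA.
  exact: same_laplace_mul1BexpN.
by move=> x; apply: cvgMr; exact: threshold_cvg.
Qed.

Let orthant (s : seq (R * I)) : set T := [set x | all (fun p => p.1 < f p.2 x) s].

Let same_laplace_orthant s : nonneg_weights s ->
  same_laplace (fun=> 1) -> same_laplace (\1_(orthant s)).
Proof.
move=> + H1; elim: s => [_|[t i] s IH /= /andP[/= t0 s0]].
  have -> : orthant [::] = setT by apply/seteqP.
  by rewrite indicT.
have -> : \1_(orthant ((t, i) :: s)) =
    (fun x => \1_(orthant s) x * (t < f i x)%R%:R) :> (T -> R).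
  apply/funext => x; rewrite !indicE -natrM mulnb; congr ((nat_of_bool _)%:R).
  apply/idP/andP; rewrite !inE /orthant/=; first by case/andP.
  by case=> -> ->.
by apply: same_laplace_gt => //; exact: IH.
Qed.

Let orthants : set (set T) := [set A | exists2 s, nonneg_weights s & A = orthant s].

Let measurable_orthant s : measurable (orthant s).
Proof.
elim: s => [|[t i] s IH].
  by have -> : orthant [::] = setT by apply/seteqP.
have -> : orthant ((t, i) :: s) = [set x | t < f i x] `&` orthant s.
  by apply/seteqP; split => x; rewrite /orthant /=; [move/andP|case=> -> ->].
apply: measurableI => //; rewrite (_ : mkset _ = f i @^-1` `]t, +oo[).
  by rewrite -[X in measurable X]setTI; exact: mf.
by apply/seteqP; split => x; rewrite /= in_itv/= andbT.
Qed.

(** Orthants with nonnegative corners are stable under intersection (the lists are concatenated) and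
    generate the sigma-algebra of the f_i: a half-line that starts at a negative level pulls back to
    the whole space because f_i >= 0. *)
Theorem laplace_measure_unique :
  (forall s, nonneg_weights s ->
    (\int[m1]_x (expR (- weighted_sum s x))%:E =
     \int[m2]_x (expR (- weighted_sum s x))%:E)%E) ->
  forall B, <<s [set A | exists i C, measurable C /\ A = f i @^-1` C] >> B ->
  m1 B = m2 B.
Proof.
move=> H B sB.
have H1 : same_laplace (fun=> 1).
  split; [exact: measurable_cst|by move=> x; rewrite lexx ler01|move=> s s0].
  by under eq_integral do rewrite mul1r; under [RHS]eq_integral do rewrite mul1r;
    exact: H.
apply: (@g_sigma_algebra_measure_unique _ R T orthants _ (fun=> setT)).
- by move=> _ [s _ ->]; exact: measurable_orthant.
- by move=> _; exists [::] => //; apply/seteqP.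
- by rewrite bigcup_const//; exists 0%N.
- move=> _ _ [s s0 ->] [s' s'0 ->]; exists (s ++ s').
    by rewrite /nonneg_weights all_cat -/(nonneg_weights s) s0.
  by apply/seteqP; split => x; rewrite /orthant /= all_cat; [case=> -> ->|move/andP].
- move=> _ [s s0 ->]; have [_ _ /(_ [::] isT)] := same_laplace_orthant s0 H1.
  have E (m : {finite_measure set T -> \bar R}) :
      (\int[m]_x (\1_(orthant s) x * expR (- weighted_sum [::] x))%:E = m (orthant s))%E.
    under eq_integral do rewrite /weighted_sum big_nil oppr0 expR0 mulr1.
    by rewrite integral_indic ?setIT//; exact: measurable_orthant.
  by rewrite !E.
- by move=> _; rewrite ltey_eq fin_num_measure.
- apply: smallest_sub sB; first exact: smallest_sigma_algebra.
  move=> _ [i [C [mC ->]]].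
  have : measurable_fun (setT : set (g_sigma_algebraType orthants)) (f i).
    move=> mT; apply: (measurability _ (RGenOInfty.measurableE R)) => // _ [_ [t ->] <-].
    have [t0|t0] := leP 0 t.
      apply: sub_sigma_algebra; exists [:: (t, i)] => /=; first by rewrite t0.
      by apply/seteqP; split => x; rewrite /orthant /= in_itv/= andbT => // -[].
    rewrite (_ : _ `&` _ = setT)//; apply/seteqP; split => x //= _; split => //.
    by rewrite in_itv/= andbT (lt_le_trans t0).
  by move=> /(_ measurableT C mC); rewrite setTI.
Qed.

End laplace_uniqueness.

(** * Cross variations of continuous nondecreasing functions *)

Section continuous_nondecreasing.
Variable R : realType.
Implicit Types (f : R -> R) (t u v c e r : R).

Let mem_le_sup (S : set R) t : has_ubound S -> S t -> t <= sup S.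
Proof. by move=> /ub_le_sup; exact. Qed.

Let mem_ge_inf (S : set R) t : has_lbound S -> S t -> inf S <= t.
Proof. by move=> /ge_inf; exact. Qed.

Definition nondecr_ge0 f := forall s t, 0 <= s -> s <= t -> f s <= f t.

Lemma within_ge0_continuousP f : {within `[0, +oo[, continuous f} ->
  forall c e, 0 <= c -> 0 < e ->
  exists2 h, 0 < h & forall x, 0 <= x -> `|x - c| < h -> `|f x - f c| < e.
Proof.
move=> cf c e c0 e0.
have cA : `[0, +oo[%classic c by rewrite /= in_itv/= c0.
have := ((subspace_continuousP _ _).1 cf) c cA => /cvgrPdist_lt /(_ _ e0).
rewrite /prop_near1 /= /within /= => -[h h0 hf]; exists h => // x x0 xc.
by rewrite distrC; apply: hf; rewrite /= ?in_itv/= ?x0// distrC.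
Qed.

Lemma within_ge0_continuous f :
  (forall c e, 0 <= c -> 0 < e ->
    exists2 h, 0 < h & forall x, 0 <= x -> `|x - c| < h -> `|f x - f c| < e) ->
  {within `[0, +oo[, continuous f}.
Proof.
move=> H; apply/subspace_continuousP => c /=; rewrite in_itv/= andbT => c0.
apply/cvgrPdist_lt => e e0; have [h h0 Hh] := H c e c0 e0.
rewrite /prop_near1 /= /within /=; exists h => // x /= cx.
by rewrite in_itv/= andbT => x0; rewrite distrC; apply: Hh; rewrite // distrC.
Qed.

(** A supremum argument in place of compactness: if [P] holds up to t close to the supremum s,
    continuity at s carries it up to s + h / 4. Only u is confined to [0, c]; v may lie beyond c, as
    is used in [unif_continuous_bounded]. *)
Lemma unif_continuous_segment f e c : {within `[0, +oo[, continuous f} -> 0 < e ->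
  exists2 h, 0 < h & forall u v, 0 <= u -> u <= c -> u <= v -> v <= u + h ->
    `|f v - f u| <= e.
Proof.
move=> cf e0.
pose P t := exists2 h, 0 < h & forall u v, 0 <= u -> u <= t -> u <= v ->
  v <= u + h -> `|f v - f u| <= e.
have [//|nPc] := pselect (P c).
have Pmono t t' : t <= t' -> P t' -> P t.
  move=> tt' [h h0 H]; exists h => // u v u0 ut; apply: H => //.
  exact: le_trans tt'.
have PN t : t < 0 -> P t.
  by move=> t0; exists 1 => // u v u0 ut; have := le_lt_trans (le_trans u0 ut) t0;
    rewrite ltxx.
pose S := [set t | P t].
have S0 : S (-1) by apply: PN; lra.
have ubS : ubound S c.
  by move=> t Pt; rewrite leNgt; apply/negP => /ltW /Pmono /(_ Pt).
have hsS : has_sup S by split; [exists (-1)|exists c].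
pose s := sup S.
have s0 : 0 <= s.
  apply/ler_addgt0Pl => d d0; rewrite -lerBlDl sub0r.
  apply: mem_le_sup; [by exists c|apply: PN; lra].
have [h h0 H] := within_ge0_continuousP cf s0 (divr_gt0 e0 (@ltr0Sn R 1)).
have [t Pt st] := sup_adherent (divr_gt0 h0 (@ltr0Sn R 1)) hsS.
have [d d0 Hd] := Pt.
have h40 : 0 < h / 4 by rewrite divr_gt0.
(* For u > t > s - h / 2 and v - u <= h / 4, both points are within h of s, and f varies by less
   than e / 2 + e / 2 between them. *)
suff : P (s + h / 4).
  by move=> Ps; have := mem_le_sup (ex_intro _ c ubS) Ps; rewrite -/s; lra.
exists (Num.min d (h / 4)); first by rewrite lt_min d0.
move=> u v u0 us uv; rewrite -lerBlDl le_min => /andP[vd vh].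
have [ut|tu] := leP u t; first by apply: Hd => //; lra.
have Hu : `|f u - f s| < e / 2.
  by apply: H => //; rewrite ltr_norml; apply/andP; split; rewrite -/s in st *; lra.
have Hv : `|f v - f s| < e / 2.
  apply: H; first exact: le_trans uv.
  by rewrite ltr_norml; apply/andP; split; rewrite -/s in st *; lra.
move: Hu Hv; rewrite !ltr_norml => /andP[? ?] /andP[? ?].
by rewrite ler_norml; apply/andP; split; lra.
Qed.

(** Past a time c at which f is within e of its supremum, monotonicity bounds the oscillation; up to
    c, uniform continuity does. *)
Lemma unif_continuous_bounded f e M : {within `[0, +oo[, continuous f} ->
  nondecr_ge0 f -> (forall t, 0 <= t -> f t <= M) -> 0 < e ->
  exists2 h, 0 < h & forall u v, 0 <= u -> u <= v -> v <= u + h ->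
    f v - f u <= e.
Proof.
move=> cf ndf fM e0.
pose S := [set f t | t in `[0, +oo[].
have hsS : has_sup S.
  split; first by exists (f 0); exists 0 => //=; rewrite in_itv/= lexx.
  by exists M => x [t /=]; rewrite in_itv/= andbT => t0 <-; exact: fM.
have [x [c /=]] := sup_adherent e0 hsS.
rewrite in_itv/= andbT => c0 <- {x} fc.
have [h h0 H] := unif_continuous_segment c cf e0.
exists h => // u v u0 uv vuh; have [uc|cu] := leP u c.
  by have := H _ _ u0 uc uv vuh; rewrite ler_norml => /andP[].
have fv : f v <= sup S.
  apply: mem_le_sup; first by case: hsS.
  by exists v => //=; rewrite in_itv/= andbT (le_trans u0).
by have fcu := ndf _ _ c0 (ltW cu); lra.
Qed.

(** With n.+1 ^ 2 steps the mesh is 1 / (n + 1) and the last point is n + 1, so a single index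
    refines the mesh and sends the horizon to infinity. *)
Definition grid (n k : nat) : R := k%:R / n.+1%:R.

Lemma grid_ge0 n k : 0 <= grid n k. Proof. by rewrite divr_ge0. Qed.

Lemma grid_le n k : grid n k <= grid n k.+1.
Proof. by rewrite ler_pM2r ?invr_gt0// ler_nat. Qed.

Lemma grid0 n : grid n 0 = 0. Proof. by rewrite /grid mul0r. Qed.

Lemma grid_last n : grid n (n.+1 ^ 2) = n.+1%:R.
Proof. by rewrite /grid natrX expr2 mulfK. Qed.

Lemma grid_mesh n k : grid n k.+1 = grid n k + n.+1%:R^-1.
Proof. by rewrite /grid -natr1 mulrDl mul1r. Qed.

Lemma grid_oscillation f e M : {within `[0, +oo[, continuous f} ->
  nondecr_ge0 f -> (forall t, 0 <= t -> f t <= M) -> 0 < e ->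
  \forall n \near \oo, forall k, f (grid n k.+1) - f (grid n k) <= e.
Proof.
move=> cf ndf fM e0; have [h h0 H] := unif_continuous_bounded cf ndf fM e0.
near=> n => k; apply: H => //; first exact: grid_ge0.
  exact: grid_le.
rewrite grid_mesh lerD2l.
have : h^-1 < n%:R by near: n; exact: nbhs_infty_gtr.
move=> hn; rewrite invf_ple ?posrE//; apply: (le_trans (ltW hn)).
by rewrite ler_nat.
Unshelve. all: by end_near. Qed.

(** The sum is at most the largest increment of f times the total [M'] of g. Boundedness of f makes
    its increments uniformly small although the horizon grows. *)
Lemma cross_variation_cvg0 f (g : nat -> nat -> R) M M' :
  {within `[0, +oo[, continuous f} ->
  nondecr_ge0 f -> (forall t, 0 <= t -> f t <= M) ->
  (forall n k, 0 <= g n k) ->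
  (forall n, \sum_(k < n.+1 ^ 2) g n k <= M') ->
  \sum_(k < n.+1 ^ 2) (f (grid n k.+1) - f (grid n k)) * g n k @[n --> \oo] --> 0.
Proof.
move=> cf ndf fM g0 gM.
have M'0 : 0 <= M' by apply: le_trans (gM 0); rewrite sumr_ge0.
apply/cvgr0Pnorm_le => e e0.
have e0' : 0 < e / (M' + 1) by rewrite divr_gt0// ltr_wpDl.
near=> n.
have df k : 0 <= f (grid n k.+1) - f (grid n k).
  by rewrite subr_ge0 ndf// ?grid_ge0// grid_le.
rewrite ger0_norm; last by rewrite sumr_ge0// => k _; rewrite mulr_ge0.
apply: (@le_trans _ _ (\sum_(k < n.+1 ^ 2) (e / (M' + 1)) * g n k)).
  apply: ler_sum => k _; rewrite ler_wpM2r//; move: (nat_of_ord k).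
  by near: n; exact: (grid_oscillation cf ndf fM e0').
rewrite -mulr_sumr -mulrA ger_pMr// mulrC ler_pdivrMr ?ltr_wpDl// mul1r.
by rewrite (le_trans (gM n))// lerDl.
Unshelve. all: by end_near. Qed.

(** The supremum c of the times u with f u <= f t still satisfies f c <= f t by continuity, so f
    grows immediately after c. Only growth to the right is excluded by the hypothesis, in accordance
    with [local_time_grows]. *)
Lemma no_growth_cst f t : {within `[0, +oo[, continuous f} -> nondecr_ge0 f ->
  0 <= t ->
  (forall u, t <= u -> ~ (forall s, u < s -> f u < f s)) ->
  forall v, t <= v -> f v = f t.
Proof.
move=> cf ndf t0 ng v tv; apply/eqP; rewrite eq_le [in X in _ && X]ndf// andbT leNgt; apply/negP => ftv.
pose S := [set u | t <= u /\ f u <= f t].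
have ubS : ubound S v.
  move=> u [tu fu]; rewrite leNgt; apply/negP => /ltW vu.
  by have := le_lt_trans fu ftv; rewrite ltNge ndf// (le_trans t0).
have hsS : has_sup S by split; [exists t; split|exists v].
pose c := sup S.
have tc : t <= c by apply: mem_le_sup; [exists v|split].
have c0 := le_trans t0 tc.
have fc : f c <= f t.
  rewrite leNgt; apply/negP => ftc.
  have d0 : 0 < f c - f t by rewrite subr_gt0.
  have [h h0 H] := within_ge0_continuousP cf c0 d0.
  have [u [tu fu] cu] := sup_adherent h0 hsS.
  have uc : u <= c by apply: mem_le_sup; [exists v|split].
  have : `|f u - f c| < f c - f t.
    by apply: H; [exact: le_trans tu|rewrite ltr_norml -/c in cu *; apply/andP; split; lra].
  by rewrite ltr_norml => /andP[]; lra.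
apply: (ng c) => // s cs; rewrite ltNge; apply/negP => fs.
suff : s <= c by rewrite leNgt cs.
apply: mem_le_sup; [by exists v|split; first exact: le_trans (ltW cs)].
exact: le_trans fc.
Qed.

Definition hitting_set f r := [set u | 0 <= u /\ r <= f u].

Definition hitting_time f r : \bar R :=
  if pselect (hitting_set f r !=set0) then (inf (hitting_set f r))%:E else +oo%E.

Lemma hitting_time_ge0 f r : (0 <= hitting_time f r)%E.
Proof.
rewrite /hitting_time; case: pselect => //= ne; rewrite lee_fin.
by apply: lb_le_inf => // u [].
Qed.

(** By continuity the infimum is attained. The event on the left is thus {f t >= r}, which depends
    on the value at time t only: hitting times are stopping times for the raw filtration. *)
Lemma hitting_time_le f r t : {within `[0, +oo[, continuous f} ->
  nondecr_ge0 f -> 0 <= t -> (hitting_time f r <= t%:E)%E <-> r <= f t.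
Proof.
move=> cf ndf t0; rewrite /hitting_time; case: pselect => /= ne; last first.
  by split => // rt; exfalso; apply: ne; exists t.
have hiS : has_inf (hitting_set f r) by split => //; exists 0 => u [].
pose c := inf (hitting_set f r).
have c0 : 0 <= c by apply: lb_le_inf => // u [].
rewrite lee_fin -/c; split => [ct|rt]; last by apply: mem_ge_inf; [exists 0 => u []|split].
suff : r <= f c by move/le_trans; apply; exact: ndf.
rewrite leNgt; apply/negP => fcr.
have d0 : 0 < r - f c by rewrite subr_gt0.
have [h h0 H] := within_ge0_continuousP cf c0 d0.
have [u [u0 fu] cu] := inf_adherent h0 hiS.
have uc : c <= u by apply: mem_ge_inf; [exists 0 => w []|split].
have : `|f u - f c| < r - f c.
  by apply: H => //; rewrite ltr_norml -/c in cu *; apply/andP; split; lra.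
by rewrite ltr_norml => /andP[_]; lra.
Qed.

(** Overshooting r at the infimum would, by continuity, give an earlier time above r; an overshoot
    at time 0 is excluded by f 0 <= r. *)
Lemma hitting_timeP f r t : {within `[0, +oo[, continuous f} ->
  nondecr_ge0 f -> f 0 <= r -> hitting_time f r = t%:E -> 0 <= t /\ f t = r.
Proof.
move=> cf ndf f0r Tt.
have t0 : 0 <= t by rewrite -lee_fin -Tt hitting_time_ge0.
split => //; apply/eqP; rewrite eq_le; apply/andP; split; last first.
  by apply/(hitting_time_le r cf ndf t0); rewrite Tt.
rewrite leNgt; apply/negP => rft.
have tn0 : t != 0 by apply/eqP => tE; move: rft; rewrite tE ltNge f0r.
have tp : 0 < t by rewrite lt_neqAle eq_sym tn0.
have d0 : 0 < f t - r by rewrite subr_gt0.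
have [h h0 H] := within_ge0_continuousP cf t0 d0.
pose u := Num.max 0 (t - h / 2).
have u0 : 0 <= u by rewrite le_max lexx.
have ut : u < t by rewrite gt_max tp/=; lra.
have : (hitting_time f r <= u%:E)%E.
  apply/(hitting_time_le r cf ndf u0).
  have : `|f u - f t| < f t - r.
    apply: H => //.
    have : t - h / 2 <= u by rewrite le_max lexx orbT.
    by rewrite ltr_norml => ?; apply/andP; split; lra.
  by rewrite ltr_norml => /andP[]; lra.
by rewrite Tt lee_fin leNgt ut.
Qed.

End continuous_nondecreasing.

(** * The size-biased permanental process *)

Section permanental_size_bias.
Variable R : realType.

Lemma expRN_quotient_cvg (z : R) : 0 <= z ->
  2 ^+ n * (1 - expR (- (z / 2 ^+ n))) @[n --> \oo] --> z.
Proof.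
move=> z0.
have q0 (n : nat) : 0 < 2 ^+ n :> R by rewrite exprn_gt0.
have qz (n : nat) : 0 <= z / 2 ^+ n by rewrite divr_ge0// ltW.
have lo : z * (1 + n%:R * 1)^-1 @[n --> \oo] --> 0 by
  rewrite -[X in _ --> X](mulr0 z); apply: cvgMr; exact: (cvg_inv_affine (@ltr01 R)).
have lo2 : z - z * (z * (1 + n%:R * 1)^-1) @[n --> \oo] --> z.
  rewrite -[X in _ --> X]subr0 -[X in _ --> _ - X](mulr0 z).
  by apply: cvgB; [exact: cvg_cst|exact: cvgMr].
apply: (squeeze_cvgr (h := cst z) _ lo2); [|exact: cvg_cst]; near=> n.
apply/andP; split; last first.
  have := expR_ge1Dx (- (z / 2 ^+ n)) => h.
  rewrite /cst mulrC -ler_pdivlMr//; lra.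
have h2 : n%:R + 1 <= 2 ^+ n :> R.
  by rewrite natr1 -natrX ler_nat ltn_expl.
apply: (@le_trans _ _ (z - z * (z / 2 ^+ n))).
  rewrite lerD2l lerN2 ler_wpM2l// ler_wpM2l// mulr1 lef_pV2 ?posrE//.
  by rewrite addrC.
have -> : z - z * (z / 2 ^+ n) = 2 ^+ n * (z / 2 ^+ n * (1 - z / 2 ^+ n)).
  by field; rewrite gt_eqF.
rewrite ler_pM2l//; set y := z / _.
have y0 : 0 <= y := qz n.
rewrite expRN.
(* exp (- y) <= 1 / (1 + y) <= 1 - y + y^2, the last inequality because (1 - y + y^2) (1 + y) = 1 +
   y^3. *)
have E : (expR y)^-1 <= (1 + y)^-1.
  by rewrite lef_pV2 ?posrE ?expR_gt0 ?ltr_pwDl// expR_ge1Dx.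
have : (1 + y)^-1 <= 1 - y * (1 - y).
  have y3 : 0 <= y ^+ 3 by exact: exprn_ge0.
  rewrite -[leLHS]mul1r ler_pdivrMr ?ltr_pwDl//.
  have -> : (1 - y * (1 - y)) * (1 + y) = 1 + y ^+ 3 by ring.
  by rewrite lerDl.
lra.
Unshelve. all: by end_near. Qed.

(** With u = exp (- z / 2^(n+1)) one has 1 - u^2 <= 2 (1 - u), so halving the step increases the
    quotient. Steps are dyadic for this reason: monotone convergence then differentiates under the
    integral with no prior moment of psi. *)
Lemma expRN_quotient_nd (z : R) : 0 <= z ->
  nondecreasing_seq (fun n : nat => 2 ^+ n * (1 - expR (- (z / 2 ^+ n)))).
Proof.
move=> z0; apply/nondecreasing_seqP => n.
have -> : expR (- (z / 2 ^+ n)) = expR (- (z / 2 ^+ n.+1)) ^+ 2.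
  by rewrite -expRM_natl; congr expR; rewrite exprS; field; rewrite expf_neq0.
set u := expR _.
have u0 : 0 <= u by exact: expR_ge0.
have u1 : u <= 1.
  by rewrite -[leRHS]expR0 ler_expR oppr_le0 divr_ge0// exprn_ge0.
rewrite [2 ^+ n.+1]exprS.
have q0 : 0 < 2 ^+ n :> R by rewrite exprn_gt0.
have -> : 2 * 2 ^+ n * (1 - u) = 2 ^+ n * (2 * (1 - u)) by ring.
by rewrite ler_pM2l//; nra.
Qed.

(** The limit is minus the derivative of D^{-1/2} in the direction D', obtained by multiplying by
    the conjugate; the hypothesis keeps all the square roots positive. *)
Lemma rsqrt_quotient_cvg (D D' : R) : 0 < D ->
  (forall n : nat, 0 < D + D' / 2 ^+ n) ->
  2 ^+ n * ((Num.sqrt D)^-1 - (Num.sqrt (D + D' / 2 ^+ n))^-1) @[n --> \oo] -->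
  D' / (2 * D * Num.sqrt D).
Proof.
move=> D0 Dn0.
pose s (n : nat) := Num.sqrt (D + D' / 2 ^+ n).
have s0 n : 0 < s n by rewrite sqrtr_gt0.
have sD : 0 < Num.sqrt D by rewrite sqrtr_gt0.
have cs : s n @[n --> \oo] --> Num.sqrt D.
  apply: continuous_cvg; first exact: sqrt_continuous.
  rewrite -[X in _ --> X]addr0; apply: cvgD; first exact: cvg_cst.
  rewrite -[X in _ --> X](mulr0 D'); apply: cvgMr.
  rewrite (_ : (fun n => _) = geometric 1 (2^-1)); last first.
    by apply/funext => n /=; rewrite mul1r exprVn.
  by apply: cvg_geometric; rewrite ger0_norm// invf_lt1// ltr1n.
rewrite (_ : (fun n => _) = (fun n => D' / (Num.sqrt D * s n * (s n + Num.sqrt D)))); last first.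
  apply/funext => n; rewrite -/(s n).
  have sE : s n ^+ 2 = D + D' / 2 ^+ n by rewrite sqr_sqrtr// ltW.
  have E : D' = 2 ^+ n * (s n - Num.sqrt D) * (s n + Num.sqrt D).
    rewrite -mulrA -subr_sqr sE sqr_sqrtr ?(ltW D0)//.
    by field; rewrite expf_neq0.
  rewrite [in RHS]E; field.
  by rewrite !gt_eqF//= addr_gt0.
rewrite (_ : 2 * D * Num.sqrt D = Num.sqrt D * Num.sqrt D * (Num.sqrt D + Num.sqrt D)); last first.
  by rewrite -expr2 sqr_sqrtr ?(ltW D0)//; ring.
apply: cvgMr; apply: cvgV.
  by rewrite !mulf_neq0// gt_eqF// addr_gt0.
apply: cvgM; last by apply: cvgD => //; exact: cvg_cst.
by apply: cvgMr.
Qed.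

Definition green_mx (E : Type) (g : E -> E -> R) n (x : 'I_n -> E) : 'M[R]_n :=
  \matrix_(i < n, j < n) g (x i) (x j).

Definition resolvent_mx n (alpha : 'rV[R]_n) (G : 'M[R]_n) : 'M[R]_n :=
  1%:M + diag_mx alpha *m G.

(* The derivative of [\det (resolvent_mx alpha G)] with respect to the weight of
   index 0. *)
Definition ddet0 n (alpha : 'rV[R]_n.+1) (G : 'M[R]_n.+1) : R :=
  \sum_j G ord0 j * cofactor (resolvent_mx alpha G) ord0 j.

(** Only row 0 involves the weight of index 0, and the cofactors along that row do not see it. *)
Lemma det_resolvent_mxD n (alpha : 'rV[R]_n.+1) (G : 'M[R]_n.+1) h :
  \det (resolvent_mx (alpha + h *: delta_mx 0 ord0) G) =
  \det (resolvent_mx alpha G) + h * ddet0 alpha G.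
Proof.
have entry (b : 'rV[R]_n.+1) i j :
    resolvent_mx b G i j = (i == j)%:R + b 0 i * G i j.
  by rewrite /resolvent_mx mul_diag_mx !mxE.
rewrite (expand_det_row _ ord0) (expand_det_row (resolvent_mx alpha G) ord0).
rewrite /ddet0 mulr_sumr -big_split /=; apply: eq_bigr => j _.
have -> : cofactor (resolvent_mx (alpha + h *: delta_mx 0 ord0) G) ord0 j =
    cofactor (resolvent_mx alpha G) ord0 j.
  rewrite /cofactor; congr (_ * \det _); apply/matrixP => k l.
  do 2 rewrite [LHS]mxE [RHS]mxE; rewrite !entry !mxE /=.
  by rewrite mulr0 addr0.
by rewrite !entry !mxE eqxx /=; ring.
Qed.

Section size_bias.
Context (dE dQ : measure_display) (E : measurableType dE) (S : measurableType dQ).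
Variables (g : E -> E -> R) (Q : probability S R) (psi : S -> {mfun E >-> R}).
Hypothesis psiP : permanental2 g Q psi.
Variables (n : nat) (alpha : 'rV[R]_n.+1) (x : 'I_n.+1 -> E).
Hypothesis alpha0 : forall i, 0 <= alpha 0 i.

Let Y (b : 'rV[R]_n.+1) s := 2^-1 * \sum_(i < n.+1) b 0 i * psi s (x i).
Let D b := \det (resolvent_mx b (green_mx g x)).

Let mpsi y : measurable_fun setT (fun s => psi s y).
Proof. by case: psiP => + _ _; exact. Qed.

Let psi0 s y : 0 <= psi s y.
Proof. by case: psiP => _ + _; exact. Qed.

Let mexpY b : measurable_fun setT (fun s => expR (- Y b s)).
Proof.
apply: measurableT_comp => //; apply: measurableT_comp => //.
by apply: measurable_funM => //; apply: measurable_sum => i; apply: measurable_funM.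
Qed.

Let lapl (b : 'rV[R]_n.+1) : (forall i, 0 <= b 0 i) ->
  (\int[Q]_s (expR (- Y b s))%:E = ((Num.sqrt (D b))^-1)%:E)%E.
Proof. by case: psiP => _ _ +; exact. Qed.

(** By the convention on the inverse square root, a nonpositive determinant would make the integral
    of a positive function against a probability vanish. *)
Lemma det_resolvent_gt0 (b : 'rV[R]_n.+1) : (forall i, 0 <= b 0 i) -> 0 < D b.
Proof.
move=> b0; rewrite ltNge; apply/negP => Dle.
have := lapl b0; rewrite ler0_sqrtr// invr0 => I0.
have : (\int[Q]_s `|(expR (- Y b s))%:E| = 0)%E.
  by rewrite -[RHS]I0; apply: eq_integral => s _; rewrite gee0_abs// lee_fin expR_ge0.
have mY : measurable_fun setT (fun s => (expR (- Y b s))%:E) by exact/measurable_EFinP.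
move=> /(ae_eq_integral_abs Q measurableT mY) [N [mN QN0 sN]].
have : Q setT = 0%E.
  apply: (subset_measure0 _ _ _ QN0) => //.
  apply: subset_trans sN => s _ /= /(_ I) []; apply/eqP.
  by rewrite gt_eqF// expR_gt0.
by rewrite probability_setT => /eqP; rewrite onee_eq0.
Qed.

(** The difference quotient of the Laplace transform in the weight of [x ord0], with steps 2^-k, is
    computed twice: by monotone convergence under the integral and by [rsqrt_quotient_cvg] on the
    determinants. The factor 2 of the latter cancels the 1/2 in front of psi. *)
Lemma size_biased_laplace :
  (\int[Q]_s (psi s (x ord0) * expR (- Y alpha s))%:E =
   (ddet0 alpha (green_mx g x) / (D alpha * Num.sqrt (D alpha)))%:E)%E.
Proof.
have D0 : 0 < D alpha by exact: det_resolvent_gt0.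
set D' := ddet0 _ _.
pose b (k : nat) : 'rV[R]_n.+1 := alpha + (2 ^+ k)^-1 *: delta_mx 0 ord0.
have b0 k i : 0 <= b k 0 i.
  by rewrite !mxE addr_ge0// mulr_ge0// ?invr_ge0 ?exprn_ge0//; case: (_ && _).
have Db k : D (b k) = D alpha + D' / 2 ^+ k.
  by rewrite /D /b det_resolvent_mxD mulrC.
have Yb k s : Y (b k) s = Y alpha s + psi s (x ord0) / 2 / 2 ^+ k.
  rewrite /Y /b (bigD1 ord0)//= [in RHS](bigD1 ord0)//= !mxE !eqxx /= mulr1.
  rewrite (eq_bigr (fun i => alpha 0 i * psi s (x i))); last first.
    by move=> i i0; rewrite !mxE (negbTE i0) andbF mulr0 addr0.
  by field; rewrite expf_neq0.
pose G k s := 2 ^+ k * (expR (- Y alpha s) - expR (- Y (b k) s)).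
have GE k s : G k s = 2 ^+ k * (1 - expR (- (psi s (x ord0) / 2 / 2 ^+ k))) *
    expR (- Y alpha s).
  by rewrite /G Yb opprD expRD; ring.
have psi20 s : 0 <= psi s (x ord0) / 2 by rewrite divr_ge0.
have int k : Q.-integrable setT (EFin \o (fun s => expR (- Y (b k) s))).
  apply: (@bounded_integrable _ _ _ _ _ 1) => // s.
  rewrite ger0_norm ?expR_ge0// -[leRHS]expR0 ler_expR oppr_le0 mulr_ge0//.
  by rewrite sumr_ge0// => i _; rewrite mulr_ge0.
have inta : Q.-integrable setT (EFin \o (fun s => expR (- Y alpha s))).
  apply: (@bounded_integrable _ _ _ _ _ 1) => // s.
  rewrite ger0_norm ?expR_ge0// -[leRHS]expR0 ler_expR oppr_le0 mulr_ge0//.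
  by rewrite sumr_ge0// => i _; rewrite mulr_ge0.
have mG k : measurable_fun setT (G k).
  by apply: measurable_funM => //; apply: measurable_funB.
have IG k : (\int[Q]_s (G k s)%:E = (2 ^+ k * ((Num.sqrt (D alpha))^-1 -
    (Num.sqrt (D alpha + D' / 2 ^+ k))^-1))%:E)%E.
  under eq_integral do rewrite /G EFinM EFinB.
  rewrite integralZl//; last first.
    exact: (integrableB measurableT inta (int k)).
  by rewrite integralB_EFin// !lapl// Db EFinM EFinB.
have cG : (\int[Q]_s (G k s)%:E @[k --> \oo] -->
    \int[Q]_s (psi s (x ord0) / 2 * expR (- Y alpha s))%:E)%E.
  have -> : (\int[Q]_s (psi s (x ord0) / 2 * expR (- Y alpha s))%:E)%E =
      (\int[Q]_s limn (fun k => (G k s)%:E))%E.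
    apply: eq_integral => s _; apply/esym/cvg_lim => //.
    apply: cvg_EFin; first exact: nearW.
    rewrite (_ : _ \o _ = (fun k => 2 ^+ k *
      (1 - expR (- (psi s (x ord0) / 2 / 2 ^+ k))) * expR (- Y alpha s))); last first.
      by apply/funext => k; exact: GE.
    by apply: cvgMl; exact: expRN_quotient_cvg.
  apply: cvg_monotone_convergence => //.
  - by move=> k; exact/measurable_EFinP.
  - move=> k s _; rewrite lee_fin GE mulr_ge0 ?expR_ge0// mulr_ge0 ?exprn_ge0//.
    by rewrite subr_ge0 -[leRHS]expR0 ler_expR oppr_le0 divr_ge0// exprn_ge0.
  - move=> s _ k l kl; rewrite lee_fin !GE ler_wpM2r ?expR_ge0//.
    exact: (expRN_quotient_nd (psi20 s)).
have cR : ((2 ^+ k * ((Num.sqrt (D alpha))^-1 -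
    (Num.sqrt (D alpha + D' / 2 ^+ k))^-1))%:E @[k --> \oo] -->
    (D' / (2 * D alpha * Num.sqrt (D alpha)))%:E)%E.
  apply: cvg_EFin; first exact: nearW.
  by apply: rsqrt_quotient_cvg => // k; rewrite -Db; exact: det_resolvent_gt0.
have IE : (\int[Q]_s (psi s (x ord0) / 2 * expR (- Y alpha s))%:E =
    (D' / (2 * D alpha * Num.sqrt (D alpha)))%:E)%E.
  apply: (cvg_unique (@ereal_hausdorff R) cG).
  have -> : (fun k => \int[Q]_s (G k s)%:E)%E = (fun k => (2 ^+ k * ((Num.sqrt (D alpha))^-1 -
      (Num.sqrt (D alpha + D' / 2 ^+ k))^-1))%:E); last exact: cR.
  by apply/funext => k; exact: IG.
have -> : (fun s => (psi s (x ord0) * expR (- Y alpha s))%:E) =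
    (fun s => 2%:E * (psi s (x ord0) / 2 * expR (- Y alpha s))%:E)%E.
  by apply/funext => s; rewrite -EFinM; congr (_%:E); field.
rewrite ge0_integralZl//.
- rewrite IE -EFinM; congr (_%:E); field.
  by rewrite !gt_eqF// sqrtr_gt0.
- by apply/measurable_EFinP; do 2 apply: measurable_funM => //.
- by move=> s _; rewrite lee_fin mulr_ge0 ?expR_ge0.
Qed.

End size_bias.

End permanental_size_bias.

(** * The law of X and its total local times *)

Section path_laws.
Context {R : realType} {dE dO : measure_display}.
Context {E : measurableType dE} {Omega : measurableType dO}.
Variable X : markovProcess R E Omega.

(* A copy of [law X x] on which the probability structure can be inferred. *)
Definition path_law (x : E) : set Omega -> \bar R := law X x.

HB.instance Definition _ x := isMeasure.Build _ _ _ (path_law x)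
  (measure0 (law X x)) (measure_ge0 (law X x))
  (@measure_semi_sigma_additive _ _ _ (law X x)).

HB.instance Definition _ x :=
  Measure_isProbability.Build _ _ _ (path_law x) (prob_kernel x).

Lemma integral_path_law x D f :
  (\int[law X x]_(w in D) f w = \int[path_law x]_(w in D) f w)%E.
Proof. by apply: eq_measure_integral. Qed.

Definition filtration_generators (t : R) : set (set Omega) :=
  [set A | exists s B, [/\ 0 <= s, s <= t, measurable B & A = X s @^-1` (Some @` B)] ].

(* [Omega] with the sigma-algebra F_t, so that F_t-measurability is
   [measurable_fun]. *)
Definition filtered (t : R) := g_sigma_algebraType (filtration_generators t).

Lemma natural_filtration_le s t : s <= t ->
  natural_filtration X s `<=` natural_filtration X t.
Proof.
move=> st; apply: sub_smallest2r; first exact: smallest_sigma_algebra.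
by move=> A [u [B [u0 us mB ->]]]; exists u, B; split => //; exact: le_trans st.
Qed.

Lemma natural_filtration_sigma t : natural_filtration X t `<=` natural_sigma X.
Proof.
apply: sub_smallest2r; first exact: smallest_sigma_algebra.
by move=> A [u [B [u0 us mB ->]]]; exists u, B.
Qed.

Lemma natural_sigma_measurable A : natural_sigma X A -> measurable A.
Proof.
apply: smallest_sub; first exact: sigma_algebra_measurable.
by move=> _ [u [B [u0 mB ->]]]; exact: path_measurable.
Qed.

Lemma natural_filtration_measurable t A : natural_filtration X t A -> measurable A.
Proof. by move=> /natural_filtration_sigma /natural_sigma_measurable. Qed.

Lemma measurable_fun_filtered_le d' (T' : measurableType d') s t (f : Omega -> T') :
  s <= t -> measurable_fun (setT : set (filtered s)) f ->
  measurable_fun (setT : set (filtered t)) f.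
Proof.
move=> st mf mT B mB; have := mf measurableT B mB; rewrite !setTI.
exact: natural_filtration_le.
Qed.

Lemma measurable_fun_filtered d' (T' : measurableType d') t (f : Omega -> T') :
  measurable_fun (setT : set (filtered t)) f -> measurable_fun setT f.
Proof.
move=> mf mT B mB; have := mf measurableT B mB; rewrite !setTI.
exact: natural_filtration_measurable.
Qed.

Lemma alive_in_filtration t : 0 <= t -> natural_filtration X t [set w | X t w <> None].
Proof.
move=> t0; rewrite (_ : mkset _ = X t @^-1` (Some @` setT)).
  by apply: sub_sigma_algebra; exists t, setT.
apply/seteqP; split => w /=; last by case=> y _ <-.
by case: (X t w) => // y _; exists y.
Qed.

Section stopping.
Variable T : Omega -> \bar R.
Hypothesis stopT : stopping_time X T.

Lemma stopped_preimage_measurable B : measurable B ->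
  natural_sigma X (stopped X T @^-1` (Some @` B)).
Proof. by move=> mB; have [] := stopped_measurable stopT mB. Qed.

Lemma stopped_neqNone : [set w | stopped X T w <> None] = stopped X T @^-1` (Some @` setT).
Proof.
apply/seteqP; split => w /=; last by case=> y _ <-.
by case: (stopped X T w) => // y _; exists y.
Qed.

Lemma stopping_time_shift s : 0 <= s -> stopping_time X (fun w => T w + s%:E)%E.
Proof.
move=> s0; have [T0 mT] := stopT; split; first by move=> w; rewrite adde_ge0.
move=> t t0; rewrite (_ : mkset _ = [set w | T w <= (t - s)%:E]%E); last first.
  by apply/seteqP; split => w /=; rewrite EFinB leeBrDr.
have [st|ts] := leP s t.
  by apply: natural_filtration_le (mT _ _); [lra|rewrite subr_ge0].
rewrite (_ : mkset _ = set0).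
  exact: (@measurable0 _ (filtered t)).
apply/seteqP; split => w //=; apply/negP; rewrite -ltNge.
by apply: lt_le_trans (T0 w); rewrite lte_fin subr_lt0.
Qed.

(** Good sets: X_s after the shift by T is X at the stopping time T + s, covered by
    [stopped_measurable]. Being alive at T is kept inside the event, and complements are taken
    relative to it, because [fine (T w)] is junk where T is infinite. *)
Lemma shift_preimage_measurable B : natural_sigma X B ->
  natural_sigma X [set w | stopped X T w <> None /\ B (Defs.shift X (fine (T w)) w)].
Proof.
pose G := [set A | exists s B, [/\ 0 <= s, measurable B & A = X s @^-1` (Some @` B)] ].
pose sOm := g_sigma_algebraType G.
pose alive : set sOm := [set w | stopped X T w <> None].
have malive : measurable alive.
  by rewrite /alive stopped_neqNone; exact: stopped_preimage_measurable.
pose H := [set B : set Omega | natural_sigma X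
  [set w | stopped X T w <> None /\ B (Defs.shift X (fine (T w)) w)] ].
move=> sB; change (H B); apply: smallest_sub sB; rewrite /H /=.
  split => /=.
  - rewrite (_ : mkset _ = set0); first exact: (@measurable0 _ sOm).
    by apply/seteqP; split => w // -[].
  - move=> A mA; rewrite (_ : mkset _ = alive `\` [set w |
      stopped X T w <> None /\ A (Defs.shift X (fine (T w)) w)]).
      by apply: (@measurableD _ sOm).
    apply/seteqP; split => w /=; rewrite /alive/=; last by rewrite /setD/=; tauto.
    by move=> [h1 [_ h2]]; split => // -[].
  - move=> F mF; rewrite (_ : mkset _ = \bigcup_n [set w |
      stopped X T w <> None /\ F n (Defs.shift X (fine (T w)) w)]).
      by apply: (@bigcupT_measurable _ sOm).
    apply/seteqP; split => w /=.
      by move=> [h [n _ Fn]]; exists n.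
    by move=> [n _ /= [h Fn]]; split => //; exists n.
move=> _ [s [C [s0 mC ->]]] /=.
rewrite (_ : mkset _ = alive `&` stopped X (fun w => T w + s%:E)%E @^-1` (Some @` C)).
  apply: (@measurableI _ sOm) => //.
  by have [] := stopped_measurable (stopping_time_shift s0) mC.
have [T0 _] := stopT.
apply/seteqP; split => w /=; rewrite /alive /stopped /=; have := T0 w;
  case: (T w) => [r| |] //= r0 [] // h1.
- by rewrite path_shift.
- by rewrite path_shift.
Qed.

Lemma measurable_stopped_comp (h : E -> \bar R) c : measurable_fun setT h ->
  measurable_fun setT (fun w => if stopped X T w is Some y then h y else c).
Proof.
move=> mh mT B mB; rewrite setTI.
have mhB : measurable (h @^-1` B) by rewrite -[X in measurable X]setTI; exact: mh.
have mS : measurable (stopped X T @^-1` (Some @` (h @^-1` B))).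
  by apply: natural_sigma_measurable; exact: stopped_preimage_measurable.
have mN : measurable (~` (stopped X T @^-1` (Some @` setT))).
  by apply: measurableC; apply: natural_sigma_measurable; exact: stopped_preimage_measurable.
have [Bc|Bc] := pselect (B c).
  rewrite (_ : _ @^-1` B = stopped X T @^-1` (Some @` (h @^-1` B)) `|`
    ~` (stopped X T @^-1` (Some @` setT))); first exact: measurableU.
  apply/seteqP; split => w /=; case: (stopped X T w) => [y|] /=.
  - by move=> By; left; exists y.
  - by move=> _; right; case.
  - by case=> [[z Bz [<-]]//|[]]; exists y.
  - by [].
rewrite (_ : _ @^-1` B = stopped X T @^-1` (Some @` (h @^-1` B)))//.
apply/seteqP; split => w /=; case: (stopped X T w) => [y|] //=.
- by move=> By; exists y.
- by case=> [z Bz [<-]].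
- by case.
Qed.

End stopping.

Lemma stopping_time_cst t : 0 <= t -> stopping_time X (fun=> t%:E).
Proof.
move=> t0; split => // u u0.
have [tu|ut] := leP t u.
  rewrite (_ : mkset _ = setT); first exact: (@measurableT _ (filtered u)).
  by apply/seteqP; split => w //= _; rewrite lee_fin.
rewrite (_ : mkset _ = set0); first exact: (@measurable0 _ (filtered u)).
by apply/seteqP; split => w //=; rewrite lee_fin leNgt ut.
Qed.

Lemma stopped_sigma_cst t A : 0 <= t -> natural_filtration X t A ->
  stopped_sigma X (fun=> t%:E) A.
Proof.
move=> t0 FA; split; first exact: natural_filtration_sigma FA.
move=> u u0; have [tu|ut] := leP t u.
  rewrite (_ : _ `&` _ = A); first exact: natural_filtration_le FA.
  by apply/seteqP; split => w /=; [case|split => //; rewrite lee_fin].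
rewrite (_ : _ `&` _ = set0); first exact: (@measurable0 _ (filtered u)).
by apply/seteqP; split => w //= -[_]; rewrite lee_fin leNgt ut.
Qed.

End path_laws.

(** * Total local times: suprema, shifts and measurability *)

Section total_local_time_facts.
Context {R : realType} {dE dO : measure_display}.
Context {E : measurableType dE} {Omega : measurableType dO}.
Context {X : markovProcess R E Omega}.
Variable L : localTime X.
Local Notation tot := (total_local_time L).

Lemma local_time_ge0 y t w : 0 <= t -> 0 <= L y t w.
Proof. by move=> t0; rewrite -(local_time0 L y w); exact: local_time_le. Qed.

Lemma total_local_time_sup y w :
  tot y w = ereal_sup [set (L y t w)%:E | t in [set t | 0 <= t]].
Proof.
pose f (t : R) := (L y (Num.max t 0) w)%:E.
have f_nd : {homo f : s t / (s <= t)%R >-> (s <= t)%E}.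
  move=> s t st; rewrite lee_fin; apply: local_time_le.
    by rewrite le_max lexx orbT.
  by rewrite ge_max !le_max st lexx orbT.
have cvL : (L y t w)%:E @[t --> +oo] --> ereal_sup (range f).
  apply: cvg_trans (nondecreasing_cvge f_nd); apply: near_eq_cvg; near=> t.
  by rewrite /f; congr (L y _ w)%:E; apply/max_idPl; near: t; exact: nbhs_pinfty_ge.
rewrite /total_local_time (cvg_lim _ cvL)//; congr ereal_sup.
apply/seteqP; split => z [t].
  by move=> _ <-; exists (Num.max t 0) => //=; rewrite le_max lexx orbT.
by move=> /= t0 <-; exists t => //; rewrite /f (max_idPl t0).
Unshelve. all: by end_near. Qed.

Lemma local_time_le_total y t w : 0 <= t -> ((L y t w)%:E <= tot y w)%E.
Proof. by move=> t0; rewrite total_local_time_sup; apply: ereal_sup_ubound; exists t. Qed.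

Lemma total_local_time_le y w M : (forall t, 0 <= t -> ((L y t w)%:E <= M)%E) ->
  (tot y w <= M)%E.
Proof.
move=> H; rewrite total_local_time_sup; apply: ge_ereal_sup => z [t t0 <-].
exact: H.
Qed.

Lemma total_local_time_ge0 y w : (0 <= tot y w)%E.
Proof.
by apply: le_trans (local_time_le_total y w (lexx 0)); rewrite local_time0.
Qed.

Lemma total_local_time_shift y s w w' : 0 <= s ->
  (forall t, 0 <= t -> L y (s + t) w = L y s w + L y t w') ->
  tot y w = ((L y s w)%:E + tot y w')%E.
Proof.
move=> s0 H; apply/eqP; rewrite eq_le; apply/andP; split.
  apply: total_local_time_le => t t0.
  apply: (@le_trans _ _ (L y (s + t) w)%:E).
    by rewrite lee_fin local_time_le// lerDr.
  by rewrite H// EFinD leeD2l// local_time_le_total.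
rewrite -leeBrDl//; apply: total_local_time_le => t t0.
rewrite leeBrDl// -EFinD -H//; apply: local_time_le_total.
by rewrite addr_ge0.
Qed.

Lemma total_local_time_cvg y w : ((L y n%:R w)%:E @[n --> \oo] --> tot y w)%E.
Proof.
rewrite total_local_time_sup.
rewrite (_ : ereal_sup _ = ereal_sup (range (fun n => (L y n%:R w)%:E))).
  apply: ereal_nondecreasing_cvgn => m n mn.
  by rewrite lee_fin local_time_le// ler_nat.
apply/eqP; rewrite eq_le; apply/andP; split; apply: ge_ereal_sup => z [t t0 <-].
  apply: (@le_trans _ _ (L y (Num.truncn t).+1%:R w)%:E).
    by rewrite lee_fin local_time_le// ltW// truncnS_gt.
  by apply: ereal_sup_ubound; exists (Num.truncn t).+1.
by apply: ereal_sup_ubound; exists t%:R => //=.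
Qed.

(** [strong_markov] asks for events generated by the path, a finer information than measurability in
    [Omega]. The supremum may only be approached from below, hence the slack 1 / (m + 1); integer
    times suffice by monotonicity. *)
Lemma total_local_time_ge_natural y (u : R) :
  natural_sigma X [set w | (u%:E <= tot y w)%E].
Proof.
pose sOm := g_sigma_algebraType [set A | exists s B,
  [/\ 0 <= s, measurable B & A = X s @^-1` (Some @` B)] ].
rewrite (_ : mkset _ = \bigcap_m \bigcup_n
    [set w | u - m.+1%:R^-1 <= L y n%:R w]).
  apply: (@bigcapT_measurable _ sOm) => m; apply: (@bigcupT_measurable _ sOm) => n.
  apply: natural_filtration_sigma.
  have := @local_time_adapted _ _ _ _ _ _ L y n%:R `[u - m.+1%:R^-1, +oo[%classic.
  rewrite (_ : L y n%:R @^-1` _ = [set w | u - m.+1%:R^-1 <= L y n%:R w]).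
    by apply.
  by apply/seteqP; split => w; rewrite /= in_itv/= andbT.
apply/seteqP; split => w /=.
  move=> ut m _ /=; apply: contrapT => H.
  have : (tot y w <= (u - m.+1%:R^-1)%:E)%E.
    apply: total_local_time_le => t t0; rewrite lee_fin leNgt; apply/negP => h.
    apply: H; exists (Num.truncn t).+1 => //=; apply: (le_trans (ltW h)).
    by rewrite local_time_le// ltW// truncnS_gt.
  move=> /(le_trans ut); rewrite lee_fin; apply/negP; rewrite -ltNge.
  by rewrite ltrBlDr ltrDl invr_gt0.
move=> H; apply/lee_subgt0Pr => e e0.
pose m := Num.truncn e^-1.
have me : m.+1%:R^-1 <= e.
  by rewrite invf_ple ?posrE// ltW// truncnS_gt.
have [n _ /= Hn] := H m I.
apply: (@le_trans _ _ (L y n%:R w)%:E); last exact: local_time_le_total.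
by rewrite -EFinB lee_fin; apply: le_trans Hn; rewrite lerD2l lerN2.
Qed.

Lemma measurable_total_path y : measurable_fun setT (tot y).
Proof.
apply: (emeasurable_fun_cvg (fun n w => (L y n%:R w)%:E)).
  move=> n; apply/measurable_EFinP => mT B mB; rewrite setTI.
  by apply: (@natural_filtration_measurable _ _ _ _ _ X n%:R); exact: local_time_adapted.
by move=> w _; exact: total_local_time_cvg.
Qed.

Lemma measurable_local_time_filtered y t : 0 <= t ->
  measurable_fun (setT : set (filtered X t)) (L y t).
Proof. by move=> t0 mT B mB; rewrite setTI; exact: local_time_adapted. Qed.

Lemma measurable_local_time y t : 0 <= t -> measurable_fun setT (L y t).
Proof. by move=> t0; exact: measurable_fun_filtered (measurable_local_time_filtered y t0). Qed.

(** Growth after t would place X at y, but X stays in the cemetery. *)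
Lemma local_time_dead y t w : 0 <= t -> X t w = None ->
  forall s, t <= s -> L y s w = L y t w.
Proof.
move=> t0 Xt; apply: (no_growth_cst (f := fun t => L y t w)) => //.
- exact: local_time_continuous.
- by move=> u v u0 uv; exact: local_time_le.
- move=> u tu /(local_time_grows (l:=L) (le_trans t0 tu)).
  by rewrite (path_cemetery t0 tu Xt).
Qed.

Lemma total_local_time_dead y t w : 0 <= t -> X t w = None -> tot y w = (L y t w)%:E.
Proof.
move=> t0 Xt; apply/eqP; rewrite eq_le local_time_le_total// andbT.
apply: total_local_time_le => s s0; rewrite lee_fin.
have [st|ts] := leP s t; first exact: local_time_le.
by rewrite (local_time_dead y t0 Xt)// ltW.
Qed.

End total_local_time_facts.

(** * Hitting levels of local times *)

Section clocks.
Context {R : realType} {dE dO : measure_display}.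
Context {E : measurableType dE} {Omega : measurableType dO}.
Variable X : markovProcess R E Omega.

(** A continuous clock carried by the visits to y. It covers the local time at y as well as its
    increments after a time s multiplied by an F_s-measurable weight, so that the strong Markov
    argument is made once for both. *)
Record is_clock (y : E) (K : R -> Omega -> R) : Prop := IsClock {
  clock_adapted : forall t, 0 <= t ->
    measurable_fun (setT : set (filtered X t)) (K t);
  clock0 : forall w, K 0 w = 0;
  clock_nd : forall w, nondecr_ge0 (K^~ w);
  clock_continuous : forall w, {within `[0, +oo[, continuous (K^~ w)};
  clock_grows : forall t w, 0 <= t ->
    (forall s, t < s -> K t w < K s w) -> X t w = Some y }.

Section clock_hitting.
Variables (y : E) (K : R -> Omega -> R).
Hypothesis clockK : is_clock y K.
Variable r : R.
Hypothesis r0 : 0 < r.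

Definition clock_hit (w : Omega) : \bar R := hitting_time (K^~ w) r.

Definition clock_event t : set Omega := [set w | r%:E <= (K t w)%:E]%E.

Lemma clock_hit_le t w : 0 <= t -> (clock_hit w <= t%:E)%E <-> r <= K t w.
Proof.
move=> t0; apply: hitting_time_le => //; first exact: clock_continuous clockK w.
exact: clock_nd clockK w.
Qed.

Lemma clock_event_filtration t : 0 <= t -> natural_filtration X t (clock_event t).
Proof.
move=> t0; have := clock_adapted clockK t0.
move=> /(_ measurableT `[r, +oo[%classic (measurable_itv _)); rewrite setTI.
rewrite (_ : _ @^-1` _ = clock_event t)//.
by apply/seteqP; split => w; rewrite /clock_event/= in_itv/= andbT lee_fin.
Qed.

Lemma stopping_time_clock_hit : stopping_time X clock_hit.
Proof.
split=> [w|t t0]; first exact: hitting_time_ge0.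
rewrite (_ : mkset _ = clock_event t); first exact: clock_event_filtration.
by apply/seteqP; split => w /=; rewrite /clock_event /= lee_fin => /clock_hit_le; exact.
Qed.

(** Both events are of the form {K >= r}: the intersection with {hit <= u} is the clock event at the
    smaller of t and u. *)
Lemma clock_event_stopped t : 0 <= t -> stopped_sigma X clock_hit (clock_event t).
Proof.
move=> t0; split.
  by apply: natural_filtration_sigma; exact: clock_event_filtration.
move=> u u0; have [tu|ut] := leP t u.
  rewrite (_ : _ `&` _ = clock_event t).
    by apply: natural_filtration_le tu _ _; exact: clock_event_filtration.
  apply/seteqP; split => w /=; first by case.
  rewrite /clock_event /= lee_fin => h; split => //; apply/clock_hit_le => //.
  exact: le_trans h (clock_nd clockK _ t0 tu).
rewrite (_ : _ `&` _ = clock_event u); first exact: clock_event_filtration.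
apply/seteqP; split => w /=; rewrite /clock_event /= !lee_fin.
  by move=> [_ /clock_hit_le]; exact.
move=> h; split; last exact/clock_hit_le.
exact: le_trans h (clock_nd clockK _ u0 (ltW ut)).
Qed.

Lemma clock_at_hit t w : clock_hit w = t%:E -> 0 <= t /\ K t w = r.
Proof.
move=> ht; apply: (hitting_timeP _ _ _ ht); first exact: clock_continuous clockK w.
  exact: clock_nd clockK w.
by rewrite (clock0 clockK) ltW.
Qed.

(** Either K leaves the level r at once after the hit, and growth to the right puts X at y, or K
    pauses at r and takes this value at a rational time. *)
Lemma stopped_clock_hit w : (clock_hit w < +oo)%E ->
  ~ (exists q : rat, 0 <= ratr q :> R /\ K (ratr q) w = r) ->
  stopped X clock_hit w = Some y.
Proof.
rewrite /stopped; case Tw : (clock_hit w) => [t| |]//; last first.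
  by have := hitting_time_ge0 (K^~ w) r; rewrite -/(clock_hit w) Tw.
move=> _ nq; have [t0 Kt] := clock_at_hit Tw.
apply: (clock_grows clockK t0) => s ts; rewrite Kt.
have [q] := rat_in_itvoo ts; rewrite in_itv/= => /andP[tq qs].
have q0 : 0 <= ratr q :> R by rewrite (le_trans t0)// ltW.
have : r <= K (ratr q) w by rewrite -Kt; apply: (clock_nd clockK) => //; exact: ltW.
rewrite le_eqVlt => /predU1P[rK|]; first by exfalso; apply: nq; exists q.
by move/lt_le_trans; apply; apply: (clock_nd clockK) => //; exact: ltW.
Qed.

Definition clock_flat : set Omega :=
  [set w | exists q : rat, 0 <= ratr q :> R /\ K (ratr q) w = r].

Lemma measurable_clock_flat : measurable clock_flat.
Proof.
rewrite (_ : clock_flat = \bigcup_(q in [set q : rat | 0 <= ratr q :> R])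
    [set w | K (ratr q) w = r]); last first.
  by apply/seteqP; split => w [q]; [case=> q0 Kq; exists q|move=> q0 Kq; exists q].
rewrite bigcup_mkcond; apply: bigcupT_measurable_rat => q.
case: ifPn => [|_]; last exact: measurable0.
rewrite inE /= => q0.
have := measurable_fun_filtered (clock_adapted clockK q0).
by move=> /(_ measurableT [set r] (measurable_set1 r)); rewrite setTI.
Qed.

Section good_level.
Variable x : E.
Hypothesis flat0 : path_law X x clock_flat = 0%E.

(** Almost surely X is at y at the hit, so the law of the restarted path does not depend on the past
    and the expectation factorizes. *)
Lemma strong_markov_clock t B : 0 <= t -> natural_sigma X B ->
  path_law X x (clock_event t `&` [set w | stopped X clock_hit w <> None /\
     B (Defs.shift X (fine (clock_hit w)) w)]) =
  (path_law X x (clock_event t) * path_law X y B)%E.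
Proof.
move=> t0 sB.
have mA : measurable (clock_event t).
  exact: natural_filtration_measurable (clock_event_filtration t0).
rewrite [LHS](strong_markov stopping_time_clock_hit (clock_event_stopped t0) sB).
rewrite integral_path_law muleC -integral_cst//.
have mB := natural_sigma_measurable sB.
apply: ge0_ae_eq_integral => //.
- apply: measurable_funTS.
  apply: (measurable_stopped_comp stopping_time_clock_hit _ (h := fun y => law X y B)).
  exact: measurable_kernel.
- by move=> w _; case: stopped.
- exists clock_flat; split; [exact: measurable_clock_flat|exact: flat0|].
  move=> w /= nw; apply: contrapT => nf; apply: nw => Aw.
  rewrite stopped_clock_hit//.
  apply: (@le_lt_trans _ _ t%:E); last exact: ltry.
  by apply/clock_hit_le => //; rewrite -lee_fin.
Qed.

End good_level.
End clock_hitting.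

(** For a fixed rational q, each w meets only the level K_q (w), a Lebesgue null set. By Tonelli,
    P_x (K_q = r) = 0 for almost every r, and the rationals are countable. *)
Lemma clock_flat_negligible (y : E) K x : is_clock y K ->
  (@lebesgue_measure R).-negligible [set r | path_law X x (clock_flat K r) <> 0%E].
Proof.
move=> clockK.
have H (q : rat) : 0 <= ratr q :> R -> (@lebesgue_measure R).-negligible
    [set r | path_law X x [set w | K (ratr q) w = r] <> 0%E].
  move=> q0.
  have mKq := measurable_fun_filtered (clock_adapted clockK q0).
  pose B : set (Omega * measurableTypeR R) := [set p | K (ratr q) p.1 = p.2].
  have mB : measurable B.
    rewrite (_ : B = (fun p : Omega * measurableTypeR R => K (ratr q) p.1 - p.2) @^-1` [set 0]).
      rewrite -[X in measurable X]setTI.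
      have : measurable_fun setT (fun p : Omega * measurableTypeR R => K (ratr q) p.1 - p.2).
        apply: measurable_funB; last exact: measurable_snd.
        by apply: measurableT_comp => //; exact: measurable_fst.
      by apply.
    apply/seteqP; split => -[w s]; rewrite /B/=; first by move->; rewrite subrr.
    by move/eqP; rewrite subr_eq0 => /eqP.
  have mI : measurable_fun setT (fun p => (\1_B p)%:E : \bar R).
    by apply/measurable_EFinP; exact: measurable_indic.
  have I0 p : (0 <= (\1_B p)%:E :> \bar R)%E by rewrite lee_fin.
  have := fubini_tonelli (m1 := path_law X x) (m2 := @lebesgue_measure R)
    (fun p => (\1_B p)%:E) mI I0.
  have -> : (\int[path_law X x]_w \int[lebesgue_measure]_r (\1_B (w, r))%:E = 0)%E.
    apply: integral0_eq => w _.
    under eq_integral => r _.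
      have -> : \1_B (w, r) = \1_[set K (ratr q) w] r :> R.
        rewrite !indicE; congr ((nat_of_bool _)%:R).
        by apply/idP/idP; rewrite !inE /B/=.
      over.
    by rewrite /= integral_indic// setIT; exact: lebesgue_measure_set1.
  have E1 r : (\int[path_law X x]_w (\1_B (w, r))%:E =
      path_law X x [set w | K (ratr q) w = r])%E.
    have mr : measurable [set w | K (ratr q) w = r].
      by rewrite -[X in measurable X]setTI; exact: (mKq measurableT _ (measurable_set1 r)).
    transitivity (\int[path_law X x]_w (\1_[set w | K (ratr q) w = r] w)%:E)%E;
      last by rewrite integral_indic// setIT.
    apply: eq_integral => w _; rewrite !indicE.
    by have -> : ((w, r) \in B) = (w \in [set w | K (ratr q) w = r])
      by apply/idP/idP; rewrite !inE.
  under eq_integral do rewrite E1.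
  move/esym => I1.
  have mG : measurable_fun setT
      (fun r : measurableTypeR R => path_law X x [set w | K (ratr q) w = r]).
    have := measurable_fun_fubini_tonelli_G (m1 := path_law X x) (fun p => (\1_B p)%:E) mI I0.
    by rewrite /fubini_G; under eq_fun do rewrite E1.
  have : (\int[lebesgue_measure]_r `|path_law X x [set w | K (ratr q) w = r]| = 0)%E.
    by rewrite -[RHS]I1; apply: eq_integral => r _; rewrite gee0_abs.
  move=> /(ae_eq_integral_abs (@lebesgue_measure R) measurableT mG).
  by apply: negligibleS => r /= Hr; apply: contra_not Hr => /(_ I).
pose N (n : nat) : set R := if unpickle n is Some q then
    [set r | 0 <= ratr q :> R /\ path_law X x [set w | K (ratr q) w = r] <> 0%E] else set0.
have HN n : (@lebesgue_measure R).-negligible (N n).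
  rewrite /N; case: (unpickle n) => [q|]; last exact: negligible_set0.
  have [q0|q0] := pselect (0 <= ratr q :> R).
    by apply: negligibleS (H q q0) => r [].
  by apply: negligibleS (@negligible_set0 _ _ _ (@lebesgue_measure R)) => r [].
apply: negligibleS (negligible_bigcup HN) => r /=.
apply: contra_notP => Nr.
have Hr n : if unpickle n is Some q then
    0 <= ratr q :> R -> path_law X x [set w | K (ratr q) w = r] = 0%E else True.
  case nq : (unpickle n : option rat) => [q|//] q0; apply: contrapT => h.
  by apply: Nr; exists n; [exact: I|rewrite /N nq; split].
apply: measure_negligible; first exact: measurable_clock_flat clockK r.
pose F (n : nat) : set Omega := if unpickle n is Some q then
  [set w | 0 <= ratr q :> R /\ K (ratr q) w = r] else set0.
apply: (@negligibleS _ _ _ _ (\bigcup_n F n)).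
  by move=> w [q [q0 Kq]]; exists (pickle q); [exact: I|rewrite /F pickleK; split].
apply: negligible_bigcup => n; have := Hr n; rewrite /F.
case: (unpickle n) => [q|_]; last exact: negligible_set0.
have [q0|q0] := pselect (0 <= ratr q :> R); last first.
  by move=> _; apply: negligibleS (@negligible_set0 _ _ _ (path_law X x)) => w [].
move=> /(_ q0) Kq0; exists [set w | K (ratr q) w = r]; split => //; last by move=> w [].
have := measurable_fun_filtered (clock_adapted clockK q0).
by move=> /(_ measurableT [set r] (measurable_set1 r)); rewrite setTI.
Qed.

End clocks.

(** * The strong Markov property on the layers of a clock *)

Section occupation.
Context {R : realType} {dE dO : measure_display}.
Context {E : measurableType dE} {Omega : measurableType dO}.
Context {X : markovProcess R E Omega}.
Variable L : localTime X.
Local Notation tot := (total_local_time L).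
Local Notation P := (path_law X).

Lemma egreenE x y : egreen L x y = (\int[P x]_w tot y w)%E.
Proof. exact: integral_path_law. Qed.

Lemma egreen_ge0 x y : (0 <= egreen L x y)%E.
Proof. by apply: integral_ge0 => w _; exact: total_local_time_ge0. Qed.

Lemma measure_le_null d (T : measurableType d) (mu : {measure set T -> \bar R})
  (A B N : set T) : measurable A -> measurable B -> measurable N -> mu N = 0%E ->
  A `<=` B `|` N -> (mu A <= mu B)%E.
Proof.
move=> mA mB mN N0 AB; rewrite -(measureU0 mB mN N0).
by apply: le_measure AB; rewrite inE//; exact: measurableU.
Qed.

Section level.
Variables (x y z : E) (K : R -> Omega -> R).
Hypothesis clockK : is_clock X y K.
Variables (r t : R).
Hypotheses (r0 : 0 < r) (t0 : 0 <= t).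
Hypothesis flat0 : P x (clock_flat K r) = 0%E.
Local Notation A := (clock_event K r t).
Local Notation hit := (clock_hit K r).

Let mA : measurable A.
Proof. exact: natural_filtration_measurable (clock_event_filtration clockK r t0). Qed.

Let hitA w : A w -> exists2 u, hit w = u%:E & 0 <= u <= t.
Proof.
rewrite /clock_event/= lee_fin => /(clock_hit_le clockK r w t0) ht.
have := hitting_time_ge0 (K^~ w) r; rewrite -/(hit w).
by case: (hit w) ht => [u| |]//; rewrite !lee_fin => ut u0; exists u => //; rewrite u0.
Qed.

Let additive_null : exists N, [/\ measurable N, P x N = 0%E &
  forall w, ~ N w -> forall u, 0 <= u ->
    tot z w = ((L z u w)%:E + tot z (Defs.shift X u w))%E].
Proof.
have [N [mN N0 HN]] := local_time_additive L x z.
exists N; split => // w Nw u u0; apply: total_local_time_shift => // v v0.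
have : ~ (~` [set w | forall s t : R, 0 <= s -> 0 <= t ->
   L z (s + t) w = L z s w + L z t (Defs.shift X s w)]) w.
  by move=> h; apply: Nw; exact: HN.
by move=> /contrapT /(_ u v u0 v0).
Qed.

Let regenerated (u : R) := A `&` [set w | stopped X hit w <> None /\
  [set w | (u%:E <= tot z w)%E] (Defs.shift X (fine (hit w)) w)].

Let mregenerated u : measurable (regenerated u).
Proof.
apply: measurableI => //; apply: (@natural_sigma_measurable _ _ _ _ _ X).
apply: (shift_preimage_measurable (stopping_time_clock_hit clockK r)).
exact: total_local_time_ge_natural.
Qed.

Let regenerated_law u : P x (regenerated u) = (P x A * P y [set w | (u%:E <= tot z w)%E])%E.
Proof.
apply: (strong_markov_clock clockK r0 flat0 t0).
exact: total_local_time_ge_natural.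
Qed.

Let integral_regenerated :
  (\int[lebesgue_measure]_(u in `]0%R, +oo[) P x (regenerated u) = P x A * egreen L y z)%E.
Proof.
under eq_integral do rewrite regenerated_law.
rewrite egreenE (ge0_layer_cake_restrict _ measurableT)//; last 2 first.
- exact: measurable_total_path.
- exact: total_local_time_ge0.
rewrite -ge0_integralZl//.
- by apply: eq_integral => u _; rewrite setTI.
- apply: measurable_fun_layer_restrict => //.
    exact: measurable_total_path.
  exact: total_local_time_ge0.
Qed.

Let measurable_regenerated :
  measurable_fun (`]0%R, +oo[%classic : set (measurableTypeR R))
    (fun u : measurableTypeR R => P x (regenerated u)).
Proof.
apply: (eq_measurable_fun (fun u : measurableTypeR R =>
    P x A * P y (setT `&` [set w | (u%:E <= tot z w)%E]))%E).
  by move=> u _; rewrite regenerated_law setTI.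
apply: measurable_funeM; apply: measurable_fun_layer_restrict => //.
  exact: measurable_total_path.
exact: total_local_time_ge0.
Qed.

(** On [clock_event] the hit occurs at some time u <= t, and by additivity tot_z - L^z_u is the
    total local time of the restarted path. The level sets of [V] are therefore contained in the
    regenerated events, up to the null sets of flat paths and of paths that violate additivity. *)
Lemma integral_le_regenerated (V : Omega -> \bar R) :
  measurable_fun setT V -> (forall w, 0 <= V w)%E ->
  (forall w u, hit w = u%:E -> (0 <= u <= t)%R -> V w <= tot z w - (L z u w)%:E)%E ->
  (\int[P x]_(w in A) V w <= P x A * egreen L y z)%E.
Proof.
move=> mV V0 HV; rewrite -integral_regenerated ge0_layer_cake_restrict//.
apply: ge0_le_integral => //.
- exact: measurable_fun_layer_restrict.
- move=> u _; have [N [mN N0 HN]] := additive_null.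
  apply: (@measure_le_null _ _ _ _ _ (N `|` clock_flat K r)) => //.
  + apply: measurableI => //.
    by rewrite -[X in measurable X]setTI; apply: measurable_lee.
  + by apply: measurableU => //; exact: measurable_clock_flat clockK r.
  + by rewrite measureU0//; exact: measurable_clock_flat clockK r.
  + move=> w [Aw uV]; have [Nw|Nw] := pselect (N w); first by right; left.
    have [fw|fw] := pselect (clock_flat K r w); first by right; right.
    left; split => //; have [v hv v0t] := hitA Aw.
    have [v0 _] := andP v0t.
    split => /=; first by rewrite (stopped_clock_hit clockK r0)// hv ltry.
    rewrite hv /=; apply: (le_trans uV); apply: le_trans (HV w v hv v0t) _.
    by rewrite (HN w Nw v v0) addeAC subee// add0e.
Qed.

Lemma integral_ge_regenerated (V : Omega -> \bar R) :
  measurable_fun setT V -> (forall w, 0 <= V w)%E ->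
  (forall w u, hit w = u%:E -> (0 <= u <= t)%R -> tot z w - (L z u w)%:E <= V w)%E ->
  (P x A * egreen L y z <= \int[P x]_(w in A) V w)%E.
Proof.
move=> mV V0 HV; rewrite -integral_regenerated [leRHS]ge0_layer_cake_restrict//.
apply: ge0_le_integral => //.
- exact: measurable_fun_layer_restrict.
- move=> u _; have [N [mN N0 HN]] := additive_null.
  apply: (@measure_le_null _ _ _ _ _ N) => //.
  + apply: measurableI => //.
    by rewrite -[X in measurable X]setTI; apply: measurable_lee.
  + move=> w [Aw [_ /= utot]]; have [Nw|Nw] := pselect (N w); first by right.
    left; split => //=; have [v hv v0t] := hitA Aw.
    have [v0 _] := andP v0t.
    apply: le_trans (HV w v hv v0t); apply: (le_trans utot).
    by rewrite hv (HN w Nw v v0) addeAC subee// add0e.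
Qed.

End level.
End occupation.

(** * Second moments of total local times *)

Section occupation_bounds.
Context {R : realType} {dE dO : measure_display}.
Context {E : measurableType dE} {Omega : measurableType dO}.
Context {X : markovProcess R E Omega}.
Variable L : localTime X.
Local Notation tot := (total_local_time L).
Local Notation P := (path_law X).

Lemma measurable_remaining y t : 0 <= t ->
  measurable_fun setT (fun w => tot y w - (L y t w)%:E)%E.
Proof.
move=> t0; apply: emeasurable_funB; first exact: measurable_total_path.
by apply/measurable_EFinP; exact: measurable_local_time.
Qed.

Lemma remaining_ge0 y t w : 0 <= t -> (0 <= tot y w - (L y t w)%:E)%E.
Proof. by move=> t0; rewrite sube_ge0//; exact: local_time_le_total. Qed.

Lemma remaining_le y s t w : 0 <= s -> s <= t ->
  (tot y w - (L y t w)%:E <= tot y w - (L y s w)%:E)%E.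
Proof. by move=> s0 st; rewrite leeB// lee_fin local_time_le. Qed.

Lemma measurable_clock y K t : is_clock X y K -> 0 <= t -> measurable_fun setT (K t).
Proof. by move=> cK t0; exact: measurable_fun_filtered (clock_adapted cK t0). Qed.

Lemma clock_ge0 y K t w : is_clock X y K -> 0 <= t -> 0 <= K t w.
Proof. by move=> cK t0; rewrite -(clock0 cK w); apply: (clock_nd cK). Qed.

Lemma le_integral_layers (f1 f2 : measurableTypeR R -> \bar R) (N : set R) :
  measurable_fun (`]0%R, +oo[%classic : set (measurableTypeR R)) f1 ->
  measurable_fun (`]0%R, +oo[%classic : set (measurableTypeR R)) f2 ->
  (forall r, 0 <= f1 r)%E -> (forall r, 0 <= f2 r)%E ->
  (@lebesgue_measure R).-negligible N ->
  (forall r, 0 < r -> ~ N r -> (f1 r <= f2 r)%E) ->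
  (\int[lebesgue_measure]_(r in `]0%R, +oo[) f1 r <=
   \int[lebesgue_measure]_(r in `]0%R, +oo[) f2 r)%E.
Proof.
move=> m1 m2 f10 f20 Nn H.
apply: (@ae_ge0_le_integral _ (measurableTypeR R) R (@lebesgue_measure R)) => //.
apply: negligibleS Nn => r /= Hr; apply: contrapT => Nr; apply: Hr.
by rewrite in_itv/= andbT => r0; exact: H.
Qed.

Section clock_bounds.
Variables (x y z : E) (K : R -> Omega -> R).
Hypothesis clockK : is_clock X y K.

Let mKe t : 0 <= t -> measurable_fun setT (fun w => (K t w)%:E).
Proof. by move=> t0; apply/measurable_EFinP; exact: measurable_clock clockK t0. Qed.

Let clock_massE t : 0 <= t -> (\int[P x]_w (K t w)%:E * egreen L y z =
  \int[lebesgue_measure]_(r in `]0%R, +oo[) (P x (clock_event K r t) * egreen L y z))%E.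
Proof.
move=> t0; have K0 w : (0 <= (K t w)%:E)%E by rewrite lee_fin (clock_ge0 w clockK).
rewrite (ge0_layer_cake_restrict _ measurableT (mKe t0))//.
rewrite ge0_integralZr ?egreen_ge0//.
- by congr (_ * _)%E; apply: eq_integral => r _; rewrite setTI.
- have := measurable_fun_layer_restrict (P x) measurableT (mKe t0) K0.
  by apply: eq_measurable_fun => r _; rewrite setTI.
Qed.

Let mlevel t : 0 <= t ->
  measurable_fun (`]0%R, +oo[%classic : set (measurableTypeR R))
    (fun r => P x (clock_event K r t) * egreen L y z)%E.
Proof.
move=> t0; have K0 w : (0 <= (K t w)%:E)%E by rewrite lee_fin (clock_ge0 w clockK).
apply: (eq_measurable_fun (fun r : measurableTypeR R =>
    egreen L y z * P x (setT `&` [set w | (r%:E <= (K t w)%:E)%E]))%E).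
  by move=> r _; rewrite muleC setTI.
by apply: measurable_funeM; exact: measurable_fun_layer_restrict (mKe t0) K0.
Qed.

(** The hit precedes t on {K_t >= r}, so what remains after t is at most what remains after the hit;
    this is integrated over almost all levels r. *)
Lemma clock_mass_ge t : 0 <= t ->
  (\int[P x]_w ((K t w)%:E * (tot z w - (L z t w)%:E)) <=
   \int[P x]_w (K t w)%:E * egreen L y z)%E.
Proof.
move=> t0; have K0 w : (0 <= (K t w)%:E)%E by rewrite lee_fin (clock_ge0 w clockK).
have V0 w : (0 <= tot z w - (L z t w)%:E)%E by exact: remaining_ge0.
have mV := measurable_remaining z t0.
rewrite clock_massE// (ge0_layer_cake _ (mKe t0) K0 mV V0).
apply: (le_integral_layers _ _ _ _ (clock_flat_negligible x clockK)) => //.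
- exact: measurable_fun_layer (mKe t0) mV V0.
- exact: mlevel.
- by move=> r; apply: integral_ge0 => w _.
- by move=> r; rewrite mule_ge0// egreen_ge0.
- move=> r r0 /= /contrapT flat0.
  apply: (integral_le_regenerated clockK r0 t0 flat0 mV V0) => w u _ /andP[u0 ut].
  exact: remaining_le.
Qed.

(** Since K vanishes at s, no positive level is hit before s: what remains after s dominates what
    remains after the hit. *)
Lemma clock_mass_le s t : 0 <= s -> 0 <= t -> (forall w, K s w = 0) ->
  (\int[P x]_w (K t w)%:E * egreen L y z <=
   \int[P x]_w ((K t w)%:E * (tot z w - (L z s w)%:E)))%E.
Proof.
move=> s0 t0 Ks; have K0 w : (0 <= (K t w)%:E)%E by rewrite lee_fin (clock_ge0 w clockK).
have V0 w : (0 <= tot z w - (L z s w)%:E)%E by exact: remaining_ge0.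
have mV := measurable_remaining z s0.
rewrite clock_massE// (ge0_layer_cake _ (mKe t0) K0 mV V0).
apply: (le_integral_layers _ _ _ _ (clock_flat_negligible x clockK)) => //.
- exact: mlevel.
- exact: measurable_fun_layer (mKe t0) mV V0.
- by move=> r; rewrite mule_ge0// egreen_ge0.
- by move=> r; apply: integral_ge0 => w _.
- move=> r r0 /= /contrapT flat0.
  apply: (integral_ge_regenerated clockK r0 t0 flat0 mV V0) => w u hu /andP[u0 ut].
  apply: remaining_le => //; rewrite leNgt; apply/negP => us.
  have [_ Ku] := clock_at_hit clockK r0 hu.
  have := clock_nd clockK w u0 (ltW us).
  by rewrite /= Ks Ku leNgt r0.
Qed.

End clock_bounds.

Section local_time_clock.
Variables (y : E) (s : R) (H : Omega -> R).
Hypotheses (s0 : 0 <= s) (H0 : forall w, 0 <= H w).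
Hypothesis mH : measurable_fun (setT : set (filtered X s)) H.

(** [Num.max u s] keeps the clock at 0 up to time s. The weight [H] enters only once it is known, so
    the process is adapted. *)
Definition weighted_clock (u : R) (w : Omega) : R :=
  H w * (L y (Num.max u s) w - L y s w).

Lemma weighted_clock_is_clock : is_clock X y weighted_clock.
Proof.
have ms u : 0 <= Num.max u s by rewrite le_max s0 orbT.
split.
- move=> t t0; have [ts|st] := leP t s.
    rewrite (_ : weighted_clock t = cst 0); first exact: measurable_cst.
    by apply/funext => w; rewrite /weighted_clock (max_idPr ts) subrr mulr0.
  rewrite (_ : weighted_clock t = fun w => H w * (L y t w - L y s w)); last first.
    by apply/funext => w; rewrite /weighted_clock (max_idPl (ltW st)).
  apply: measurable_funM; first exact: measurable_fun_filtered_le (ltW st) mH.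
  apply: measurable_funB; first exact: measurable_local_time_filtered.
  apply: measurable_fun_filtered_le (ltW st) _.
  exact: measurable_local_time_filtered.
- by move=> w; rewrite /weighted_clock (max_idPr s0) subrr mulr0.
- move=> w u v u0 uv; rewrite /weighted_clock ler_wpM2l// lerD2r.
  by rewrite local_time_le// ge_max !le_max uv lexx orbT.
- move=> w; apply: within_ge0_continuous => c e c0 e0.
  have e0' : 0 < e / (H w + 1) by rewrite divr_gt0// ltr_wpDl.
  have [h h0 Hh] := within_ge0_continuousP (@local_time_continuous _ _ _ _ _ _ L y w) (ms c) e0'.
  exists h => // u u0 uc.
  have : `|Num.max u s - Num.max c s| < h.
    apply: le_lt_trans uc; case: (leP u s) => us; case: (leP c s) => cs //.
    - by rewrite subrr normr0.
    - by rewrite !ler0_norm; lra.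
    - by rewrite !ger0_norm; lra.
  move=> /(Hh _ (ms u)) {}Hh.
  rewrite /weighted_clock -mulrBr opprB addrA subrK normrM (ger0_norm (H0 w)).
  apply: (@le_lt_trans _ _ (H w * (e / (H w + 1)))).
    by rewrite ler_wpM2l// ltW.
  rewrite mulrCA -[ltRHS]mulr1 ltr_pM2l// ltr_pdivrMr ?mul1r ?ltrDl//.
  by rewrite ltr_wpDl.
- move=> t w t0 Hgr.
  have st : s <= t.
    rewrite leNgt; apply/negP => ts; have := Hgr s ts.
    by rewrite /weighted_clock (max_idPr (ltW ts)) maxxx ltxx.
  apply: (local_time_grows (l := L) t0) => u tu; have := Hgr u tu.
  rewrite /weighted_clock (max_idPl st) (max_idPl (le_trans st (ltW tu))).
  rewrite -subr_gt0 -mulrBr opprB addrA subrK => h.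
  rewrite -subr_gt0 ltNge; apply/negP => h'.
  by move: h; rewrite ltNge mulr_ge0_le0.
Qed.

(** With [occupation_le], this encloses E [H (L_t - L_s)] g (y, z) between the local times at z
    remaining after t and after s: the strong Markov property integrated over one grid interval. *)
Lemma occupation_ge x z t : s <= t ->
  (\int[P x]_w ((H w * (L y t w - L y s w))%:E * (tot z w - (L z t w)%:E)) <=
   \int[P x]_w (H w * (L y t w - L y s w))%:E * egreen L y z)%E.
Proof.
move=> st; have := clock_mass_ge x z weighted_clock_is_clock (le_trans s0 st).
by rewrite /weighted_clock (max_idPl st).
Qed.

Lemma occupation_le x z t : s <= t ->
  (\int[P x]_w (H w * (L y t w - L y s w))%:E * egreen L y z <=
   \int[P x]_w ((H w * (L y t w - L y s w))%:E * (tot z w - (L z s w)%:E)))%E.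
Proof.
move=> st; have := clock_mass_le x z weighted_clock_is_clock s0 (le_trans s0 st).
rewrite /weighted_clock (max_idPl st); apply.
by move=> w; rewrite maxxx subrr mulr0.
Qed.

End local_time_clock.

Lemma local_time_is_clock y : is_clock X y (L y).
Proof.
split.
- by move=> t t0; exact: measurable_local_time_filtered.
- exact: local_time0.
- by move=> w u v; exact: local_time_le.
- exact: local_time_continuous.
- by move=> t w; exact: local_time_grows.
Qed.

(* On [r <= l / 2] one has [l / 2 <= l - r], and [l - r] is bounded by the local
   time accumulated after the hitting time of the level r. *)
Lemma local_time_half_sq x y t : 0 <= t ->
  (\int[P x]_w ((L y t w / 2)%:E * (L y t w / 2)%:E) <= egreen L x y * egreen L y y)%E.
Proof.
move=> t0; pose f w := (L y t w / 2)%:E.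
have f0 w : (0 <= f w)%E by rewrite lee_fin divr_ge0// local_time_ge0.
have mf : measurable_fun setT f.
  by apply/measurable_EFinP; apply: measurable_funM => //; exact: measurable_local_time.
have clockL := local_time_is_clock y.
have L0 w : (0 <= (L y t w)%:E)%E by rewrite lee_fin local_time_ge0.
have mL : measurable_fun setT (fun w => (L y t w)%:E).
  by apply/measurable_EFinP; exact: measurable_local_time.
rewrite (ge0_layer_cake _ mf f0 mf f0).
apply: (@le_trans _ _ (\int[P x]_w (L y t w)%:E * egreen L y y)%E); last first.
  rewrite egreenE lee_wpmul2r ?egreen_ge0//; apply: ge0_le_integral => //.
  - exact: measurable_total_path.
  - by move=> w _; exact: local_time_le_total.
rewrite (ge0_layer_cake_restrict _ measurableT mL)// -ge0_integralZr ?egreen_ge0//; last first.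
  exact: measurable_fun_layer_restrict.
apply: (le_integral_layers _ _ _ _ (clock_flat_negligible x clockL)) => //.
- exact: measurable_fun_layer.
- apply: (eq_measurable_fun (fun r : measurableTypeR R =>
    egreen L y y * P x (setT `&` [set w | (r%:E <= (L y t w)%:E)%E]))%E).
    by move=> r _; rewrite muleC.
  by apply: measurable_funeM; exact: measurable_fun_layer_restrict.
- by move=> r; apply: integral_ge0 => w _.
- by move=> r; rewrite mule_ge0// egreen_ge0.
move=> r r0 /= /contrapT flat0; rewrite setTI.
pose V w := (Num.max 0 (L y t w - r))%:E.
have mV : measurable_fun setT V.
  apply/measurable_EFinP; apply: measurable_maxr => //.
  by apply: measurable_funB => //; exact: measurable_local_time.
have V0 w : (0 <= V w)%E by rewrite lee_fin le_max lexx.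
apply: le_trans (integral_le_regenerated clockL r0 t0 flat0 mV V0 _); last first.
  move=> w u hu /andP[u0 ut]; have [_ Lu] := clock_at_hit clockL r0 hu.
  rewrite Lu /V leeBrDr// -EFinD; apply: le_trans (local_time_le_total L y w t0).
  have rL : r <= L y t w by rewrite -Lu; exact: local_time_le.
  by rewrite lee_fin (max_idPr _) ?subr_ge0// subrK.
have mA : measurable (clock_event (L y) r t).
  exact: natural_filtration_measurable (clock_event_filtration clockL r t0).
have mB : measurable [set w | (r%:E <= f w)%E].
  by rewrite -[X in measurable X]setTI; exact: measurable_lee.
have BA : [set w | (r%:E <= f w)%E] `<=` clock_event (L y) r t.
  move=> w; rewrite /clock_event /f /= !lee_fin => rL.
  by apply: (le_trans rL); have := local_time_ge0 L y w t0; lra.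
apply: (@le_trans _ _ (\int[P x]_(w in [set w | (r%:E <= f w)%E]) V w)%E); last first.
  by apply: ge0_subset_integral => //; exact: measurable_funTS.
apply: ge0_le_integral => //.
- exact: measurable_funTS.
- exact: measurable_funTS.
- move=> w; rewrite /f /V /= !lee_fin => rL; rewrite le_max; apply/orP; right; lra.
Qed.

(** These second moments dominate the discretization error. The 4 undoes the two halvings of
    [local_time_half_sq]. *)
Lemma total_local_time_sq x y :
  (\int[P x]_w (tot y w * tot y w) <= 4%:E * (egreen L x y * egreen L y y))%E.
Proof.
have mL n : measurable_fun setT (fun w => (L y n%:R w)%:E).
  by apply/measurable_EFinP; exact: measurable_local_time.
have L0 n w : (0 <= (L y n%:R w)%:E)%E by rewrite lee_fin local_time_ge0.
have -> : (\int[P x]_w (tot y w * tot y w) =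
    \int[P x]_w limn (fun n => (L y n%:R w)%:E * (L y n%:R w)%:E))%E.
  apply: eq_integral => w _; apply/esym/cvg_lim => //.
  have h := @total_local_time_cvg _ _ _ _ _ _ L y w.
  by apply: cvgeM => //; case: (tot y w).
rewrite monotone_convergence//; last 3 first.
- by move=> n; exact: emeasurable_funM.
- by move=> n w _; exact: mule_ge0.
- move=> w _ m n mn; rewrite lee_pmul// lee_fin local_time_le// ler_nat//.
apply: lime_le.
  apply: ereal_nondecreasing_is_cvgn => m n mn.
  apply: ge0_le_integral => //.
  - by move=> w _; exact: mule_ge0.
  - exact: emeasurable_funM.
  - exact: emeasurable_funM.
  - by move=> w _; rewrite lee_pmul// lee_fin local_time_le// ler_nat.
apply: nearW => n.
apply: (@le_trans _ _ (4%:E * \int[P x]_w ((L y n%:R w / 2)%:E * (L y n%:R w / 2)%:E))%E).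
  rewrite -ge0_integralZl//.
  - apply: ge0_le_integral => //.
    + by move=> w _; exact: mule_ge0.
    + exact: emeasurable_funM.
    + apply/measurable_EFinP; apply: measurable_funM => //.
      by apply: measurable_funM; apply: measurable_funM => //; exact: measurable_local_time.
    + by move=> w _; rewrite -!EFinM lee_fin; lra.
  - apply/measurable_EFinP.
    by apply: measurable_funM; apply: measurable_funM => //; exact: measurable_local_time.
  - by move=> w _; rewrite -EFinM lee_fin mulr_ge0// divr_ge0// local_time_ge0.
by rewrite lee_wpmul2l// local_time_half_sq.
Qed.

End occupation_bounds.

(** * The resolvent equation *)

Section discrete.
Variable R : realType.
Implicit Types (a d l : nat -> R).

Lemma telescope_ord l N : \sum_(k < N) (l k.+1 - l k) = l N - l 0%N.
Proof. by rewrite -(big_mkord xpredT (fun k => l k.+1 - l k)) telescope_sumr. Qed.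

Lemma telescope_ordN d N : \sum_(k < N) (d k - d k.+1) = d 0%N - d N.
Proof.
rewrite -[RHS]opprB -telescope_ord -sumrN; apply: eq_bigr => k _.
by rewrite opprB.
Qed.

Lemma summation_by_parts d l N : d 0%N = 1 ->
  \sum_(k < N) (1 - d k) * (l k.+1 - l k) =
  \sum_(k < N) (d k - d k.+1) * (l N - l k.+1).
Proof.
move=> d0; elim: N => [|N IH]; first by rewrite !big_ord0.
rewrite !big_ord_recr /= IH subrr mulr0 addr0 -d0 -telescope_ordN.
rewrite mulr_suml -big_split /=; apply: eq_bigr => k _; ring.
Qed.

Let weighted_increments d l N : d 0%N = 1 -> l 0%N = 0 ->
  \sum_(k < N) d k * (l k.+1 - l k) =
  l N - \sum_(k < N) (d k - d k.+1) * (l N - l k.+1).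
Proof.
move=> d0 l0; rewrite -summation_by_parts//.
have -> : l N = \sum_(k < N) (l k.+1 - l k) by rewrite telescope_ord l0 subr0.
by rewrite -sumrB; apply: eq_bigr => k _; ring.
Qed.

(** Model: for d = exp (- a), l_N is the integral of d dl plus that of (l_N - l) d da. On the grid
    the increments d da exceed the decrements of d, which leaves an inequality. *)
Lemma discrete_resolvent_ge a d l N : d 0%N = 1 -> l 0%N = 0 ->
  (forall k, d k - d k.+1 <= d k * (a k.+1 - a k)) ->
  (forall j k, (j <= k)%N -> l j <= l k) ->
  l N <= \sum_(k < N) d k * (l k.+1 - l k) +
         \sum_(k < N) d k * (a k.+1 - a k) * (l N - l k.+1).
Proof.
move=> d0 l0 da ndl; rewrite weighted_increments// -addrA lerDl addrC subr_ge0.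
by apply: ler_sum => k _; rewrite ler_wpM2r// subr_ge0 ndl.
Qed.

(** The same model read in the other direction, at the price of three errors: the cross variation of
    a and d, the tail [M - l N] beyond the horizon, and the cross variation of a and l. *)
Lemma discrete_resolvent_le a d l N M : d 0%N = 1 -> l 0%N = 0 ->
  (forall k, 0 <= d k <= 1) ->
  (forall k, a k <= a k.+1) ->
  (forall k, d k.+1 * (a k.+1 - a k) <= d k - d k.+1) ->
  (forall j k, (j <= k)%N -> l j <= l k) -> l N <= M ->
  \sum_(k < N) d k * (l k.+1 - l k) +
  \sum_(k < N) d k * (a k.+1 - a k) * (M - l k) <=
  M + \sum_(k < N) (a k.+1 - a k) *
        ((d k - d k.+1) * M + (M - l N) + (l k.+1 - l k)).
Proof.
move=> d0 l0 d01 nda da ndl lM; rewrite weighted_increments//.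
have H : \sum_(k < N) d k * (a k.+1 - a k) * (M - l k) <=
  \sum_(k < N) (a k.+1 - a k) * ((d k - d k.+1) * M + (M - l N) + (l k.+1 - l k)) +
  \sum_(k < N) (d k - d k.+1) * (l N - l k.+1).
  rewrite -big_split; apply: ler_sum => k _ /=.
  have da0 : 0 <= a k.+1 - a k by rewrite subr_ge0.
  have lk0 : 0 <= l k by rewrite -l0 ndl.
  have lkN : 0 <= l N - l k.+1 by rewrite subr_ge0 ndl.
  have /andP[dk0 _] := d01 k; have /andP[dk'0 dk'1] := d01 k.+1.
  have dd : 0 <= d k - d k.+1 by apply: le_trans (da k); rewrite mulr_ge0.
  apply: (@le_trans _ _ ((a k.+1 - a k) * ((d k - d k.+1) * M + (M - l N) + (l k.+1 - l k))
    + d k.+1 * (a k.+1 - a k) * (l N - l k.+1))); last first.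
    by rewrite lerD2l ler_wpM2r.
  (* The excess of this side is an increment of a times a sum of products of nonnegative factors. *)
  have -> : (a k.+1 - a k) * ((d k - d k.+1) * M + (M - l N) + (l k.+1 - l k))
    + d k.+1 * (a k.+1 - a k) * (l N - l k.+1) =
    d k * (a k.+1 - a k) * (M - l k) + (a k.+1 - a k) * ((d k - d k.+1) * l k +
      (1 - d k.+1) * ((M - l N) + (l k.+1 - l k))) by ring.
  have ll : 0 <= l k.+1 - l k by rewrite subr_ge0 ndl.
  rewrite lerDl mulr_ge0// addr_ge0 ?mulr_ge0//; first by rewrite subr_ge0.
  by rewrite addr_ge0// subr_ge0.
move: H; set S1 := \sum_(k < N) _; set S2 := \sum_(k < N) _; set S3 := \sum_(k < N) _.
by move=> H; lra.
Qed.

End discrete.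

(** * The two resolvent inequalities on a grid *)

Section resolvent.
Context {R : realType} {dE dO : measure_display}.
Context {E : measurableType dE} {Omega : measurableType dO}.
Context {X : markovProcess R E Omega}.
Variable L : localTime X.
Hypothesis transientL : transient L.
Local Notation tot := (total_local_time L).
Local Notation P := (path_law X).
Variables (m : nat) (alpha : 'rV[R]_m.+1) (xi : 'I_m.+1 -> E).
Hypothesis alpha0 : forall i, 0 <= alpha 0 i.

Definition additive_functional (t : R) (w : Omega) : R :=
  \sum_(i < m.+1) alpha 0 i * L (xi i) t w.

Definition discount (t : R) (w : Omega) : R := expR (- additive_functional t w).

Local Notation A := additive_functional.
Local Notation D := discount.

Lemma measurable_additive_functional t : 0 <= t ->
  measurable_fun (setT : set (filtered X t)) (A t).
Proof.
move=> t0; apply: measurable_sum => i; apply: measurable_funM => //.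
exact: measurable_local_time_filtered.
Qed.

Lemma measurable_discount t : 0 <= t ->
  measurable_fun (setT : set (filtered X t)) (D t).
Proof.
move=> t0; apply: measurableT_comp => //; apply: measurableT_comp => //.
exact: measurable_additive_functional.
Qed.

Lemma additive_functional_nd w : nondecr_ge0 (A ^~ w).
Proof.
move=> s t s0 st; apply: ler_sum => i _; rewrite ler_wpM2l//.
exact: local_time_le.
Qed.

Lemma additive_functional_continuous w : {within `[0, +oo[, continuous (A ^~ w)}.
Proof.
rewrite /additive_functional => c.
apply: cvg_big => [|i _]; first exact: add_continuous.
by apply: cvgMr; exact: (@local_time_continuous _ _ _ _ _ _ L (xi i) w).
Qed.

Lemma additive_functional0 w : A 0 w = 0.
Proof. by rewrite /A big1// => i _; rewrite local_time0 mulr0. Qed.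

Lemma additive_functional_ge0 t w : 0 <= t -> 0 <= A t w.
Proof. by move=> t0; rewrite -(additive_functional0 w); exact: additive_functional_nd. Qed.

Lemma discount01 t w : 0 <= t -> 0 <= D t w <= 1.
Proof.
by move=> t0; rewrite expR_ge0 -[leRHS]expR0 ler_expR oppr_le0 additive_functional_ge0.
Qed.

Lemma discount_decr s t w : D s w - D t w <= D s w * (A t w - A s w).
Proof.
have -> : D t w = D s w * expR (- (A t w - A s w)) by rewrite -expRD; congr expR; ring.
rewrite -{1}[D s w]mulr1 -mulrBr ler_wpM2l ?expR_ge0//.
by have := expR_ge1Dx (- (A t w - A s w)); lra.
Qed.

Lemma discount_decr_ge s t w : D t w * (A t w - A s w) <= D s w - D t w.
Proof. by have := discount_decr t s w; rewrite -opprB -[A s w - _]opprB mulrN lerN2. Qed.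

Local Notation a := (xi ord0).
Local Notation incr i n k w := (L (xi i) (grid R n k.+1) w - L (xi i) (grid R n k) w).

Definition discounted_increment n i k (w : Omega) : R :=
  D (grid R n k) w * incr i n k w.

Local Notation W := discounted_increment.

(** Left Riemann sum for E_a of the integral of exp (- A_t) dL_t^{x_i}, up to the horizon n + 1. *)
Definition discounted_occupation n i : \bar R :=
  (\sum_(k < n.+1 ^ 2) \int[P a]_w (W n i k w)%:E)%E.

Local Notation V := discounted_occupation.

Let grid0' n k : 0 <= grid R n k. Proof. exact: grid_ge0. Qed.
Let gridS n k : grid R n k <= grid R n k.+1. Proof. exact: grid_le. Qed.
Let grid_nd n j k : (j <= k)%N -> grid R n j <= grid R n k.
Proof. by move=> jk; rewrite ler_pM2r ?invr_gt0// ler_nat. Qed.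

Let incr_ge0 i n k w : 0 <= incr i n k w.
Proof. by rewrite subr_ge0 local_time_le. Qed.

Let W_ge0 n i k w : 0 <= W n i k w.
Proof. by rewrite mulr_ge0// expR_ge0. Qed.

Let mincr i n k : measurable_fun setT (fun w => incr i n k w).
Proof. by apply: measurable_funB; exact: measurable_local_time. Qed.

Let mD t : 0 <= t -> measurable_fun setT (D t).
Proof. by move=> t0; exact: measurable_fun_filtered (measurable_discount t0). Qed.

Let mA t : 0 <= t -> measurable_fun setT (A t).
Proof. by move=> t0; exact: measurable_fun_filtered (measurable_additive_functional t0). Qed.

Let mW n i k : measurable_fun setT (W n i k).
Proof. by apply: measurable_funM => //; exact: mD. Qed.

Let mWe n i k : measurable_fun setT (fun w => (W n i k w)%:E).
Proof. exact/measurable_EFinP. Qed.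

Let gE i j : egreen L (xi i) (xi j) = (green L (xi i) (xi j))%:E.
Proof. by rewrite fineK// ge0_fin_numE ?transientL// egreen_ge0. Qed.

Let AincrE n k w : A (grid R n k.+1) w - A (grid R n k) w =
  \sum_i alpha 0 i * incr i n k w.
Proof. by rewrite -sumrB; apply: eq_bigr => i _; rewrite mulrBr. Qed.

Let DAincrE n k w (c : R) :
  D (grid R n k) w * (A (grid R n k.+1) w - A (grid R n k) w) * c =
  \sum_i alpha 0 i * (W n i k w * c).
Proof.
rewrite AincrE mulr_sumr mulr_suml; apply: eq_bigr => i _.
by rewrite /W; ring.
Qed.

Lemma discounted_occupation_ge0 n i : (0 <= V n i)%E.
Proof. by apply: sume_ge0 => k _; apply: integral_ge0 => w _; rewrite lee_fin. Qed.

(** [discrete_resolvent_ge] is integrated term by term. The local time at the horizon is first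
    enlarged to the total one, so that [occupation_ge] can replace the remaining local times by the
    Green function. *)
Lemma integral_local_time_le j n :
  (\int[P a]_w (L (xi j) n.+1%:R w)%:E <=
   V n j + \sum_i (alpha 0 i)%:E * (V n i * (green L (xi i) (xi j))%:E))%E.
Proof.
pose rem k w : \bar R := (tot (xi j) w - (L (xi j) (grid R n k) w)%:E)%E.
have rem0 k w : (0 <= rem k w)%E by exact: remaining_ge0.
have mrem k : measurable_fun setT (rem k) by exact: measurable_remaining.
have mWr i k : measurable_fun setT (fun w => (W n i k w)%:E * rem k.+1 w)%E.
  exact: emeasurable_funM.
have Wr0 i k w : (0 <= (W n i k w)%:E * rem k.+1 w)%E by rewrite mule_ge0// lee_fin.
have aWr0 i k w : (0 <= (alpha 0 i)%:E * ((W n i k w)%:E * rem k.+1 w))%E.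
  by rewrite mule_ge0// lee_fin.
have maWr i k : measurable_fun setT
    (fun w => (alpha 0 i)%:E * ((W n i k w)%:E * rem k.+1 w))%E.
  exact: measurable_funeM.
apply: (@le_trans _ _ (\int[P a]_w (\sum_(k < n.+1 ^ 2) (W n j k w)%:E +
   \sum_i \sum_(k < n.+1 ^ 2) (alpha 0 i)%:E * ((W n i k w)%:E * rem k.+1 w)))%E).
  apply: ge0_le_integral => //.
  - by move=> w _; rewrite lee_fin local_time_ge0.
  - by apply/measurable_EFinP; exact: measurable_local_time.
  - apply: emeasurable_funD; first by apply: emeasurable_sum.
    by apply: emeasurable_sum => i; exact: emeasurable_sum.
  - move=> w _.
    apply: (@le_trans _ _ (\sum_(k < n.+1 ^ 2) W n j k w +
        \sum_(k < n.+1 ^ 2) D (grid R n k) w *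
          (A (grid R n k.+1) w - A (grid R n k) w) *
          (L (xi j) n.+1%:R w - L (xi j) (grid R n k.+1) w))%:E).
      rewrite lee_fin -(@grid_last R n).
      apply: (@discrete_resolvent_ge _ (fun k => A (grid R n k) w)
        (fun k => D (grid R n k) w) (fun k => L (xi j) (grid R n k) w)).
      + by rewrite /D grid0 additive_functional0 oppr0 expR0.
      + by rewrite grid0 local_time0.
      + by move=> k; exact: discount_decr.
      + by move=> k k' kk'; rewrite local_time_le// grid_nd.
    rewrite EFinD leeD// ?sumEFin//.
    under eq_bigr do rewrite DAincrE.
    rewrite exchange_big /= -sumEFin; apply: lee_sum => i _.
    rewrite -sumEFin; apply: lee_sum => k _.
    rewrite EFinM lee_wpmul2l ?lee_fin// EFinM lee_wpmul2l ?lee_fin//.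
    by rewrite EFinB leeB//; exact: local_time_le_total.
rewrite ge0_integralD//; first last.
- by apply: emeasurable_sum => i; exact: emeasurable_sum.
- by move=> w _; apply: sume_ge0 => i _; apply: sume_ge0 => k _.
- exact: emeasurable_sum.
- by move=> w _; apply: sume_ge0 => k _; rewrite lee_fin.
rewrite ge0_integral_sum//; last by move=> k w _; rewrite lee_fin.
rewrite leeD2l// ge0_integral_sum//; last 2 first.
- by move=> i; exact: emeasurable_sum.
- by move=> i w _; apply: sume_ge0 => k _.
apply: lee_sum => i _.
rewrite ge0_integral_sum//.
rewrite /V ge0_sume_distrl; last by move=> k _; apply: integral_ge0 => w _; rewrite lee_fin.
rewrite ge0_sume_distrr; last first.
  move=> k _; rewrite mule_ge0//; last by rewrite lee_fin fine_ge0// egreen_ge0.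
  by apply: integral_ge0 => w _; rewrite lee_fin.
apply: lee_sum => k _; rewrite ge0_integralZl ?lee_fin// lee_wpmul2l ?lee_fin// -gE.
by apply: occupation_ge => // [w|]; [rewrite expR_ge0|exact: measurable_discount].
Qed.

(** The three errors of [discrete_resolvent_le], for l the local time at x_j and M its total. *)
Definition resolvent_error n j (w : Omega) : \bar R :=
  (\sum_(k < n.+1 ^ 2) (A (grid R n k.+1) w - A (grid R n k) w)%:E *
    ((D (grid R n k) w - D (grid R n k.+1) w)%:E * tot (xi j) w +
     (tot (xi j) w - (L (xi j) n.+1%:R w)%:E) + (incr j n k w)%:E))%E.

Local Notation err := resolvent_error.

Let Aincr_ge0 n k w : 0 <= A (grid R n k.+1) w - A (grid R n k) w.
Proof. by rewrite subr_ge0 additive_functional_nd. Qed.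

Let Dincr_ge0 n k w : 0 <= D (grid R n k) w - D (grid R n k.+1) w.
Proof.
apply: le_trans (discount_decr_ge (grid R n k) (grid R n k.+1) w).
by rewrite mulr_ge0// expR_ge0.
Qed.

Let err_term_ge0 n j k w :
  (0 <= (D (grid R n k) w - D (grid R n k.+1) w)%:E * tot (xi j) w +
     (tot (xi j) w - (L (xi j) n.+1%:R w)%:E) + (incr j n k w)%:E)%E.
Proof.
apply: adde_ge0; last by rewrite lee_fin.
apply: adde_ge0; last exact: remaining_ge0.
by rewrite mule_ge0 ?lee_fin// total_local_time_ge0.
Qed.

Lemma resolvent_error_ge0 n j w : (0 <= err n j w)%E.
Proof. by apply: sume_ge0 => k _; rewrite mule_ge0// lee_fin. Qed.

Lemma measurable_resolvent_error n j : measurable_fun setT (err n j).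
Proof.
apply: emeasurable_sum => k; apply: emeasurable_funM.
  by apply/measurable_EFinP; apply: measurable_funB; exact: mA.
apply: emeasurable_funD; last exact/measurable_EFinP.
apply: emeasurable_funD; last exact: measurable_remaining.
apply: emeasurable_funM; last exact: measurable_total_path.
by apply/measurable_EFinP; apply: measurable_funB; exact: mD.
Qed.

Let tot_fineE j w : tot (xi j) w \is a fin_num ->
  forall t, 0 <= t -> L (xi j) t w <= fine (tot (xi j) w).
Proof.
by move=> fin t t0; rewrite -lee_fin fineK//; exact: local_time_le_total.
Qed.

Let errE n j w : tot (xi j) w \is a fin_num -> err n j w =
  (\sum_(k < n.+1 ^ 2) (A (grid R n k.+1) w - A (grid R n k) w) *
    ((D (grid R n k) w - D (grid R n k.+1) w) * fine (tot (xi j) w) +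
     (fine (tot (xi j) w) - L (xi j) n.+1%:R w) + incr j n k w))%:E.
Proof.
move=> fin; rewrite -sumEFin; apply: eq_bigr => k _.
by rewrite EFinM !EFinD EFinM EFinB fineK.
Qed.

(** Here [occupation_le] bounds the Green function by what remains after the left end of each
    interval, which is why [discrete_resolvent_le] has [M - l k] with index k. *)
Lemma discounted_occupation_le j n :
  (V n j + \sum_i (alpha 0 i)%:E * (V n i * (green L (xi i) (xi j))%:E) <=
   egreen L a (xi j) + \int[P a]_w err n j w)%E.
Proof.
pose rem k w : \bar R := (tot (xi j) w - (L (xi j) (grid R n k) w)%:E)%E.
have rem0 k w : (0 <= rem k w)%E by exact: remaining_ge0.
have mrem k : measurable_fun setT (rem k) by exact: measurable_remaining.
have mWr i k : measurable_fun setT (fun w => (W n i k w)%:E * rem k w)%E.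
  exact: emeasurable_funM.
have Wr0 i k w : (0 <= (W n i k w)%:E * rem k w)%E by rewrite mule_ge0// lee_fin.
have aWr0 i k w : (0 <= (alpha 0 i)%:E * ((W n i k w)%:E * rem k w))%E.
  by rewrite mule_ge0// lee_fin.
have maWr i k : measurable_fun setT
    (fun w => (alpha 0 i)%:E * ((W n i k w)%:E * rem k w))%E.
  exact: measurable_funeM.
have msum : measurable_fun setT (fun w =>
    \sum_i \sum_(k < n.+1 ^ 2) (alpha 0 i)%:E * ((W n i k w)%:E * rem k w))%E.
  by apply: emeasurable_sum => i; exact: emeasurable_sum.
apply: (@le_trans _ _ (\int[P a]_w (\sum_(k < n.+1 ^ 2) (W n j k w)%:E +
   \sum_i \sum_(k < n.+1 ^ 2) (alpha 0 i)%:E * ((W n i k w)%:E * rem k w)))%E).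
  rewrite ge0_integralD//; first last.
  - by move=> w _; apply: sume_ge0 => i _; apply: sume_ge0 => k _.
  - exact: emeasurable_sum.
  - by move=> w _; apply: sume_ge0 => k _; rewrite lee_fin.
  rewrite ge0_integral_sum//; last by move=> k w _; rewrite lee_fin.
  rewrite leeD2l// ge0_integral_sum//; last 2 first.
  - by move=> i; exact: emeasurable_sum.
  - by move=> i w _; apply: sume_ge0 => k _.
  apply: lee_sum => i _.
  rewrite ge0_integral_sum//.
  rewrite /V ge0_sume_distrl; last by move=> k _; apply: integral_ge0 => w _; rewrite lee_fin.
  rewrite ge0_sume_distrr; last first.
    move=> k _; rewrite mule_ge0//; last by rewrite lee_fin fine_ge0// egreen_ge0.
    by apply: integral_ge0 => w _; rewrite lee_fin.
  apply: lee_sum => k _; rewrite ge0_integralZl ?lee_fin// lee_wpmul2l ?lee_fin// -gE.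
  by apply: occupation_le => // [w|]; [rewrite expR_ge0|exact: measurable_discount].
rewrite egreenE -ge0_integralD//; last 4 first.
- by move=> w _; exact: total_local_time_ge0.
- exact: measurable_total_path.
- by move=> w _; exact: resolvent_error_ge0.
- exact: measurable_resolvent_error.
apply: ge0_le_integral => //.
- move=> w _; rewrite adde_ge0//; first by apply: sume_ge0 => k _; rewrite lee_fin.
  by apply: sume_ge0 => i _; apply: sume_ge0 => k _.
- by apply: emeasurable_funD => //; exact: emeasurable_sum.
- apply: emeasurable_funD; first exact: measurable_total_path.
  exact: measurable_resolvent_error.
(* Where the total local time is infinite, the right-hand side is [+oo]; elsewhere the inequality is
   one between real numbers. *)
move=> w _; have [fin|] := boolP (tot (xi j) w \is a fin_num); last first.
  rewrite ge0_fin_numE ?total_local_time_ge0// -leNgt leye_eq => /eqP ->.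
  by rewrite addye ?leey// gt_eqF// (lt_le_trans _ (resolvent_error_ge0 n j w)).
rewrite errE// -[X in (_ <= X + _)%E](fineK fin) -EFinD.
have -> : (\sum_i \sum_(k < n.+1 ^ 2) (alpha 0 i)%:E * ((W n i k w)%:E * rem k w) =
    (\sum_(k < n.+1 ^ 2) D (grid R n k) w *
      (A (grid R n k.+1) w - A (grid R n k) w) *
      (fine (tot (xi j) w) - L (xi j) (grid R n k) w))%:E)%E.
  under [in RHS]eq_bigr do rewrite DAincrE.
  rewrite exchange_big /= -sumEFin; apply: eq_bigr => k _.
  rewrite -sumEFin; apply: eq_bigr => i _.
  by rewrite [RHS]EFinM; congr (_ * _)%E; rewrite [RHS]EFinM EFinB fineK.
rewrite sumEFin -EFinD lee_fin -(@grid_last R n).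
apply: (@discrete_resolvent_le _ (fun k => A (grid R n k) w)
  (fun k => D (grid R n k) w) (fun k => L (xi j) (grid R n k) w)).
- by rewrite /D grid0 additive_functional0 oppr0 expR0.
- by rewrite grid0 local_time0.
- by move=> k; exact: discount01.
- by move=> k; exact: additive_functional_nd.
- by move=> k; exact: discount_decr_ge.
- by move=> k k' kk'; rewrite local_time_le// grid_nd.
- exact: tot_fineE.
Qed.

End resolvent.

(** * Vanishing of the discretization error *)

Section resolvent_limit.
Context {R : realType} {dE dO : measure_display}.
Context {E : measurableType dE} {Omega : measurableType dO}.
Context {X : markovProcess R E Omega}.
Variable L : localTime X.
Hypothesis transientL : transient L.
Local Notation tot := (total_local_time L).
Local Notation P := (path_law X).
Variables (m : nat) (alpha : 'rV[R]_m.+1) (xi : 'I_m.+1 -> E).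
Hypothesis alpha0 : forall i, 0 <= alpha 0 i.

Local Notation a := (xi ord0).
Local Notation A := (additive_functional L alpha xi).
Local Notation D := (discount L alpha xi).
Local Notation V := (discounted_occupation L alpha xi).
Local Notation err := (resolvent_error L alpha xi).

(** Each of the three errors multiplying an increment of A is at most tot_j, and the increments of A
    add up to at most the sum of the alpha_i tot_i. *)
Let majorant j w : \bar R := (\sum_i (3 * alpha 0 i)%:E * (tot (xi i) w * tot (xi j) w))%E.

Let tot2 y z w : (tot y w * tot z w <= tot y w * tot y w + tot z w * tot z w)%E.
Proof.
have := total_local_time_ge0 L y w; have := total_local_time_ge0 L z w.
case: (tot y w) => [r| |]//; case: (tot z w) => [s| |]// s0 r0.
- by rewrite -!EFinM -EFinD lee_fin; nra.
- by rewrite [leRHS]addey ?leey// mulyy.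
- by rewrite mulyy addye ?leey// -EFinM.
Qed.

Let mtot y : measurable_fun setT (tot y).
Proof. exact: measurable_total_path. Qed.

Let integral_sq_lty y : (\int[P a]_w (tot y w * tot y w) < +oo)%E.
Proof.
apply: le_lt_trans (total_local_time_sq L a y) _.
by rewrite !lte_mul_pinfty// ?mule_ge0 ?egreen_ge0// ?ge0_fin_numE ?egreen_ge0//;
  apply: transientL.
Qed.

Let majorant_integrable j : (P a).-integrable setT (majorant j).
Proof.
have mm i : measurable_fun setT (fun w => tot (xi i) w * tot (xi j) w)%E.
  exact: emeasurable_funM.
apply: integrable_sum => // i _; apply: integrableZl => //.
apply/integrableP; split => //.
under eq_integral do rewrite gee0_abs ?mule_ge0 ?total_local_time_ge0//.
apply: (@le_lt_trans _ _ (\int[P a]_w (tot (xi i) w * tot (xi i) w +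
   tot (xi j) w * tot (xi j) w))%E).
  apply: ge0_le_integral => //.
  - by move=> w _; rewrite mule_ge0 ?total_local_time_ge0.
  - by apply: emeasurable_funD; exact: emeasurable_funM.
rewrite ge0_integralD//.
- by rewrite lte_add_pinfty.
- by move=> w _; rewrite mule_ge0 ?total_local_time_ge0.
- exact: emeasurable_funM.
- by move=> w _; rewrite mule_ge0 ?total_local_time_ge0.
Qed.

Lemma total_finite_ae : {ae P a, forall w i, tot (xi i) w \is a fin_num}.
Proof.
have : (P a).-integrable setT (fun w => \sum_i tot (xi i) w)%E.
  apply: integrable_sum => // i _; apply/integrableP; split => //.
  under eq_integral do rewrite gee0_abs ?total_local_time_ge0//.
  by rewrite -egreenE; exact: transientL.
move=> /(integrable_ae measurableT).
apply: filterS => w /(_ I) /= fin i.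
rewrite ge0_fin_numE ?total_local_time_ge0//.
move: fin; rewrite ge0_fin_numE; last first.
  by apply: sume_ge0 => k _; exact: total_local_time_ge0.
apply: le_lt_trans; rewrite (bigD1 i)//= leeDl// sume_ge0// => k _.
exact: total_local_time_ge0.
Qed.

Let A_le w t : (forall i, tot (xi i) w \is a fin_num) -> 0 <= t ->
  A t w <= \sum_i alpha 0 i * fine (tot (xi i) w).
Proof.
move=> fin t0; apply: ler_sum => i _; rewrite ler_wpM2l//.
by rewrite -lee_fin fineK//; exact: local_time_le_total.
Qed.

Let err_le_majorant n j w : (err n j w <= majorant j w)%E.
Proof.
pose T := tot (xi j) w.
have T0 : (0 <= T)%E by exact: total_local_time_ge0.
have dA0 k : 0 <= A (grid R n k.+1) w - A (grid R n k) w.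
  by rewrite subr_ge0 additive_functional_nd// ?grid_ge0// grid_le.
apply: (@le_trans _ _ (\sum_(k < n.+1 ^ 2)
    (A (grid R n k.+1) w - A (grid R n k) w)%:E * (3%:E * T))%E).
  apply: lee_sum => k _; rewrite lee_wpmul2l ?lee_fin//.
  have -> : (3%:E * T = T + T + T)%E.
    case: (T) => [r| |]; rewrite -?EFinM -?EFinD.
    - by congr (_%:E); ring.
    - by rewrite gt0_muley ?lte_fin.
    - by rewrite gt0_muleNy ?lte_fin.
  apply: leeD; first apply: leeD.
  - rewrite -[leRHS]mul1e lee_wpmul2r// lee_fin.
    have /andP[_ d1] := discount01 (alpha := alpha) L xi alpha0 w (grid_ge0 R n k).
    have /andP[d0 _] := discount01 (alpha := alpha) L xi alpha0 w (grid_ge0 R n k.+1).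
    by lra.
  - by rewrite leeBlDr// leeDl// lee_fin local_time_ge0.
  - apply: (@le_trans _ _ (L (xi j) (grid R n k.+1) w)%:E).
      by rewrite lee_fin gerBl local_time_ge0 ?grid_ge0.
    by apply: local_time_le_total; exact: grid_ge0.
rewrite -ge0_sume_distrl; last by move=> k _; rewrite lee_fin.
rewrite sumEFin (telescope_ord (fun k => A (grid R n k) w)).
rewrite grid0 additive_functional0 subr0 grid_last.
rewrite /A -sumEFin ge0_sume_distrl; last first.
  by move=> i _; rewrite lee_fin mulr_ge0// local_time_ge0.
apply: lee_sum => i _; rewrite EFinM -/T muleACA -EFinM [alpha 0 i * 3]mulrC.
rewrite lee_wpmul2l ?lee_fin ?mulr_ge0// lee_wpmul2r//.
exact: local_time_le_total.
Qed.

Let err_cvg0 j w : (forall i, tot (xi i) w \is a fin_num) ->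
  (err n j w @[n --> \oo] --> 0)%E.
Proof.
move=> fin; pose M := fine (tot (xi j) w); pose C := \sum_i alpha 0 i * fine (tot (xi i) w).
have LM t : 0 <= t -> L (xi j) t w <= M.
  by move=> t0; rewrite -lee_fin fineK//; exact: local_time_le_total.
have cA := @additive_functional_continuous _ _ _ _ _ _ L m alpha xi w.
have ndA := additive_functional_nd (alpha := alpha) L xi alpha0 w.
(* [e1] and [e3] are cross variations against the continuous A; [e2] is a bounded factor times the
   tail of the local time. *)
pose e1 n := \sum_(k < n.+1 ^ 2) (A (grid R n k.+1) w - A (grid R n k) w) *
  (D (grid R n k) w - D (grid R n k.+1) w).
pose e2 n := A n.+1%:R w * (M - L (xi j) n.+1%:R w).
pose e3 n := \sum_(k < n.+1 ^ 2) (A (grid R n k.+1) w - A (grid R n k) w) *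
  (L (xi j) (grid R n k.+1) w - L (xi j) (grid R n k) w).
have errE n : err n j w = (e1 n * M + e2 n + e3 n)%:E.
  have -> : e2 n = \sum_(k < n.+1 ^ 2) (A (grid R n k.+1) w - A (grid R n k) w) *
      (M - L (xi j) n.+1%:R w).
    rewrite -mulr_suml (telescope_ord (fun k => A (grid R n k) w)).
    by rewrite grid0 additive_functional0 subr0 grid_last.
  rewrite /e1 /e3 mulr_suml -!big_split /= -sumEFin; apply: eq_bigr => k _.
  rewrite -mulrA -!mulrDr EFinM; congr (_ * _)%E.
  by rewrite !EFinD !EFinM EFinN fineK.
have c1 : e1 n @[n --> \oo] --> 0.
  apply: (@cross_variation_cvg0 R (A ^~ w)
    (fun n k => D (grid R n k) w - D (grid R n k.+1) w) C 1) => //.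
  - by move=> t t0; exact: A_le.
  - move=> n k; apply: le_trans (discount_decr_ge L alpha xi (grid R n k) (grid R n k.+1) w).
    by rewrite mulr_ge0 ?expR_ge0// subr_ge0 ndA// ?grid_ge0// grid_le.
  - move=> n; rewrite (telescope_ordN (fun k => D (grid R n k) w)).
    have /andP[_ d1] := discount01 (alpha := alpha) L xi alpha0 w (grid_ge0 R n 0).
    have /andP[d0 _] := discount01 (alpha := alpha) L xi alpha0 w (grid_ge0 R n (n.+1 ^ 2)).
    by lra.
have c3 : e3 n @[n --> \oo] --> 0.
  apply: (@cross_variation_cvg0 R (A ^~ w)
    (fun n k => L (xi j) (grid R n k.+1) w - L (xi j) (grid R n k) w) C M) => //.
  - by move=> t t0; exact: A_le.
  - by move=> n k; rewrite subr_ge0 local_time_le// ?grid_ge0// grid_le.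
  - move=> n; rewrite (telescope_ord (fun k => L (xi j) (grid R n k) w)).
    have l0 := local_time_ge0 L (xi j) w (grid_ge0 R n 0).
    by have := LM _ (grid_ge0 R n (n.+1 ^ 2)); lra.
have cL : L (xi j) n.+1%:R w @[n --> \oo] --> M.
  have := @total_local_time_cvg _ _ _ _ _ _ L (xi j) w.
  rewrite -(cvg_shiftS (fun n => (L (xi j) n%:R w)%:E)) -(fineK (fin j)).
  exact: fine_cvg.
have c2 : e2 n @[n --> \oo] --> 0.
  have lim0 : C * (M - L (xi j) n.+1%:R w) @[n --> \oo] --> 0.
    rewrite (_ : 0 = C * (M - M)); last by rewrite subrr mulr0.
    by apply: cvgMr; apply: cvgB => //; exact: cvg_cst.
  apply: (squeeze_cvgr (f := cst 0) _ _ lim0); last exact: cvg_cst.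
  apply: nearW => n; rewrite /e2; have ML : 0 <= M - L (xi j) n.+1%:R w.
    by rewrite subr_ge0; exact: LM.
  by rewrite mulr_ge0 ?additive_functional_ge0//= ler_wpM2r// A_le.
rewrite (_ : (fun n => _) = (fun n => (e1 n * M + e2 n + e3 n)%:E)); last first.
  by apply/funext => n; exact: errE.
apply: cvg_EFin; first exact: nearW.
rewrite (_ : 0 = 0 * M + 0 + 0); last by rewrite mul0r !addr0.
by apply: cvgD => //; apply: cvgD => //; exact: cvgMl.
Qed.

Lemma integral_resolvent_error_cvg j : (\int[P a]_w err n j w @[n --> \oo] --> 0)%E.
Proof.
have [|||||_ _] := @dominated_convergence _ _ R (P a) setT measurableT
  (fun n w => err n j w) (cst 0%E) (majorant j).
- by move=> n; exact: measurable_resolvent_error.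
- exact: measurable_cst.
- have := total_finite_ae; apply: filterS => w fin _.
  exact: err_cvg0.
- exact: majorant_integrable.
- apply: aeW => w n _; rewrite gee0_abs; last exact: resolvent_error_ge0.
  exact: err_le_majorant.
- by rewrite integral_cst// mul0e.
Qed.

Lemma integral_resolvent_error_lty n j : (\int[P a]_w err n j w < +oo)%E.
Proof.
have /integrableP[_] := majorant_integrable j.
apply: le_lt_trans; apply: ge0_le_integral => //.
- by move=> w _; exact: resolvent_error_ge0.
- exact: measurable_resolvent_error.
- by apply: measurableT_comp => //; exact: (measurable_int _ (majorant_integrable j)).
- move=> w _; rewrite gee0_abs ?err_le_majorant//.
  by apply: le_trans (err_le_majorant n j w); exact: resolvent_error_ge0.
Qed.

End resolvent_limit.

(** * Solution of the linear system *)

Section resolvent_solution.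
Context {R : realType} {dE dO : measure_display}.
Context {E : measurableType dE} {Omega : measurableType dO}.
Context {X : markovProcess R E Omega}.
Variable L : localTime X.
Hypothesis transientL : transient L.
Local Notation P := (path_law X).
Variables (m : nat) (alpha : 'rV[R]_m.+1) (xi : 'I_m.+1 -> E).
Hypothesis alpha0 : forall i, 0 <= alpha 0 i.

Local Notation a := (xi ord0).
Local Notation V := (discounted_occupation L alpha xi).
Local Notation err := (resolvent_error L alpha xi).
Local Notation G := (green_mx (green L) xi).
Local Notation M := (resolvent_mx alpha G).

Let green_fine x y : egreen L x y = (green L x y)%:E.
Proof. by rewrite fineK// ge0_fin_numE ?egreen_ge0//; exact: transientL. Qed.

Let green_ge0 x y : 0 <= green L x y.
Proof. by rewrite fine_ge0// egreen_ge0. Qed.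

Let Ierr n j := (\int[P a]_w err n j w)%E.

Let Ierr_fin n j : Ierr n j \is a fin_num.
Proof.
rewrite ge0_fin_numE; last by apply: integral_ge0 => w _; exact: resolvent_error_ge0.
exact: integral_resolvent_error_lty.
Qed.

Let IL n j := (\int[P a]_w (L (xi j) n.+1%:R w)%:E)%E.

Let IL_fin n j : IL n j \is a fin_num.
Proof.
rewrite ge0_fin_numE; last by apply: integral_ge0 => w _; rewrite lee_fin local_time_ge0.
apply: le_lt_trans (transientL a (xi j)); rewrite egreenE; apply: ge0_le_integral => //.
- by move=> w _; rewrite lee_fin local_time_ge0.
- by apply/measurable_EFinP; exact: measurable_local_time.
- exact: measurable_total_path.
- by move=> w _; exact: local_time_le_total.
Qed.

Let V_fin n j : V n j \is a fin_num.
Proof.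
rewrite ge0_fin_numE ?discounted_occupation_ge0//.
have : (egreen L a (xi j) + Ierr n j < +oo)%E.
  by rewrite lte_add_pinfty ?transientL// -ge0_fin_numE//;
    apply: integral_ge0 => w _; exact: resolvent_error_ge0.
apply: le_lt_trans; apply: (le_trans _ (discounted_occupation_le transientL xi alpha0 j n)).
rewrite leeDl//; apply: sume_ge0 => i _; rewrite mule_ge0 ?lee_fin//.
by rewrite mule_ge0 ?lee_fin// discounted_occupation_ge0.
Qed.

Let v n i := fine (V n i).

Let defect n j := G ord0 j - (v n j + \sum_i v n i * alpha 0 i * G i j).

Let sumE n j : (V n j + \sum_i (alpha 0 i)%:E * (V n i * (green L (xi i) (xi j))%:E) =
  (v n j + \sum_i v n i * alpha 0 i * G i j)%:E)%E.
Proof.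
rewrite EFinD -sumEFin fineK//; congr (_ + _)%E; apply: eq_bigr => i _.
by rewrite -[V n i in LHS]fineK// -!EFinM mxE; congr (_%:E); rewrite /v; ring.
Qed.

(** Squeezed between minus the expected error and the part of g (a, x_j) contributed after time n +
    1. *)
Let defect_cvg j : defect n j @[n --> \oo] --> 0.
Proof.
have cIL : fine (IL n j) @[n --> \oo] --> green L a (xi j).
  apply: fine_cvg; rewrite -green_fine egreenE.
  have -> : (\int[P a]_w total_local_time L (xi j) w =
     \int[P a]_w limn (fun n => (L (xi j) n.+1%:R w)%:E))%E.
    apply: eq_integral => w _; apply/esym/cvg_lim => //.
    have := @total_local_time_cvg _ _ _ _ _ _ L (xi j) w.
    by rewrite -(cvg_shiftS (fun n => (L (xi j) n%:R w)%:E)).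
  apply: cvg_monotone_convergence => //.
  - by move=> n; apply/measurable_EFinP; exact: measurable_local_time.
  - by move=> n w _; rewrite lee_fin local_time_ge0.
  - by move=> w _ n k nk; rewrite lee_fin local_time_le// ler_nat.
have cE : fine (Ierr n j) @[n --> \oo] --> 0.
  by apply: fine_cvg; exact: integral_resolvent_error_cvg.
have lo : - fine (Ierr n j) @[n --> \oo] --> 0 by rewrite -oppr0; exact: cvgN.
have hi : green L a (xi j) - fine (IL n j) @[n --> \oo] --> 0.
  by rewrite -(subrr (green L a (xi j))); apply: cvgB => //; exact: cvg_cst.
apply: (squeeze_cvgr _ lo hi); apply: nearW => n.
have h1 := integral_local_time_le transientL xi alpha0 j n.
have h2 := discounted_occupation_le transientL xi alpha0 j n.
move: h1 h2; rewrite -/(IL n j) -/(Ierr n j) !sumE green_fine.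
rewrite -(fineK (IL_fin n j)) -(fineK (Ierr_fin n j)) -EFinD !lee_fin.
by rewrite /defect mxE => h1 h2; apply/andP; split; lra.
Qed.

(** Convergence of v_n is not known beforehand. The equation v_n M = (row a of G) - defect is solved
    for each n with the adjugate matrix, and the limit is taken in the resulting formula. *)
Lemma discounted_occupation_cvg : 0 < \det M ->
  (V n ord0 @[n --> \oo] --> (ddet0 alpha G / \det M)%:E)%E.
Proof.
move=> D0.
pose vv n : 'rV[R]_m.+1 := \row_i v n i.
pose rr n : 'rV[R]_m.+1 := \row_j (G ord0 j - defect n j).
have vM n : vv n *m M = rr n.
  apply/rowP => j; rewrite /resolvent_mx mulmxDr mulmx1 [LHS]mxE [RHS]mxE /defect subKr.
  congr (_ + _); first by rewrite mxE.
  by rewrite mxE; apply: eq_bigr => i _; rewrite mul_diag_mx !mxE mulrA.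
have v0 n : v n ord0 = (\sum_j (G ord0 j - defect n j) * cofactor M ord0 j) / \det M.
  have : vv n *m (M *m \adj M) = rr n *m \adj M by rewrite mulmxA vM.
  rewrite mul_mx_adj mul_mx_scalar => /rowP /(_ ord0); rewrite !mxE => h.
  apply/(canRL (mulfK _)); first by rewrite gt_eqF.
  by rewrite mulrC h; apply: eq_bigr => j _; rewrite !mxE.
rewrite (_ : (fun n => V n ord0) = (fun n => ((\sum_j (G ord0 j - defect n j) *
    cofactor M ord0 j) / \det M)%:E)); last first.
  by apply/funext => n; rewrite -v0 fineK.
apply: cvg_EFin; first exact: nearW.
apply: cvgMl; rewrite /ddet0.
apply: cvg_big => [|j _]; first exact: add_continuous.
apply: cvgMl; rewrite -[X in _ --> X]subr0.
by apply: cvgB; [exact: cvg_cst|exact: defect_cvg].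
Qed.

End resolvent_solution.

(** * The tilted law *)

Section fixed_time.
Context {R : realType} {dE dO : measure_display}.
Context {E : measurableType dE} {Omega : measurableType dO}.
Context {X : markovProcess R E Omega}.
Variable L : localTime X.
Local Notation tot := (total_local_time L).
Local Notation P := (path_law X).

Section position.
Variables (t : R).
Hypothesis t0 : 0 <= t.

(** The value [point] at the cemetery is harmless: in [markov_remaining] it is multiplied by the
    indicator of being alive. *)
Definition position (w : Omega) : E := odflt point (X t w).

Lemma measurable_position : measurable_fun setT position.
Proof.
move=> mT B mB; rewrite setTI.
have mS C : measurable C -> measurable (X t @^-1` (Some @` C)) by exact: path_measurable.
have [Bp|Bp] := pselect (B point).
  rewrite (_ : _ @^-1` B = X t @^-1` (Some @` B) `|` ~` (X t @^-1` (Some @` setT))).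
    by apply: measurableU; [exact: mS|apply: measurableC; exact: mS].
  apply/seteqP; split => w; rewrite /position /=; case: (X t w) => [y|] /=.
  - by move=> By; left; exists y.
  - by move=> _; right; case.
  - by case=> [[z Bz [<-]]//|[]]; exists y.
  - by [].
rewrite (_ : _ @^-1` B = X t @^-1` (Some @` B)); first exact: mS.
apply/seteqP; split => w; rewrite /position /=; case: (X t w) => [y|] //=.
- by move=> By; exists y.
- by case=> z Bz [<-].
- by case.
Qed.

(* The law of X started at the position at time t, as a kernel that ignores its
   second parameter, the level of a layer cake. *)
Definition restarted_law (p : Omega * measurableTypeR R) : {measure set Omega -> \bar R} :=
  law X (position p.1).

Let measurable_restarted_law U : measurable U -> measurable_fun setT (restarted_law ^~ U).
Proof.
move=> mU; apply: (measurableT_comp (f := fun y => law X y U)).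
  exact: measurable_kernel.
by apply: measurableT_comp; [exact: measurable_position|exact: measurable_fst].
Qed.

HB.instance Definition _ := isKernel.Build _ _ _ _ R restarted_law measurable_restarted_law.

HB.instance Definition _ := Kernel_isProbability.Build _ _ _ _ _ restarted_law
  (fun p => prob_kernel (position p.1)).

(** The starting point and the level vary together. Joint measurability, required by Tonelli, comes
    from the sections of a measurable set under a kernel. *)
Lemma measurable_restarted_tail z : measurable_fun setT
  (fun p : Omega * measurableTypeR R => P (position p.1) [set w | (p.2%:E <= tot z w)%E]).
Proof.
pose S : set ((Omega * measurableTypeR R) * Omega) :=
  [set q | (q.1.2%:E <= tot z q.2)%E].
have mS : measurable S.
  rewrite -[X in measurable X]setTI; apply: measurable_lee => //.
    apply/measurable_EFinP; apply: (measurableT_comp (f := snd)); first exact: measurable_snd.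
    exact: measurable_fst.
  by apply: measurableT_comp; [exact: measurable_total_path|exact: measurable_snd].
have := @measurable_fun_xsection_finite_kernel _ _ _ _ R restarted_law S.
rewrite inE => /(_ mS); apply: eq_measurable_fun => p _.
rewrite /path_law /restarted_law; congr (law X _ _).
by apply/seteqP; split => w; rewrite /xsection /= inE.
Qed.

End position.

(** The Markov property at time t acts on the level sets of the remaining local time; Tonelli then
    reassembles the levels into the Green function started from X_t. *)
Lemma markov_remaining x z t A : 0 <= t -> natural_filtration X t A ->
  (\int[P x]_(w in A) (tot z w - (L z t w)%:E) =
   \int[P x]_(w in A) (if X t w is Some y then egreen L y z else 0))%E.
Proof.
move=> t0 FA.
have mA : measurable A := natural_filtration_measurable FA.
have malive : measurable [set w | X t w <> None].
  exact: natural_filtration_measurable (alive_in_filtration t0).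
have stopt : stopping_time X (fun=> t%:E) by exact: stopping_time_cst.
have rem0 w : (0 <= tot z w - (L z t w)%:E)%E by exact: remaining_ge0.
have mrem := measurable_remaining L z t0.
rewrite ge0_layer_cake_restrict//.
pose D : set (measurableTypeR R) := `]0%R, +oo[%classic.
pose k (p : Omega * measurableTypeR R) : \bar R :=
  ((\1_[set w | X t w <> None] p.1)%:E *
   P (position t p.1) [set w | (p.2%:E <= tot z w)%E])%E.
pose k1 (p : Omega * measurableTypeR R) : \bar R :=
  ((\1_A p.1)%:E * (\1_D p.2)%:E * k p)%E.
have mi (B : set Omega) : measurable B ->
    measurable_fun setT (fun p : Omega * measurableTypeR R => (\1_B p.1)%:E : \bar R).
  move=> mB; apply/measurable_EFinP; apply: measurableT_comp; last exact: measurable_fst.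
  exact: measurable_indic.
have mk : measurable_fun setT k.
  by apply: emeasurable_funM; [exact: mi|exact: measurable_restarted_tail].
have mk1 : measurable_fun setT k1.
  apply: emeasurable_funM => //; apply: emeasurable_funM; first exact: mi.
  have mD : measurable_fun (setT : set (measurableTypeR R)) (\1_D : measurableTypeR R -> R).
    by apply: measurable_indic; exact: measurable_itv.
  by apply/measurable_EFinP; exact: measurableT_comp mD measurable_snd.
have k0 p : (0 <= k p)%E by rewrite mule_ge0.
have k10 p : (0 <= k1 p)%E by rewrite !mule_ge0.
have level u : 0 < u -> P x (A `&` [set w | (u%:E <= tot z w - (L z t w)%:E)%E]) =
    (\int[P x]_w k1 (w, u))%E.
  move=> u0.
  have Du : u \in D by rewrite inE /D /= in_itv/= u0.
  have sB := @total_local_time_ge_natural _ _ _ _ _ _ L z u.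
  have mC : measurable [set w | stopped X (fun=> t%:E) w <> None /\
      [set w | (u%:E <= tot z w)%E] (Defs.shift X (fine t%:E) w)].
    by apply: (@natural_sigma_measurable _ _ _ _ _ X); exact: (shift_preimage_measurable stopt sB).
  transitivity (P x (A `&` [set w | stopped X (fun=> t%:E) w <> None /\
      [set w | (u%:E <= tot z w)%E] (Defs.shift X (fine t%:E) w)])).
    have [N [mN N0 HN]] := local_time_additive L x z.
    have tot_shift w : ~ N w -> tot z w = ((L z t w)%:E + tot z (Defs.shift X t w))%E.
      move=> Nw; apply: total_local_time_shift => // v v0.
      have : ~ (~` [set w | forall s t : R, 0 <= s -> 0 <= t ->
         L z (s + t) w = L z s w + L z t (Defs.shift X s w)]) w.
        by move=> h; apply: Nw; exact: HN.
      by move=> /contrapT /(_ t v t0 v0).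
    have mW : measurable [set w | (u%:E <= tot z w - (L z t w)%:E)%E].
      by rewrite -[X in measurable X]setTI; apply: measurable_lee.
    apply/eqP; rewrite eq_le; apply/andP; split; apply: (@measure_le_null _ _ _ _ _ _ N) => //;
      try exact: measurableI.
      move=> w [Aw /= uw]; have [Nw|Nw] := pselect (N w); [by right|left].
      split => //=; split; last by move: uw; rewrite tot_shift// addeAC subee// add0e.
      (* A path dead at t has no local time left, which excludes levels u > 0. *)
      move=> Xt; move: uw; rewrite (@total_local_time_dead _ _ _ _ _ _ L z t w t0 Xt) subee// lee_fin.
      by rewrite leNgt u0.
    move=> w [Aw /= [_ uw]]; have [Nw|Nw] := pselect (N w); [by right|left].
    by split => //=; rewrite tot_shift// addeAC subee// add0e.
  rewrite [LHS](strong_markov stopt (stopped_sigma_cst t0 FA) sB) integral_path_law.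
  rewrite integral_mkcond; apply: eq_integral => w _; rewrite patchE /k1 /k /= !indicE Du.
  case: (boolP (w \in A)) => _ /=; last by rewrite !mul0e.
  rewrite !mul1e /position /stopped.
  case Xw : (X t w) => [y|]; first by rewrite mem_set /= ?mul1e// Xw.
  by rewrite memNset /= ?mul0e// Xw.
transitivity (\int[lebesgue_measure]_u \int[P x]_w k1 (w, u))%E.
  rewrite [LHS]integral_mkcond; apply: eq_integral => u _; rewrite patchE.
  case: ifPn => uD; first by apply: level; move: uD; rewrite inE/= in_itv/= andbT.
  rewrite integral0_eq// => w _; rewrite /k1 /= !indicE.
  by rewrite (negbTE uD) mule0 mul0e.
rewrite -(fubini_tonelli k1 mk1 k10) [RHS]integral_mkcond.
apply: eq_integral => w _; rewrite patchE /k1 /= indicE.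
case: ifPn => wA; last by rewrite integral0_eq// => u _; rewrite !mul0e.
under eq_integral do rewrite mul1e.
transitivity (\int[lebesgue_measure]_(u in D) k (w, u))%E.
  rewrite [RHS]integral_mkcond; apply: eq_integral => u _; rewrite patchE indicE.
  by case: ifPn => _; rewrite ?mul1e ?mul0e.
rewrite /k /= indicE.
case Xw : (X t w) => [y|]; last first.
  by rewrite memNset /= ?Xw//; apply: integral0_eq => u _; rewrite mul0e.
rewrite mem_set /= ?Xw//; under eq_integral do rewrite mul1e.
rewrite egreenE (ge0_layer_cake_restrict _ measurableT)//; last 2 first.
- exact: measurable_total_path.
- by move=> w'; exact: total_local_time_ge0.
by apply: eq_integral => u _; rewrite setTI /position Xw.
Qed.

End fixed_time.

(** * The tilted law before the lifetime *)

Section tilted_law.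
Context {R : realType} {dE dO : measure_display}.
Context {E : measurableType dE} {Omega : measurableType dO}.
Context {X : markovProcess R E Omega}.
Variable L : localTime X.
Hypothesis transientL : transient L.
Local Notation tot := (total_local_time L).
Local Notation P := (path_law X).
Variable a : E.
Hypothesis ga_gt0 : 0 < green L a a.
Variable Pa : probability Omega R.
Hypothesis Pa_tilted : is_tilted_law L a Pa.
Local Notation g := (green L a a).
Local Notation alive t := [set w | X t w <> None].

Let malive t : 0 <= t -> measurable (alive t).
Proof. by move=> t0; exact: natural_filtration_measurable (alive_in_filtration t0). Qed.

(** By the Markov property, g (X_t, a) is the conditional expectation given F_t of the local time at
    a remaining after t, so this remaining local time can serve as density. *)
Lemma tilted_law_remaining t B : 0 <= t -> natural_filtration X t B ->
  Pa (B `&` alive t) = (g^-1%:E * \int[P a]_(w in B) (tot a w - (L a t w)%:E))%E.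
Proof.
move=> t0 FB; rewrite Pa_tilted// markov_remaining// integral_path_law.
have mB := natural_filtration_measurable FB.
rewrite -ge0_integralZl//.
- apply: eq_integral => w _; case: (X t w) => [y|]; last by rewrite mule0.
  by rewrite mulrC EFinM fineK// ge0_fin_numE ?egreen_ge0//; exact: transientL.
- apply: measurable_funTS.
  have stopt : stopping_time X (fun=> t%:E) by exact: stopping_time_cst.
  apply: (measurable_stopped_comp stopt (h := fun y => egreen L y a)).
  apply: measurable_fun_integral_kernel => //; last exact: measurable_total_path.
    by move=> U mU; exact: measurable_kernel.
  by move=> w; exact: total_local_time_ge0.
- by move=> w _; case: (X t w) => // y; exact: egreen_ge0.
- by rewrite lee_fin invr_ge0 ltW.
Qed.

Lemma tilted_law_integral (f : Omega -> R) t : 0 <= t ->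
  measurable_fun (setT : set (filtered X t)) f -> (forall w, 0 <= f w) ->
  (\int[Pa]_w (f w * \1_(alive t) w)%:E =
   g^-1%:E * \int[P a]_w ((f w)%:E * (tot a w - (L a t w)%:E)))%E.
Proof.
move=> t0 mf f0.
have mfe : measurable_fun setT (fun w => (f w)%:E).
  by apply/measurable_EFinP; exact: measurable_fun_filtered mf.
have f0e w : (0 <= (f w)%:E)%E by rewrite lee_fin.
have rem0 w : (0 <= tot a w - (L a t w)%:E)%E by exact: remaining_ge0.
have mrem := measurable_remaining L a t0.
under eq_integral do rewrite EFinM.
have mi : measurable_fun setT (fun w => (\1_(alive t) w)%:E : \bar R).
  by apply/measurable_EFinP; apply: measurable_indic; exact: malive.
rewrite (ge0_layer_cake Pa mfe f0e mi)// (ge0_layer_cake (P a) mfe f0e mrem rem0).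
rewrite -ge0_integralZl//.
- apply: eq_integral => r _.
  have Fr : natural_filtration X t [set w | (r%:E <= (f w)%:E)%E].
    have := mf measurableT `[r, +oo[%classic (measurable_itv _); rewrite setTI.
    rewrite (_ : f @^-1` _ = [set w | (r%:E <= (f w)%:E)%E])//.
    by apply/seteqP; split => w; rewrite /= in_itv/= andbT lee_fin.
  rewrite -(tilted_law_remaining t0 Fr) integral_indic ?(setIC (alive t))//.
  - exact: natural_filtration_measurable Fr.
  - exact: malive.
- exact: measurable_fun_layer.
- by move=> r _; exact: integral_ge0.
- by rewrite lee_fin invr_ge0 ltW.
Qed.

Lemma integral_remaining_cvg :
  (\int[P a]_w (tot a w - (L a n%:R w)%:E) @[n --> \oo] --> 0)%E.
Proof.
have tot_int : (P a).-integrable setT (tot a).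
  apply/integrableP; split; first exact: measurable_total_path.
  under eq_integral do rewrite gee0_abs ?total_local_time_ge0//.
  by rewrite -egreenE; exact: transientL.
have [|||||_ _] := @dominated_convergence _ _ R (P a) setT measurableT
  (fun n w => tot a w - (L a n%:R w)%:E)%E (cst 0%E) (tot a).
- by move=> n; exact: measurable_remaining.
- exact: measurable_cst.
- have := integrable_ae measurableT tot_int; apply: filterS => w /(_ I) fin _.
  rewrite -(subee fin); apply: cvgeB => //; first by rewrite fin_num_adde_defl ?fin_numN.
    exact: cvg_cst.
  exact: total_local_time_cvg.
- exact: tot_int.
- apply: aeW => w n _; rewrite gee0_abs ?remaining_ge0// leeBlDr// leeDl//.
  by rewrite lee_fin local_time_ge0.
- by rewrite integral_cst// mul0e.
Qed.

(** The probability of being alive at n is the expected local time at a remaining after n, divided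
    by g (a, a), and the total local time is integrable by transience. *)
Lemma tilted_law_alive_cvg : (Pa (alive n%:R) @[n --> \oo] --> 0)%E.
Proof.
rewrite (_ : (fun n => _) =
    (fun n => g^-1%:E * \int[P a]_w (tot a w - (L a n%:R w)%:E))%E); last first.
  apply/funext => n; rewrite -(setTI (alive _)) tilted_law_remaining//.
  exact: (@measurableT _ (filtered X n%:R)).
rewrite -[X in _ --> X](mule0 g^-1%:E).
by apply: cvgeZl => //; exact: integral_remaining_cvg.
Qed.

Lemma tilted_law_dies : Pa (\bigcap_n alive n%:R) = 0%E.
Proof.
have mI : measurable (\bigcap_n alive n%:R).
  by apply: bigcapT_measurable => n; exact: malive.
apply/eqP; rewrite eq_le measure_ge0 andbT.
apply: (cvge_to_ge tilted_law_alive_cvg); apply: nearW => n.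
by apply: le_measure; rewrite ?inE//; [exact: malive|move=> w; exact].
Qed.

Lemma tilted_law_starts : Pa (~` alive 0) = 0%E.
Proof.
have h : Pa (alive 0) = 1%E.
  rewrite -(setTI (alive 0)) tilted_law_remaining//; last exact: (@measurableT _ (filtered X 0)).
  under eq_integral do rewrite local_time0 sube0.
  rewrite -egreenE -(fineK (_ : egreen L a a \is a fin_num)).
    by rewrite -EFinM mulVf// gt_eqF.
  by rewrite ge0_fin_numE ?egreen_ge0//; exact: transientL.
by rewrite probability_setC ?h ?subee//; exact: malive.
Qed.

End tilted_law.

(** * Laplace transform of the total local times under the tilted law *)

Section tilted_laplace.
Context {R : realType} {dE dO : measure_display}.
Context {E : measurableType dE} {Omega : measurableType dO}.
Context {X : markovProcess R E Omega}.
Variable L : localTime X.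
Hypothesis transientL : transient L.
Local Notation tot := (total_local_time L).
Local Notation P := (path_law X).
Variables (m : nat) (alpha : 'rV[R]_m.+1) (xi : 'I_m.+1 -> E).
Hypothesis alpha0 : forall i, 0 <= alpha 0 i.
Local Notation a := (xi ord0).
Hypothesis ga_gt0 : 0 < green L a a.
Variable Pa : probability Omega R.
Hypothesis Pa_tilted : is_tilted_law L a Pa.
Local Notation g := (green L a a).
Local Notation alive t := [set w | X t w <> None].
Local Notation A := (additive_functional L alpha xi).
Local Notation D := (discount L alpha xi).
Local Notation V := (discounted_occupation L alpha xi).
Local Notation W := (discounted_increment L alpha xi).
Local Notation M := (resolvent_mx alpha (green_mx (green L) xi)).

Definition total_discount (w : Omega) : R :=
  expR (- \sum_i alpha 0 i * total_local_time_path L w (xi i)).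

(** The indicator of dying between two consecutive grid times, written as a difference so that sums
    telescope. *)
Definition killed n k (w : Omega) : R :=
  \1_(alive (grid R n k)) w - \1_(alive (grid R n k.+1)) w.

Let malive t : 0 <= t -> measurable (alive t).
Proof. by move=> t0; exact: natural_filtration_measurable (alive_in_filtration t0). Qed.

Let malive1 t : 0 <= t -> measurable_fun setT (\1_(alive t) : Omega -> R).
Proof. by move=> t0; apply: measurable_indic; exact: malive. Qed.

Let mD t : 0 <= t -> measurable_fun setT (D t).
Proof.
by move=> t0; exact: measurable_fun_filtered (@measurable_discount _ _ _ _ _ _ L m alpha xi t t0).
Qed.

Let alive_le s t w : 0 <= s -> s <= t -> \1_(alive t) w <= \1_(alive s) w :> R.
Proof.
move=> s0 st; rewrite !indicE ler_nat.
have [wt|] := boolP (w \in alive t); last by [].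
rewrite mem_set//= => Xs; move: wt; rewrite inE /=; apply.
exact: path_cemetery s0 st Xs.
Qed.

Let killed_ge0 n k w : 0 <= killed n k w.
Proof. by rewrite subr_ge0 alive_le ?grid_ge0// grid_le. Qed.

Let mDalive s t : 0 <= s -> 0 <= t ->
  measurable_fun setT (fun w => D s w * \1_(alive t) w).
Proof. by move=> s0 t0; apply: measurable_funM; [exact: mD|exact: malive1]. Qed.

Let D01 t w : 0 <= t -> 0 <= D t w <= 1.
Proof. by move=> t0; exact: discount01. Qed.

Let Dalive_int s t : 0 <= s -> 0 <= t ->
  Pa.-integrable setT (EFin \o (fun w => D s w * \1_(alive t) w)).
Proof.
move=> s0 t0; apply: (@bounded_integrable _ _ _ _ _ 1); first exact: mDalive.
move=> w; have /andP[d0 d1] := D01 w s0.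
rewrite ger0_norm ?mulr_ge0//; rewrite indicE.
by case: (_ \in _); rewrite ?mulr1 ?mulr0.
Qed.

(** Subtracting [tilted_law_integral] at the two ends of the interval leaves the increment of L^a:
    the death time under the tilted law corresponds to dL^a / g (a, a) under P_a. *)
Lemma tilted_killed n k :
  (\int[Pa]_w (D (grid R n k) w * killed n k w)%:E =
   g^-1%:E * \int[P a]_w (W n ord0 k w)%:E)%E.
Proof.
set s := grid R n k; set t := grid R n k.+1.
have s0 : 0 <= s := grid_ge0 R n k.
have t0 : 0 <= t := grid_ge0 R n k.+1.
have st : s <= t := grid_le R n k.
have mDs : measurable_fun (setT : set (filtered X s)) (D s).
  exact: measurable_discount.
have D0 w : 0 <= D s w by exact: expR_ge0.
have E1 := tilted_law_integral transientL ga_gt0 Pa_tilted s0 mDs D0.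
have E2 := tilted_law_integral transientL ga_gt0 Pa_tilted t0
  (measurable_fun_filtered_le st mDs) D0.
have mWe : measurable_fun setT (fun w => (W n ord0 k w)%:E).
  apply/measurable_EFinP; apply: measurable_funM; first exact: mD.
  by apply: measurable_funB; exact: measurable_local_time.
have W0 w : (0 <= (W n ord0 k w)%:E)%E.
  by rewrite lee_fin mulr_ge0// subr_ge0 local_time_le.
have mR : measurable_fun setT (fun w => (D s w)%:E * (tot a w - (L a t w)%:E))%E.
  apply: emeasurable_funM; last exact: measurable_remaining.
  by apply/measurable_EFinP; exact: mD.
have R0 w : (0 <= (D s w)%:E * (tot a w - (L a t w)%:E))%E.
  by rewrite mule_ge0 ?lee_fin// remaining_ge0.
have split_rem w : ((D s w)%:E * (tot a w - (L a s w)%:E) =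
    (W n ord0 k w)%:E + (D s w)%:E * (tot a w - (L a t w)%:E))%E.
  rewrite /discounted_increment -/s -/t EFinM -ge0_muleDr; last 2 first.
  - by rewrite lee_fin subr_ge0 local_time_le.
  - exact: remaining_ge0.
  by congr (_ * _)%E; rewrite EFinB [RHS]addeC [RHS]addeA subeK.
under eq_integral do rewrite mulrBr EFinB.
rewrite integralB_EFin//; [|exact: Dalive_int|exact: Dalive_int].
have E3 : (\int[P a]_w ((D s w)%:E * (tot a w - (L a s w)%:E)) =
    \int[P a]_w ((W n ord0 k w)%:E + (D s w)%:E * (tot a w - (L a t w)%:E)))%E.
  by apply: eq_integral => w _; exact: split_rem.
rewrite E1 E3  ge0_integralD// ge0_muleDr ?integral_ge0// -E2 addeK//.
exact: integrable_fin_num (Dalive_int s0 t0).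
Qed.

Lemma tilted_killed_sum n :
  (\int[Pa]_w (\sum_(k < n.+1 ^ 2) D (grid R n k) w * killed n k w)%:E =
   g^-1%:E * V n ord0)%E.
Proof.
under eq_integral do rewrite -sumEFin.
rewrite ge0_integral_sum//; last 2 first.
- move=> k; apply/measurable_EFinP; apply: measurable_funM; first exact/mD/grid_ge0.
  by apply: measurable_funB; apply: malive1; exact: grid_ge0.
- by move=> k w _; rewrite lee_fin mulr_ge0 ?expR_ge0.
under eq_bigr do rewrite tilted_killed.
rewrite /V ge0_sume_distrr// => k _; apply: integral_ge0 => w _.
by rewrite lee_fin mulr_ge0 ?expR_ge0// subr_ge0 local_time_le ?grid_ge0// grid_le.
Qed.

(** Local times are frozen after death, so D at the right end of the interval of death is already
    the final value. Evaluating D at the left end costs a cross variation of D against the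
    indicators [killed]. *)
Lemma killed_sum_cvg w : X 0 w <> None -> (exists T, 0 <= T /\ X T w = None) ->
  \sum_(k < n.+1 ^ 2) D (grid R n k) w * killed n k w @[n --> \oo] --> total_discount w.
Proof.
move=> X0 [T [T0 XT]].
have D_dead s : 0 <= s -> X s w = None -> D s w = total_discount w.
  move=> s0 Xs; congr (expR (- _)); apply: eq_bigr => i _; congr (_ * _).
  by rewrite /total_local_time_path (@total_local_time_dead _ _ _ _ _ _ L _ _ _ s0 Xs).
(* The sign gives a nondecreasing function, as [cross_variation_cvg0] requires. *)
pose f t := - D t w.
have cf : {within `[0, +oo[, continuous f}.
  have cA : {within `[0, +oo[, continuous (A ^~ w)}.
    exact: (@additive_functional_continuous _ _ _ _ _ _ L m alpha xi w).
  move=> c; apply: (@continuous_cvg _ R R _ _ (A ^~ w) (fun x => - expR (- x)) _ _ (cA c)).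
    exact: nbhs_subspace_filter.
  apply: cvgN; apply: (@continuous_comp R R R -%R expR); last exact: continuous_expR.
  exact: opp_continuous.
have ndf : nondecr_ge0 f.
  by move=> s t s0 st; rewrite lerN2 ler_expR lerN2; exact: additive_functional_nd.
have f0 t : 0 <= t -> f t <= 0 by move=> t0; rewrite oppr_le0 expR_ge0.
have ks n : \sum_(k < n.+1 ^ 2) killed n k w = \1_(alive 0) w - \1_(alive n.+1%:R) w.
  rewrite (telescope_ordN (fun k => \1_(alive (grid R n k)) w)).
  by rewrite grid0 grid_last.
have kM n : \sum_(k < n.+1 ^ 2) killed n k w <= 1.
  by rewrite ks !indicE; case: (_ \in _); case: (_ \in _); rewrite ?subr0 ?subrr ?sub0r//; lra.
have h : total_discount w + \sum_(k < n.+1 ^ 2) (f (grid R n k.+1) - f (grid R n k)) *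
    killed n k w @[n --> \oo] --> total_discount w.
  rewrite -[X in _ --> X]addr0; apply: cvgD; first exact: cvg_cst.
  exact: cross_variation_cvg0 cf ndf f0 (fun n k => killed_ge0 n k w) kM.
apply: cvg_trans h; apply: near_eq_cvg; near=> n.
have TN : T <= n.+1%:R.
  by rewrite (@le_trans _ _ n%:R) ?ler_nat//; near: n; exact: nbhs_infty_ger.
(* Once the horizon is past the death, the indicators add up to 1 and the final value can be
   distributed over them. *)
have k1 : \sum_(k < n.+1 ^ 2) killed n k w = 1.
  rewrite ks indicE mem_set// indicE memNset ?subr0// => h.
  by apply: h; exact: path_cemetery T0 TN XT.
rewrite -[total_discount w]mulr1 -k1 mulr_sumr -big_split /=.
apply: eq_bigr => k _; rewrite -mulrDl /f opprK.
(* Only the interval of death contributes, and X is dead at its right end. *)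
have [kd|] := eqVneq (killed n k w) 0; first by rewrite kd !mulr0.
rewrite /killed !indicE => kn; congr (_ * _).
have dead : X (grid R n k.+1) w = None.
  apply: contrapT => Xk1; move: kn.
  have -> : w \in alive (grid R n k.+1) by rewrite inE.
  have -> : w \in alive (grid R n k); last by rewrite subrr eqxx.
  by rewrite inE => Xk; apply: Xk1; exact: path_cemetery (grid_ge0 R n k) (grid_le R n k) Xk.
by rewrite (D_dead _ (grid_ge0 R n k.+1) dead); ring.
Unshelve. all: by end_near. Qed.

Lemma tilted_total_discount : 0 < \det M ->
  (\int[Pa]_w (total_discount w)%:E =
   (ddet0 alpha (green_mx (green L) xi) / (g * \det M))%:E)%E.
Proof.
move=> D0.
pose f n w := \sum_(k < n.+1 ^ 2) D (grid R n k) w * killed n k w.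
have mf n : measurable_fun setT (f n).
  apply: measurable_sum => k; apply: measurable_funM; first exact/mD/grid_ge0.
  by apply: measurable_funB; apply: malive1; exact: grid_ge0.
have f1 n w : `|f n w| <= 1.
  rewrite ger0_norm; last by rewrite sumr_ge0// => k _; rewrite mulr_ge0 ?expR_ge0.
  apply: (@le_trans _ _ (\sum_(k < n.+1 ^ 2) killed n k w)).
    apply: ler_sum => k _; rewrite ler_piMl//.
    by have /andP[] := D01 w (grid_ge0 R n k).
  rewrite (telescope_ordN (fun k => \1_(alive (grid R n k)) w)).
  by rewrite !indicE; case: (_ \in _); case: (_ \in _); rewrite ?subr0 ?subrr ?sub0r//; lra.
have mtd : measurable_fun setT total_discount.
  apply: measurableT_comp => //; apply: measurableT_comp => //.
  apply: measurable_sum => i; apply: measurable_funM => //.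
  by apply: measurableT_comp => //; exact: measurable_total_path.
have c1 : (\int[Pa]_w (f n w)%:E @[n --> \oo] --> \int[Pa]_w (total_discount w)%:E)%E.
  have [|||||_ _] := @dominated_convergence _ _ R Pa setT measurableT
    (fun n w => (f n w)%:E) (EFin \o total_discount) (cst 1%E); last by [].
  - by move=> n; exact/measurable_EFinP.
  - exact/measurable_EFinP.
  (* The exceptional paths are dead at time 0 or alive at all integer times. *)
  - exists ((~` alive 0) `|` \bigcap_n alive n%:R); split.
    + apply: measurableU; first by apply: measurableC; exact: malive.
      by apply: bigcapT_measurable => n; exact: malive.
    + rewrite measureU0//.
      * exact: (tilted_law_starts transientL ga_gt0 Pa_tilted).
      * by apply: measurableC; exact: malive.
      * by apply: bigcapT_measurable => n; exact: malive.
      * exact: (tilted_law_dies transientL ga_gt0 Pa_tilted).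
    + move=> w /= nw; apply: contrapT => /not_orP[/contrapT X0 dies].
      apply: nw => _; apply: cvg_EFin; first exact: nearW.
      apply: killed_sum_cvg => //; apply: contrapT => h.
      by apply: dies => n _ /= Xn; apply: h; exists n%:R.
  - exact: finite_measure_integrable_cst.
  - by apply: aeW => w n _; rewrite /= lee_fin.
have c2 : (\int[Pa]_w (f n w)%:E @[n --> \oo] -->
    (g^-1%:E * (ddet0 alpha (green_mx (green L) xi) / \det M)%:E))%E.
  rewrite (_ : (fun n => _) = (fun n => g^-1%:E * V n ord0)%E); last first.
    by apply/funext => n; exact: tilted_killed_sum.
  by apply: cvgeZl => //; exact: discounted_occupation_cvg.
rewrite (cvg_unique (@ereal_hausdorff R) c1 c2) -EFinM; congr (_%:E).
by rewrite invfM; ring.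
Qed.

End tilted_laplace.

(** * The isomorphism *)

Section weighted_image.
Local Open Scope ereal_scope.
Context d1 d2 (T1 : measurableType d1) (T2 : measurableType d2) (R : realType).
Variables (mu : {sigma_finite_measure set T1 -> \bar R}) (phi : T1 -> T2) (h : T1 -> \bar R).
Hypothesis mphi : measurable_fun setT phi.
Hypothesis mh : measurable_fun setT h.
Hypothesis h0 : forall x, 0 <= h x.
Hypothesis hfin : \int[mu]_x h x < +oo.

(* The hypotheses are arguments so that the measure structure can be inferred. *)
Definition weighted_image of measurable_fun setT phi & measurable_fun setT h &
  (forall x, 0 <= h x) & \int[mu]_x h x < +oo : set T2 -> \bar R :=
  fun B => \int[mu]_(x in phi @^-1` B) h x.

Local Notation nu := (weighted_image mphi mh h0 hfin).

Let mpre B : measurable B -> measurable (phi @^-1` B).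
Proof. by move=> mB; rewrite -[X in measurable X]setTI; exact: mphi. Qed.

Let weighted_image0 : nu set0 = 0.
Proof. by rewrite /weighted_image preimage_set0 integral_set0. Qed.

Let weighted_image_ge0 B : 0 <= nu B.
Proof. exact: integral_ge0. Qed.

Let weighted_image_sigma_additive : semi_sigma_additive nu.
Proof.
move=> F mF tF mUF; rewrite /weighted_image preimage_bigcup.
rewrite ge0_integral_bigcup//; last 3 first.
- by move=> n; exact: mpre.
- exact: measurable_funTS.
- apply/trivIsetP => /= i j _ _ ij; rewrite -preimage_setI.
  by move/trivIsetP : tF => /(_ _ _ _ _ ij) ->//; rewrite preimage_set0.
by apply: is_cvg_nneseries => n _ _; exact: integral_ge0.
Qed.

HB.instance Definition _ := isMeasure.Build _ _ _ nu
  weighted_image0 weighted_image_ge0 weighted_image_sigma_additive.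

Let weighted_image_finite : fin_num_fun nu.
Proof.
apply: lty_fin_num_fun; rewrite /= /weighted_image preimage_setT; exact: hfin.
Qed.

HB.instance Definition _ := Measure_isFinite.Build _ _ _ nu weighted_image_finite.

(** Layer cakes on both sides reduce the formula to level sets of [f], where it is the definition of
    the image. *)
Lemma ge0_integral_weighted_image (f : T2 -> \bar R) :
  measurable_fun setT f -> (forall y, 0 <= f y) ->
  \int[nu]_y f y = \int[mu]_x (f (phi x) * h x).
Proof.
move=> mf f0.
have mfphi : measurable_fun setT (f \o phi) by exact: measurableT_comp.
rewrite (ge0_layer_cake mu mfphi (fun x => f0 (phi x)))//.
rewrite (ge0_layer_cake_restrict nu measurableT)//.
by apply: eq_integral => r _; rewrite setTI.
Qed.

End weighted_image.

(** * Path space with the evaluation sigma-algebra *)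

Section path_space.
Context {R : realType} {dE : measure_display}.
Variable E : measurableType dE.

Definition path_space := {mfun E >-> R}.

HB.instance Definition _ := Choice.on path_space.
HB.instance Definition _ := isPointed.Build path_space (0 : {mfun E >-> R}).

Definition evaluations : set (set path_space) := [set A | exists (x : E) (B : set R),
  measurable B /\ A = [set f : {mfun E >-> R} | B (f x)] ].

Definition measured_path_space := g_sigma_algebraType evaluations.

(** [laplace_measure_unique] applies to functions that are nonnegative on the whole space, while a
    path may take negative values. Both laws to be compared are carried by nonnegative paths, which
    [abs_path] fixes, so the coordinates f x are replaced by their absolute values. *)
Definition abs_path_fun (f : {mfun E >-> R}) (x : E) : R := `|f x|.

Let measurable_abs_path (f : {mfun E >-> R}) : measurable_fun setT (abs_path_fun f).
Proof. exact: measurableT_comp. Qed.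

HB.instance Definition _ (f : {mfun E >-> R}) :=
  isMeasurableFun.Build _ _ _ _ (abs_path_fun f) (measurable_abs_path f).

Definition abs_path (f : {mfun E >-> R}) : {mfun E >-> R} := abs_path_fun f.

Lemma abs_path_id (f : {mfun E >-> R}) : (forall x, 0 <= f x) -> abs_path f = f.
Proof. by move=> f0; apply/mfuneqP => x; rewrite /abs_path /= /abs_path_fun ger0_norm. Qed.

Lemma evaluation_sigma_abs_path (B : set {mfun E >-> R}) : evaluation_sigma B ->
  <<s [set A | exists (i : E) C, measurable C /\
     A = (fun f : measured_path_space => `|(f : {mfun E >-> R}) i|) @^-1` C] >> (abs_path @^-1` B).
Proof.
set G := [set A | _]; move=> sB.
change ([set B | <<s G >> (abs_path @^-1` B)] B).
apply: smallest_sub sB; last first.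
  by move=> _ [x [C [mC ->]]]; apply: sub_sigma_algebra; exists x, C.
have sG : sigma_algebra setT <<s G >> by exact: smallest_sigma_algebra.
rewrite (_ : mkset _ = image_set_system setT abs_path <<s G >>).
  exact: (@sigma_algebra_image {mfun E >-> R} {mfun E >-> R} setT abs_path <<s G >> sG).
by apply/seteqP; split => C; rewrite /image_set_system /= setTI.
Qed.

Lemma measurable_evaluation (x : E) :
  measurable_fun setT (fun f : measured_path_space => (f : {mfun E >-> R}) x).
Proof.
by move=> mT B mB; rewrite setTI; apply: sub_sigma_algebra; exists x, B.
Qed.

Lemma measurable_to_path_space d (T : measurableType d) (phi : T -> {mfun E >-> R}) :
  (forall x, measurable_fun setT (fun t => phi t x)) ->
  measurable_fun setT (phi : T -> measured_path_space).
Proof.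
move=> mphi; apply: (@measurability _ _ T measured_path_space setT phi evaluations) => //.
move=> _ [_ [x [B [mB ->]]] <-].
by rewrite setTI; have := mphi x measurableT B mB; rewrite setTI.
Qed.

End path_space.

Section isomorphism.
Context {R : realType} {dE dO dQ : measure_display}.
Context {E : measurableType dE} {Omega : measurableType dO} {S : measurableType dQ}.
Context {X : markovProcess R E Omega} {L : localTime X}.
Hypothesis transientL : transient L.
Context {Q : probability S R} {psi : S -> {mfun E >-> R}}.
Hypothesis psiP : permanental2 (green L) Q psi.
Variable a : E.
Hypothesis ga_gt0 : 0 < green L a a.
Context {Pa : probability Omega R}.
Hypothesis Pa_tilted : is_tilted_law L a Pa.

Local Notation g := (green L a a).

Let mpsi x : measurable_fun setT (fun s => psi s x).
Proof. by case: psiP => + _ _; exact. Qed.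

Let psi0 s x : 0 <= psi s x.
Proof. by case: psiP => _ + _; exact. Qed.

Let mtot x : measurable_fun setT (fun w => total_local_time_path L w x).
Proof. by apply: measurableT_comp => //; exact: measurable_total_path. Qed.

Let tot0 w x : 0 <= total_local_time_path L w x.
Proof. by rewrite fine_ge0// total_local_time_ge0. Qed.

Definition shifted_path (p : Omega * S) : {mfun E >-> R} :=
  total_local_time_mfun L p.1 + 2^-1 *: psi p.2.

Definition half_path (s : S) : {mfun E >-> R} := 2^-1 *: psi s.

Definition bias (s : S) : \bar R := (psi s a / g)%:E.

Let shifted_pathE p x : shifted_path p x = total_local_time_path L p.1 x + 2^-1 * psi p.2 x.
Proof. by []. Qed.

Let half_pathE s x : half_path s x = 2^-1 * psi s x.
Proof. by []. Qed.

Lemma measurable_shifted_path :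
  measurable_fun setT (shifted_path : Omega * S -> measured_path_space E).
Proof.
apply: measurable_to_path_space => x; apply: measurable_funD.
  exact: measurableT_comp (mtot x) measurable_fst.
apply: measurable_funM => //.
exact: measurableT_comp (mpsi x) measurable_snd.
Qed.

Lemma measurable_half_path :
  measurable_fun setT (half_path : S -> measured_path_space E).
Proof.
by apply: measurable_to_path_space => x; apply: measurable_funM => //; exact: mpsi.
Qed.

Let mbias : measurable_fun setT bias.
Proof. by apply/measurable_EFinP; apply: measurable_funM => //; exact: mpsi. Qed.

Let bias0 s : (0 <= bias s)%E.
Proof. by rewrite lee_fin divr_ge0// ltW. Qed.

(* The weights [s] are padded with a null weight at the point [a]. *)
Let xi (s : seq (R * E)) (i : 'I_(size s).+1) : E := nth a (a :: map snd s) i.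
Let alpha (s : seq (R * E)) : 'rV[R]_(size s).+1 :=
  \row_(i < (size s).+1) nth 0 (0 :: map fst s) i.

Let alpha_sum s (h : E -> R) :
  \sum_i alpha s 0 i * h (xi i) = \sum_(p <- s) p.1 * h p.2.
Proof.
rewrite big_ord_recl !mxE /= mul0r add0r (big_nth (0, a)) big_mkord.
apply: eq_bigr => i _; rewrite !mxE /xi lift0 /=.
by rewrite (nth_map (0, a))// (nth_map (0, a)).
Qed.

Let alpha_ge0 s : nonneg_weights s -> forall i, 0 <= alpha s 0 i.
Proof.
move=> s0 [[|i] /= ilt]; rewrite mxE //= (nth_map (0, a))//.
by apply: (allP s0); exact: mem_nth.
Qed.

Let det s := \det (resolvent_mx (alpha s) (green_mx (green L) (@xi s))).
Let ddet s := ddet0 (alpha s) (green_mx (green L) (@xi s)).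

Let det_gt0 s : nonneg_weights s -> 0 < det s.
Proof. by move=> s0; apply: (det_resolvent_gt0 psiP); exact: alpha_ge0. Qed.

Let laplace_total s : nonneg_weights s ->
  (\int[Pa]_w (expR (- \sum_(p <- s) p.1 * total_local_time_path L w p.2))%:E =
   (ddet s / (g * det s))%:E)%E.
Proof.
move=> s0; under eq_integral do rewrite -alpha_sum.
exact: (tilted_total_discount transientL (alpha_ge0 s0) ga_gt0 Pa_tilted (det_gt0 s0)).
Qed.

Let laplace_psi s : nonneg_weights s ->
  (\int[Q]_t (expR (- \sum_(p <- s) p.1 * (2^-1 * psi t p.2)))%:E =
   ((Num.sqrt (det s))^-1)%:E)%E.
Proof.
move=> s0; have [_ _ H] := psiP.
rewrite -[RHS](H _ (alpha s) (@xi s) (alpha_ge0 s0)).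
apply: eq_integral => t _; rewrite mulr_sumr -(alpha_sum s (fun x => 2^-1 * psi t x)).
by congr (expR (- _))%:E; apply: eq_bigr => i _; rewrite mulrCA.
Qed.

Let laplace_biased s : nonneg_weights s ->
  (\int[Q]_t ((expR (- \sum_(p <- s) p.1 * (2^-1 * psi t p.2)))%:E * bias t) =
   (ddet s / (g * det s * Num.sqrt (det s)))%:E)%E.
Proof.
move=> s0.
have H := size_biased_laplace psiP (@xi s) (alpha_ge0 s0).
transitivity (\int[Q]_t (g^-1%:E * (psi t a *
    expR (- (2^-1 * \sum_i alpha s 0 i * psi t (xi i))))%:E))%E.
  apply: eq_integral => t _; rewrite -!EFinM; congr (_%:E).
  rewrite -(alpha_sum s (fun x => 2^-1 * psi t x)) mulr_sumr.
  rewrite (eq_bigr (fun i => 2^-1 * (alpha s 0 i * psi t (xi i)))); first by ring.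
  by move=> i _; rewrite mulrCA.
rewrite ge0_integralZl//.
- rewrite [X in (_ * X)%E = _]H -EFinM; congr (_%:E).
  by rewrite -/(det s) -/(ddet s) !invfM; ring.
- apply/measurable_EFinP; apply: measurable_funM; first exact: mpsi.
  apply: measurableT_comp => //; apply: measurableT_comp => //.
  apply: measurable_funM => //; apply: measurable_sum => i.
  by apply: measurable_funM => //; exact: mpsi.
- by move=> t _; rewrite lee_fin mulr_ge0 ?expR_ge0.
- by rewrite lee_fin invr_ge0 ltW.
Qed.

Let PQ : probability (Omega * S)%type R := product_measure1 Pa Q.

Let mone : measurable_fun setT (cst 1%E : Omega * S -> \bar R).
Proof. exact: measurable_cst. Qed.

Let one0 (p : Omega * S) : (0 <= cst 1%E p :> \bar R)%E. Proof. by []. Qed.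

Let one_fin : (\int[PQ]_p (cst 1%E p) < +oo)%E.
Proof.
rewrite integral_cst// mul1e; apply: (@le_lt_trans _ _ 1%E); last exact: ltry.
by rewrite [leLHS](@probability_setT _ _ _ PQ).
Qed.

Let bias_fin : (\int[Q]_t bias t < +oo)%E.
Proof.
(* With no weights the exponential is 1, and the formula gives a finite mass. *)
have := @laplace_biased [::] isT.
under eq_integral do rewrite big_nil oppr0 expR0 mul1e.
by move=> ->; exact: ltry.
Qed.

Let m1 := weighted_image measurable_shifted_path mone one0 one_fin.
Let m2 := weighted_image measurable_half_path mbias bias0 bias_fin.

Let abs_eval (x : E) (f : measured_path_space E) : R := `|(f : {mfun E >-> R}) x|.

Let mabs_eval x : measurable_fun setT (abs_eval x).
Proof. by apply: measurableT_comp => //; exact: measurable_evaluation. Qed.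

Let shifted_ge0 p x : 0 <= shifted_path p x.
Proof. by rewrite shifted_pathE addr_ge0// mulr_ge0. Qed.

Let half_ge0 s x : 0 <= half_path s x.
Proof. by rewrite half_pathE mulr_ge0. Qed.

Let laplace_eq s : nonneg_weights s ->
  (\int[m1]_f (expR (- weighted_sum abs_eval s f))%:E =
   \int[m2]_f (expR (- weighted_sum abs_eval s f))%:E)%E.
Proof.
move=> s0.
have me : measurable_fun setT (fun f => (expR (- weighted_sum abs_eval s f))%:E).
  by apply/measurable_EFinP; apply: measurable_expN_weighted_sum => x; exact: mabs_eval.
rewrite !ge0_integral_weighted_image//.
have -> : (\int[Q]_t ((expR (- weighted_sum abs_eval s (half_path t)))%:E * bias t) =
    \int[Q]_t ((expR (- \sum_(p <- s) p.1 * (2^-1 * psi t p.2)))%:E * bias t))%E.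
  apply: eq_integral => t _; congr ((expR (- _))%:E * _)%E.
  by apply: eq_bigr => p _; rewrite /abs_eval ger0_norm.
rewrite laplace_biased//.
pose e1 w := expR (- \sum_(p <- s) p.1 * total_local_time_path L w p.2).
pose e2 t := expR (- \sum_(p <- s) p.1 * (2^-1 * psi t p.2)).
have me1 : measurable_fun setT e1.
  apply: measurableT_comp => //; apply: measurableT_comp => //.
  by apply: measurable_sum => p; apply: measurable_funM => //; exact: mtot.
have me2 : measurable_fun setT e2.
  apply: measurableT_comp => //; apply: measurableT_comp => //.
  apply: measurable_sum => p; apply: measurable_funM => //.
  by apply: measurable_funM => //; exact: mpsi.
(* Shifted paths are nonnegative, so the absolute values disappear and the exponential splits into a
   factor for each coordinate of the product space. *)
transitivity (\int[PQ]_q ((e1 q.1)%:E * (e2 q.2)%:E))%E.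
  apply: eq_integral => q _; rewrite mule1 -EFinM -expRD -opprD -big_split /=.
  congr (expR (- _))%:E; apply: eq_bigr => p _.
  by rewrite /abs_eval ger0_norm// shifted_pathE mulrDr.
have mee : measurable_fun setT (fun q : Omega * S => (e1 q.1)%:E * (e2 q.2)%:E)%E.
  apply: emeasurable_funM; apply/measurable_EFinP.
    exact: measurableT_comp me1 measurable_fst.
  exact: measurableT_comp me2 measurable_snd.
rewrite [LHS](fubini_tonelli1 _ mee); last by move=> q; rewrite mule_ge0 ?lee_fin ?expR_ge0.
rewrite /fubini_F /=.
under eq_integral => w _.
  rewrite ge0_integralZl//; last 3 first.
  - exact/measurable_EFinP.
  - by move=> t _; rewrite lee_fin expR_ge0.
  - by rewrite lee_fin expR_ge0.
  rewrite laplace_psi//.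
  over.
rewrite ge0_integralZr//; last 2 first.
- exact/measurable_EFinP.
- by move=> w _; rewrite lee_fin expR_ge0.
rewrite laplace_total// -EFinM; congr (_%:E).
by rewrite !invfM; ring.
Qed.

Let law_eq B : evaluation_sigma B -> m1 B = m2 B.
Proof.
move=> sB.
have e1 : shifted_path @^-1` (@abs_path _ _ E @^-1` B) = shifted_path @^-1` B.
  by apply/seteqP; split => p; rewrite /= abs_path_id.
have e2 : half_path @^-1` (@abs_path _ _ E @^-1` B) = half_path @^-1` B.
  by apply/seteqP; split => t; rewrite /= abs_path_id.
have : m1 (@abs_path _ _ E @^-1` B) = m2 (@abs_path _ _ E @^-1` B).
  apply: (laplace_measure_unique mabs_eval (fun x f => normr_ge0 _) laplace_eq).
  exact: evaluation_sigma_abs_path.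
by rewrite /m1 /m2 /weighted_image e1 e2.
Qed.

Lemma isomorphism_ge0 (F : {mfun E >-> R} -> \bar R) :
  measurable_functional F -> (forall f, 0 <= F f)%E ->
  (\int[Pa]_w \int[Q]_s F (shifted_path (w, s)) = \int[Q]_s (bias s * F (half_path s)))%E.
Proof.
move=> mF F0.
have mF' : measurable_fun (setT : set (measured_path_space E)) F.
  by move=> mT B mB; rewrite setTI; exact: mF.
have E1 := ge0_integral_weighted_image measurable_shifted_path mone one0 one_fin mF' F0.
have E2 := ge0_integral_weighted_image measurable_half_path mbias bias0 bias_fin mF' F0.
under [RHS]eq_integral do rewrite muleC.
transitivity (\int[m1]_f F f)%E; last first.
  by rewrite -E2; apply: eq_measure_integral => B mB _; exact: law_eq.
rewrite E1; transitivity (\int[PQ]_p F (shifted_path p))%E; last first.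
  by apply: eq_integral => p _; rewrite mule1.
rewrite [RHS](fubini_tonelli1 (fun p => F (shifted_path p)))//.
exact: (measurableT_comp mF' measurable_shifted_path).
Qed.

End isomorphism.

Lemma measurable_functional_funepos (R : realType) (dE : measure_display)
    (E : measurableType dE) (F : {mfun E >-> R} -> \bar R) :
  measurable_functional F ->
  measurable_functional (F^\+)%E /\ measurable_functional (F^\-)%E.
Proof.
move=> mF.
have mF' : measurable_fun (setT : set (measured_path_space E)) F.
  by move=> mT B mB; rewrite setTI; exact: mF.
split => B mB.
  by have := measurable_funepos mF' measurableT mB; rewrite setTI.
by have := measurable_funeneg mF' measurableT mB; rewrite setTI.
Qed.

(** * Bounded functionals of arbitrary sign *)

Section isomorphism_bounded.
Context {R : realType} {dE dO dQ : measure_display}.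
Context {E : measurableType dE} {Omega : measurableType dO} {S : measurableType dQ}.
Context {X : markovProcess R E Omega} {L : localTime X}.
Hypothesis transientL : transient L.
Context {Q : probability S R} {psi : S -> {mfun E >-> R}}.
Hypothesis psiP : permanental2 (green L) Q psi.
Variable a : E.
Hypothesis ga_gt0 : 0 < green L a a.
Context {Pa : probability Omega R}.
Hypothesis Pa_tilted : is_tilted_law L a Pa.

Local Notation shifted := (@shifted_path _ _ _ _ _ _ _ X L psi).
Local Notation half := (@half_path _ _ _ _ _ psi).
Local Notation bias := (@bias _ _ _ _ _ _ _ X L psi a).

Let inner (F : {mfun E >-> R} -> \bar R) w := (\int[Q]_s F (shifted (w, s)))%E.

Let integrable_inner (F : {mfun E >-> R} -> \bar R) (M : R) : measurable_functional F ->
  (forall f, 0 <= F f)%E -> (forall f, F f <= M%:E)%E -> Pa.-integrable setT (inner F).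
Proof.
move=> mF F0 FM.
have mF' : measurable_fun (setT : set (measured_path_space E)) F.
  by move=> mT B mB; rewrite setTI; exact: mF.
have mFs : measurable_fun setT (fun p => F (shifted p)).
  exact: (measurableT_comp mF' (measurable_shifted_path psiP)).
apply/integrableP; split.
  exact: (measurable_fun_fubini_tonelli_F (m2 := Q) (fun p => F (shifted p)) mFs).
apply: (@le_lt_trans _ _ (\int[Pa]_w (cst M%:E w))%E); last first.
  rewrite integral_cst//.
  by rewrite [X in (_ * X)%E](@probability_setT _ _ _ Pa) mule1 ltry.
apply: ge0_le_integral => //.
- apply: measurableT_comp => //.
  exact: (measurable_fun_fubini_tonelli_F (m2 := Q) (fun p => F (shifted p)) mFs).
- move=> w _; rewrite gee0_abs; last exact: integral_ge0.
  rewrite -[leRHS]mule1 -(probability_setT Q) -integral_cst//.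
  apply: ge0_le_integral => //.
  exact: (measurableT_comp mFs (measurable_pair1 w)).
Qed.

(** The nonnegative case is applied to the positive and negative parts of [F]. Boundedness makes
    both inner integrals integrable under [Pa], so that their difference can be taken inside the
    outer integral. *)
Lemma isomorphism_bounded (F : {mfun E >-> R} -> \bar R) (M : R) :
  measurable_functional F -> (forall f, `|F f| <= M%:E)%E ->
  (\int[Pa]_w \int[Q]_s F (shifted (w, s)) = \int[Q]_s (bias s * F (half s)))%E.
Proof.
move=> mF FM; have [mFp mFn] := measurable_functional_funepos mF.
have Fp0 f : (0 <= F^\+ f)%E by exact: funepos_ge0.
have Fn0 f : (0 <= F^\- f)%E by exact: funeneg_ge0.
have FpM f : (F^\+ f <= M%:E)%E.
  by apply: le_trans (FM f); rewrite funeposE ge_max lee_abs abse_ge0.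
have FnM f : (F^\- f <= M%:E)%E.
  by apply: le_trans (FM f); rewrite funenegE ge_max -abseN lee_abs abse_ge0.
rewrite [RHS]integralE.
have bias0 s : (0 <= bias s)%E.
  by rewrite lee_fin divr_ge0 ?(ltW ga_gt0)//; case: psiP.
have -> : (\int[Q]_s ((fun s => bias s * F (half s))^\+ s) =
    \int[Q]_s (bias s * F^\+ (half s)))%E.
  by apply: eq_integral => s _; rewrite !funeposE maxe_pMr ?mule0.
have -> : (\int[Q]_s ((fun s => bias s * F (half s))^\- s) =
    \int[Q]_s (bias s * F^\- (half s)))%E.
  by apply: eq_integral => s _; rewrite !funenegE -muleN maxe_pMr ?mule0.
rewrite -!(isomorphism_ge0 transientL psiP ga_gt0 Pa_tilted)//.
rewrite -integralB//; [|exact: integrable_inner FpM|exact: integrable_inner FnM].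
apply: eq_integral => w _; rewrite integralE; congr (_ - _)%E; apply: eq_integral => s _.
  by rewrite !funeposE.
by rewrite !funenegE.
Qed.

End isomorphism_bounded.

Unset Implicit Arguments.
Set Strict Implicit.
Set Printing Implicit Defensive.

Theorem theorem3p3 (R : realType) (dE dO dQ : measure_display)
    (E : measurableType dE) (Omega : measurableType dO) (S : measurableType dQ)
    (X : markovProcess R E Omega) (L : localTime X) (X_transient : transient L)
    (Q : probability S R) (psi : S -> {mfun E >-> R})
    (psi_permanental : permanental2 (green L) Q psi)
    (a : E) (ga_gt0 : 0 < green L a a)
    (Pa : probability Omega R) (Pa_tilted : is_tilted_law L a Pa)
    (F : {mfun E >-> R} -> \bar R) (F_measurable : measurable_functional F)
    (F_bounded_or_ge0 : (exists M : R, forall f, (`|F f| <= M%:E)%E) \/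
                        (forall f, (0 <= F f)%E)) :
  (\int[Pa]_w \int[Q]_s F (total_local_time_mfun L w + 2^-1 *: psi s)%R =
   \int[Q]_s ((psi s a / green L a a)%:E * F (2^-1 *: psi s)%R))%E.
Proof.
case: F_bounded_or_ge0 => [[M FM]|F0].
  exact: (isomorphism_bounded X_transient psi_permanental ga_gt0 Pa_tilted F_measurable FM).
exact: (isomorphism_ge0 X_transient psi_permanental ga_gt0 Pa_tilted F_measurable F0).
Qed.
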